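(* There exists no non-trivial group homomorphism $$\Phi\colon\langle\mathrm{PGL}_4(\mathbb{C}),\mathrm{W}_3\rangle\to\mathrm{Bir}(\mathbb{G}(1,3))$$ such that $\Phi(\mathrm{PGL}_4(\mathbb{C}))\subset\mathrm{Aut}(\mathbb{G}(1,3))$. In particular, neither the action of $\mathrm{PGL}_4(\mathbb{C})$ on $\mathbb{G}(1,3)$ given by the embedding $\varphi_G$ nor the action given by $\varphi_G\circ\alpha$ can be extended to a rational action of $\mathrm{Cr}_3$.
   Context: Everything is over $\mathbb{C}$. $\mathrm{Cr}_3=\mathrm{Bir}(\mathbb{P}^3)\supset\mathrm{PGL}_4(\mathbb{C})=\mathrm{Aut}(\mathbb{P}^3)$. $\mathrm{W}_3\simeq\mathrm{GL}_3(\mathbb{Z})$ is the subgroup of $\mathrm{Cr}_3$ of monomial transformations $(x_1^{a_{11}}x_2^{a_{12}}x_3^{a_{13}},\,x_1^{a_{21}}x_2^{a_{22}}x_3^{a_{23}},\,x_1^{a_{31}}x_2^{a_{32}}x_3^{a_{33}})$, $(a_{ij})\in\mathrm{GL}_3(\mathbb{Z})$, in the affine chart $x_0=1$; $\langle\mathrm{PGL}_4(\mathbb{C}),\mathrm{W}_3\rangle$ is the subgroup of $\mathrm{Cr}_3$ they generate. $\mathbb{G}(1,3)$ is the Grassmannian of lines in $\mathbb{P}^3$ and $\varphi_G\colon\mathrm{PGL}_4(\mathbb{C})\to\mathrm{Aut}(\mathbb{G}(1,3))$ is the natural action on lines. $\alpha$ is the automorphism $g\mapsto{}^tg^{-1}$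 of $\mathrm{PGL}_4(\mathbb{C})$. A rational action of $\mathrm{Cr}_3$ on a variety $M$ is a group homomorphism $\mathrm{Cr}_3\to\mathrm{Bir}(M)$. *)

(* Defs.v *)
From HB Require Import structures.
From mathcomp Require Import all_boot all_order all_algebra.
From mathcomp Require Import generic_quotient boolp mpoly ring.

Set Implicit Arguments.
Unset Strict Implicit.
Unset Printing Implicit Defensive.

Import GRing.Theory Num.Theory.
Local Open Scope ring_scope.
Local Open Scope quotient_scope.

(* Points of P^n are given by nonzero column vectors of homogeneous
   coordinates, up to a nonzero scalar. *)

Section Evaluation.
Context (K : numClosedFieldType).

Definition pev n (p : {mpoly K[n]}) (x : 'cV[K]_n) : K := p.@[fun i => x i 0].

Definition mev m n (F : 'cV[{mpoly K[n]}]_m) (x : 'cV[K]_n) : 'cV[K]_m :=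
  \col_i pev (F i 0) x.

Definition same_point n (x y : 'cV[K]_n) : Prop :=
  exists2 c : K, c != 0 & y = c *: x.

Lemma pevM n (p q : {mpoly K[n]}) x : pev (p * q) x = pev p x * pev q x.
Proof. exact: mevalM. Qed.

Lemma pevZ n d (p : {mpoly K[n]}) c x :
  p \is d.-homog -> pev p (c *: x) = c ^+ d * pev p x.
Proof.
move=> /dhomogP hp; rewrite /pev !mevalE big_distrr /= !big_seq.
apply: eq_bigr => m /hp <-; rewrite mulrCA; congr (_ * _).
rewrite /= mdegE -prodrXr -big_split /=.
by apply: eq_bigr => i _; rewrite mxE exprMn.
Qed.

Lemma dhomog_comp n m d e (p : {mpoly K[m]}) (F : 'cV[{mpoly K[n]}]_m) :
  (forall i, F i 0 \is e.-homog) -> p \is d.-homog ->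
  p \mPo [tuple F j 0 | j < m] \is (e * d).-homog.
Proof.
move=> hF /dhomogP hp; rewrite comp_mpolyEX big_seq; apply: rpred_sum => a ha.
apply: rpredZ; rewrite comp_mpolyX -(hp a ha) /= mdegE big_distrr /=.
elim/big_rec2: _ => [|i d' q _ hq]; first exact: dhomog1.
by apply: dhomogM => //; rewrite tnth_mktuple; apply: dhomogMn.
Qed.

Lemma mev_neq0 m n (F : 'cV[{mpoly K[n]}]_m) x :
  mev F x != 0 -> exists i, pev (F i 0) x != 0.
Proof.
move=> h; apply: contrapT => /forallNP h0; move/eqP: h; apply.
apply/matrixP => i j; rewrite !mxE.
by apply/eqP; apply: contrapT => /negP; apply: h0.
Qed.

Lemma mev_neq0i m n (F : 'cV[{mpoly K[n]}]_m) x i :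
  pev (F i 0) x != 0 -> mev F x != 0.
Proof. by apply: contra_neq => /matrixP/(_ i 0); rewrite !mxE. Qed.

Lemma poly_exneq0 (p : {poly K}) : p != 0 -> exists t, p.[t] != 0.
Proof.
move=> p0; apply: contrapT => /forallNP h.
have r : all (root p) [seq i%:R | i <- iota 0 (size p)].
  by apply/allP => x _; apply: contrapT => /negP; apply: h.
have u : uniq [seq i%:R : K | i <- iota 0 (size p)].
  by rewrite map_inj_uniq ?iota_uniq // => i j /eqP; rewrite eqr_nat => /eqP.
by have := max_poly_roots p0 r u; rewrite size_map size_iota ltnn.
Qed.

End Evaluation.

Section Varieties.
Context (K : numClosedFieldType).

(* A projective variety in P^n: the set of nonzero vectors representing
   its points. *)
Record projvar (n : nat) := ProjVar {
  pv_mem :> 'cV[K]_n.+1 -> Prop;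
  pv_closed : exists S : {mpoly K[n.+1]} -> Prop,
    (forall p, S p -> exists d, p \is d.-homog) /\
    (forall x, pv_mem x <-> x != 0 /\ forall p, S p -> pev p x = 0);
  pv_nonempty : exists x, pv_mem x;
  pv_irreducible : forall (d e : nat) (p q : {mpoly K[n.+1]}),
    p \is d.-homog -> q \is e.-homog ->
    (forall x, pv_mem x -> pev (p * q) x = 0) ->
    (forall x, pv_mem x -> pev p x = 0) \/
    (forall x, pv_mem x -> pev q x = 0) }.

Context (n : nat) (X : projvar n).
Local Notation tuple_map := ('cV[{mpoly K[n.+1]}]_n.+1).

(* F represents a rational map X --> X. A zero of F need not be a point of
   indeterminacy of that map: another representative, in the sense of [rat_eq],
   may be nonzero there. *)
Definition is_rat (F : tuple_map) : Prop :=
  [/\ exists d : nat, forall i, F i 0 \is d.-homog,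
      exists2 x, X x & mev F x != 0 &
      forall x, X x -> mev F x != 0 -> X (mev F x)].

Definition rat_eq (F G : tuple_map) : Prop :=
  forall x, X x -> mev F x != 0 -> mev G x != 0 ->
    same_point (mev F x) (mev G x).

Definition rat_comp (F G : tuple_map) : tuple_map :=
  \col_i (F i 0 \mPo [tuple G j 0 | j < n.+1]).

Definition rat_id : tuple_map := \col_i 'X_i.

Definition rat_inv (F G : tuple_map) : Prop :=
  [/\ is_rat (rat_comp F G), is_rat (rat_comp G F),
      rat_eq (rat_comp F G) rat_id & rat_eq (rat_comp G F) rat_id].

Definition is_birat (F : tuple_map) : Prop :=
  is_rat F /\ exists2 G, is_rat G & rat_inv F G.

Lemma pv_neq0 x : X x -> x != 0.
Proof. by have [S [_ h]] := pv_closed X; case/h. Qed.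

Lemma pv_scale c x : X x -> c != 0 -> X (c *: x).
Proof.
have [S [hS h]] := pv_closed X; case/h => x0 hx c0; apply/h; split.
  by rewrite scaler_eq0 negb_or c0.
by move=> p Sp; have [d hp] := hS p Sp; rewrite (pevZ _ _ hp) hx ?mulr0.
Qed.

Lemma mev_comp F G x : mev (rat_comp F G) x = mev F (mev G x).
Proof.
apply/matrixP => i j; rewrite !mxE /pev comp_mpoly_meval.
by apply: meval_eq => k; rewrite tnth_mktuple mxE.
Qed.

Lemma mev_id x : mev rat_id x = x.
Proof. by apply/matrixP => i j; rewrite !mxE /pev mevalXU ord1. Qed.

(* P holds on a nonempty open subset of X. *)
Definition generic (P : 'cV[K]_n.+1 -> Prop) : Prop :=
  exists d (p : {mpoly K[n.+1]}), [/\ p \is d.-homog,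
    exists2 x, X x & pev p x != 0 & forall x, X x -> pev p x != 0 -> P x].

Lemma genericI P Q : generic P -> generic Q -> generic (fun x => P x /\ Q x).
Proof.
move=> [d [p [hp [x Xx px] hP]]] [e [q [hq [y Xy qy] hQ]]].
exists (d + e)%N, (p * q); split; first exact: dhomogM.
  apply: contrapT => /forall2NP h.
  have z0 z : X z -> pev (p * q) z = 0.
    by move=> Xz; case: (h z) => // /negP; rewrite negbK => /eqP.
  have [a|a] := @pv_irreducible _ X _ _ _ _ hp hq z0.
    by move: px; rewrite a ?eqxx.
  by move: qy; rewrite a ?eqxx.
by move=> z Xz; rewrite pevM mulf_eq0 negb_or => /andP[a b]; split; auto.
Qed.

Lemma generic_ex P : generic P -> exists2 x, X x & P x.
Proof. by move=> [d [p [_ [x Xx px] h]]]; exists x => //; apply: h. Qed.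

Lemma genericS (P Q : _ -> Prop) :
  (forall x, X x -> P x -> Q x) -> generic P -> generic Q.
Proof.
move=> PQ [d [p [hp e h]]]; exists d, p; split => // x Xx px.
by apply: PQ => //; apply: h.
Qed.

Lemma rat_generic F : is_rat F -> generic (fun x => mev F x != 0).
Proof.
move=> [[d hd] [x Xx /mev_neq0[i xi]] _]; exists d, (F i 0); split => //.
  by exists x.
by move=> y _; apply: mev_neq0i.
Qed.

Lemma same_point_refl m (x : 'cV[K]_m) : same_point x x.
Proof. by exists 1; rewrite ?oner_eq0 ?scale1r. Qed.

Lemma same_point_sym m (x y : 'cV[K]_m) : same_point x y -> same_point y x.
Proof.
by case=> c c0 ->; exists c^-1; rewrite ?invr_eq0 // scalerA mulVf // scale1r.
Qed.

Lemma same_point_trans m (x y z : 'cV[K]_m) :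
  same_point x y -> same_point y z -> same_point x z.
Proof.
by case=> c c0 -> [d d0 ->]; exists (d * c); rewrite ?mulf_neq0 ?scalerA.
Qed.

Lemma same_point_minors m (x y : 'cV[K]_m) : x != 0 -> y != 0 ->
  same_point x y <-> forall i j, x i 0 * y j 0 = x j 0 * y i 0.
Proof.
move=> x0 y0; split.
  by move=> [c c0 ->] i j; rewrite !mxE; ring.
move=> h; have [i xi] : exists i, x i 0 != 0.
  apply: contrapT => /forallNP h0; move/eqP: x0; apply.
  apply/matrixP => i j; rewrite ord1 mxE.
  by apply/eqP; apply: contrapT => /negP; apply: h0.
have e : y = (y i 0 / x i 0) *: x.
  apply/matrixP => j k; rewrite ord1 mxE.
  by apply: (mulfI xi); rewrite h; field.
exists (y i 0 / x i 0) => //.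
by apply: contra_neq y0 => c0; rewrite e c0 scale0r.
Qed.

Lemma rat_eq_generic F G : is_rat F -> is_rat G ->
  generic (fun x => same_point (mev F x) (mev G x)) -> rat_eq F G.
Proof.
move=> rF rG gen x Xx Fx Gx.
apply/same_point_minors => // i j; rewrite !mxE.
have [[d hd] _ _] := rF; have [[e he] _ _] := rG.
pose m := F i 0 * G j 0 - F j 0 * G i 0.
apply/eqP; rewrite -subr_eq0 -!pevM; apply: contrapT => /negP nz.
have gm : generic (fun x => pev m x != 0).
  exists (d + e)%N, m; split => //.
    by apply: rpredB; apply: dhomogM.
  by exists x => //; rewrite /pev mevalB.
have [y Xy [[[sp my] Fy] Gy]] :=
  generic_ex (genericI (genericI (genericI gen gm) (rat_generic rF))
                       (rat_generic rG)).
move/same_point_minors: sp => /(_ Fy Gy i j); rewrite !mxE -!pevM => e1.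
by move: my; rewrite /pev mevalB /= -!/(pev _ _) e1 subrr eqxx.
Qed.

Lemma rat_eq_refl F : rat_eq F F.
Proof. by move=> x _ _ _; apply: same_point_refl. Qed.

Lemma rat_eq_sym F G : rat_eq F G -> rat_eq G F.
Proof. by move=> h x Xx Gx Fx; apply: same_point_sym; apply: h. Qed.

Lemma rat_eq_trans F G H : is_rat F -> is_rat G -> is_rat H ->
  rat_eq F G -> rat_eq G H -> rat_eq F H.
Proof.
move=> rF rG rH FG GH; apply: rat_eq_generic => //.
apply: genericS (genericI (rat_generic rF)
  (genericI (rat_generic rG) (rat_generic rH))) => x Xx [Fx [Gx Hx]].
by apply: same_point_trans (FG x _ _ _) (GH x _ _ _).
Qed.

Lemma is_rat_id : is_rat rat_id.
Proof.
split.
- by exists 1%N => i; rewrite mxE dhomogX /= mdeg1.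
- by have [x Xx] := pv_nonempty X; exists x => //; rewrite mev_id pv_neq0.
- by move=> x; rewrite mev_id.
Qed.

Lemma mev_scale F c x : is_rat F -> c != 0 -> same_point (mev F x) (mev F (c *: x)).
Proof.
move=> [[d hd] _ _] c0; exists (c ^+ d); first by rewrite expf_neq0.
by apply/matrixP => i j; rewrite !mxE (pevZ _ _ (hd i)).
Qed.

Lemma same_point_neq0 m (x y : 'cV[K]_m) : same_point x y -> (x != 0) = (y != 0).
Proof. by case=> c c0 ->; rewrite scaler_eq0 (negbTE c0). Qed.

Lemma mev_same F x y : is_rat F -> same_point x y ->
  same_point (mev F x) (mev F y).
Proof. by move=> rF [c c0 ->]; apply: mev_scale. Qed.

Lemma mev_at0 F : is_rat F -> mev F 0 != 0 -> forall x, mev F x = mev F 0.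
Proof.
move=> [[d hd] _ _] /mev_neq0[i]; rewrite -(scale0r 0) (pevZ _ _ (hd i)).
case: d hd => [|d] hd; last by rewrite expr0n mul0r eqxx.
move=> _ x; apply/matrixP => k l; rewrite !mxE -[in RHS](scale0r x).
by rewrite scale0r -(scale0r x) (pevZ _ _ (hd k)) expr0 mul1r.
Qed.

Lemma pev_same d (p : {mpoly K[n.+1]}) x y : p \is d.-homog ->
  same_point x y -> (pev p x != 0) = (pev p y != 0).
Proof.
by move=> hp [c c0 ->]; rewrite (pevZ _ _ hp) mulf_eq0 expf_eq0 (negbTE c0) andbF.
Qed.

Lemma generic_pull F G P : is_rat F -> is_rat G -> is_rat (rat_comp F G) ->
  rat_eq (rat_comp F G) rat_id ->
  generic P -> generic (fun x => P (mev F x)).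
Proof.
move=> rF rG rFG FG [d [p [hp ex hP]]].
have [[dF hF] _ FX] := rF; have [_ _ GX] := rG.
pose q := p \mPo [tuple F j 0 | j < n.+1].
have qE x : pev q x = pev p (mev F x).
  rewrite /pev comp_mpoly_meval; apply: meval_eq => k.
  by rewrite tnth_mktuple mxE.
have hq : q \is (dF * d).-homog by exact: dhomog_comp.
have gp : generic (fun x => pev p x != 0) by exists d, p; split.
have [x Xx [[px Gx] FGx]] := generic_ex (genericI (genericI gp (rat_generic rG))
  (rat_generic rFG)).
have gq : generic (fun x => pev q x != 0).
  exists (dF * d)%N, q; split => //; exists (mev G x); first exact: GX.
  rewrite qE -mev_comp; have := FG x Xx FGx; rewrite mev_id => /(_ (pv_neq0 Xx)).
  by move/(pev_same hp) => ->.
apply: genericS (genericI gq (rat_generic rF)) => y Xy [qy Fy].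
by apply: hP; [apply: FX | rewrite -qE].
Qed.

Definition gen_inv F G := generic (fun x => same_point (mev F (mev G x)) x) /\
  generic (fun x => same_point (mev G (mev F x)) x).

Lemma comp_is_rat F G : is_rat F -> is_rat G ->
  generic (fun x => mev F (mev G x) != 0) -> is_rat (rat_comp F G).
Proof.
move=> rF rG g; have [[d hd] [x1 Xx1 Fx1] FX] := rF; have [[e he] _ GX] := rG.
split.
- by exists (e * d)%N => i; rewrite mxE; apply: dhomog_comp.
- by have [x Xx h] := generic_ex g; exists x; rewrite ?mev_comp.
move=> x Xx; rewrite mev_comp => h; have [G0|G0] := eqVneq (mev G x) 0.
  by move: h; rewrite G0 => h; rewrite -(mev_at0 rF h x1); apply: FX.
by apply: FX => //; apply: GX.
Qed.

Lemma rat_inv_of F G : is_rat F -> is_rat G -> gen_inv F G -> rat_inv F G.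
Proof.
move=> rF rG [h1 h2].
have nz (H H' : tuple_map) : generic (fun x => same_point (mev H (mev H' x)) x) ->
    generic (fun x => mev H (mev H' x) != 0).
  by apply: genericS => x Xx /same_point_neq0 ->; apply: pv_neq0.
have r1 := comp_is_rat rF rG (nz F G h1).
have r2 := comp_is_rat rG rF (nz G F h2).
split => //; apply: rat_eq_generic => //; try exact: is_rat_id.
  by apply: genericS h1 => x _; rewrite mev_comp mev_id.
by apply: genericS h2 => x _; rewrite mev_comp mev_id.
Qed.

Lemma rat_inv_gen F G : is_rat F -> is_rat G -> rat_inv F G -> gen_inv F G.
Proof.
move=> rF rG [r1 r2 e1 e2]; split.
  apply: genericS (rat_generic r1) => x Xx h.
  by rewrite -mev_comp -[X in same_point _ X]mev_id; apply: e1 => //; rewrite mev_id; apply: pv_neq0.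
apply: genericS (rat_generic r2) => x Xx h.
by rewrite -mev_comp -[X in same_point _ X]mev_id; apply: e2 => //; rewrite mev_id; apply: pv_neq0.
Qed.

Lemma birat_pull F P : is_birat F -> generic P -> generic (fun x => P (mev F x)).
Proof. by move=> [rF [G rG [r1 r2 e1 e2]]]; apply: generic_pull rF rG r1 e1. Qed.

Lemma is_birat_inv F G : is_rat F -> is_rat G -> rat_inv F G -> is_birat G.
Proof. by move=> rF rG [? ? ? ?]; split => //; exists F. Qed.

Lemma is_birat_id : is_birat rat_id.
Proof.
have r := is_rat_id; split => //; exists rat_id => //; apply: rat_inv_of => //.
split; apply: genericS (rat_generic r) => x Xx _; rewrite !mev_id;
  exact: same_point_refl.
Qed.

Lemma is_birat_comp F G : is_birat F -> is_birat G -> is_birat (rat_comp F G).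
Proof.
move=> bF bG; have [rF [F' rF' iF]] := bF; have [rG [G' rG' iG]] := bG.
have bF' := is_birat_inv rF rF' iF; have bG' := is_birat_inv rG rG' iG.
have r1 := comp_is_rat rF rG (birat_pull bG (rat_generic rF)).
have r2 := comp_is_rat rG' rF' (birat_pull bF' (rat_generic rG')).
split; [exact: r1 | exists (rat_comp G' F'); first exact: r2].
apply: (rat_inv_of r1 r2).
have [f1 f2] := rat_inv_gen rF rF' iF; have [g1 g2] := rat_inv_gen rG rG' iG.
split.
  apply: genericS (genericI f1 (birat_pull bF' g1)) => x Xx [hf hg].
  by rewrite !mev_comp; apply: same_point_trans hf; apply: mev_same.
apply: genericS (genericI g2 (birat_pull bG f2)) => x Xx [hg hf].
by rewrite !mev_comp; apply: same_point_trans hg; apply: mev_same.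
Qed.

Record birat_rep := BiratRep { br_map :> tuple_map; _ : `[< is_birat br_map >] }.

HB.instance Definition _ := [isSub for br_map].
HB.instance Definition _ := [Choice of birat_rep by <:].

Lemma birat_repP (F : birat_rep) : is_birat F.
Proof. by case: F => F /= /asboolP. Qed.

Definition birat_rel (F G : birat_rep) : bool := `[< rat_eq F G >].

Lemma birat_rel_equiv : equiv_class_of birat_rel.
Proof.
split.
- by move=> F; apply/asboolP; apply: rat_eq_refl.
- by move=> F G; apply/asboolP/asboolP; apply: rat_eq_sym.
move=> F G H /asboolP h1 /asboolP h2; apply/asboolP.
by apply: rat_eq_trans h1 h2; apply: (birat_repP _).1.
Qed.

Canonical birat_equiv := EquivRelPack birat_rel_equiv.

Definition Bir := {eq_quot birat_rel}.
HB.instance Definition _ := Choice.on Bir.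
HB.instance Definition _ : EqQuotient _ birat_equiv Bir := EqQuotient.on Bir.

Definition to_bir (F : tuple_map) (hF : is_birat F) : Bir :=
  \pi_Bir (BiratRep (asboolT hF)).

Lemma to_birP F G (hF : is_birat F) (hG : is_birat G) :
  to_bir hF = to_bir hG <-> rat_eq F G.
Proof. by split=> [/eqmodP/asboolP //|h]; apply/eqmodP/asboolP. Qed.

Lemma to_bir_repr (f : Bir) : f = to_bir (birat_repP (repr f)).
Proof. by rewrite -[LHS]reprK; congr (\pi_Bir _); apply: val_inj. Qed.

Lemma birP (f : Bir) : exists F (hF : is_birat F), f = to_bir hF.
Proof.
by exists (repr f), (birat_repP (repr f)); apply: to_bir_repr.
Qed.

Definition bir_mul (f g : Bir) : Bir :=
  to_bir (is_birat_comp (birat_repP (repr f)) (birat_repP (repr g))).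

Definition bir_one : Bir := to_bir is_birat_id.

Lemma birat_inv_ex (F : birat_rep) : exists G, is_birat G /\ rat_inv F G.
Proof.
have [rF [G rG iG]] := birat_repP F; exists G; split => //.
exact: is_birat_inv iG.
Qed.

Definition bir_inv (f : Bir) : Bir := to_bir (projT2 (cid (birat_inv_ex (repr f)))).1.

Lemma bir_mulE F G (hF : is_birat F) (hG : is_birat G) :
  bir_mul (to_bir hF) (to_bir hG) = to_bir (is_birat_comp hF hG).
Proof.
apply/to_birP.
case: piP => F' /eqmodP/asboolP /= eF; case: piP => G' /eqmodP/asboolP /= eG.
have bF' := birat_repP F'; have bG' := birat_repP G'.
apply: rat_eq_generic; [exact: (is_birat_comp _ _).1..|].
have GX := let: And3 _ _ h := hG.1 in h.
apply: genericS (genericI (genericI (rat_generic hG.1) (rat_generic bG'.1))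
 (genericI (birat_pull hG (rat_generic hF.1)) (birat_pull hG (rat_generic bF'.1)))).
move=> x Xx [[Gx G'x] [Fx F'x]]; rewrite !mev_comp.
apply: same_point_sym; apply: same_point_trans (eF _ _ Fx F'x) _; first exact: GX.
by apply: mev_same; [exact: bF'.1 | exact: eG].
Qed.

Lemma bir_mulA : associative bir_mul.
Proof.
move=> f g h; have [F [hF ->]] := birP f; have [G [hG ->]] := birP g.
have [H [hH ->]] := birP h; rewrite !bir_mulE; apply/to_birP => x Xx.
by rewrite !mev_comp => _ _; apply: same_point_refl.
Qed.

Lemma bir_mul1g : left_id bir_one bir_mul.
Proof.
move=> f; have [F [hF ->]] := birP f; rewrite bir_mulE; apply/to_birP => x Xx.
by rewrite !mev_comp mev_id => _ _; apply: same_point_refl.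
Qed.

Lemma bir_mulg1 : right_id bir_one bir_mul.
Proof.
move=> f; have [F [hF ->]] := birP f; rewrite bir_mulE; apply/to_birP => x Xx.
by rewrite !mev_comp mev_id => _ _; apply: same_point_refl.
Qed.

Lemma bir_mulVg : left_inverse bir_one bir_inv bir_mul.
Proof.
move=> f; rewrite {2}(to_bir_repr f) /bir_inv; move: (cid _) => [G [bG i]] /=; have [_ _ _ e] := i.
by rewrite bir_mulE; apply/to_birP.
Qed.

Lemma bir_mulgV : right_inverse bir_one bir_inv bir_mul.
Proof.
move=> f; rewrite {1}(to_bir_repr f) /bir_inv; move: (cid _) => [G [bG i]] /=; have [_ _ e _] := i.
by rewrite bir_mulE; apply/to_birP.
Qed.

HB.instance Definition _ :=
  isGroup.Build Bir bir_mulA bir_mul1g bir_mulg1 bir_mulVg bir_mulgV.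

(* f is defined at x and maps it to y: some representative F of f does not
   vanish at x, and F(x) represents the point y. *)
Definition bir_maps (f : Bir) (x y : 'cV[K]_n.+1) : Prop :=
  exists F (hF : is_birat F),
    [/\ f = to_bir hF, mev F x != 0 & same_point (mev F x) y].

Definition regular (f : Bir) : Prop := forall x, X x -> exists y, bir_maps f x y.

Definition Aut : {pred Bir} := [pred f | `[< regular f /\ regular f^-1%g >]].

End Varieties.

Arguments Aut {K n} X.

Section Paths.
Context (K : numClosedFieldType) (n : nat).

Definition path_at (w : 'cV[{poly K}]_n) (t : K) : 'cV[K]_n :=
  \col_i (w i 0).[t].

Lemma pev_path (p : {mpoly K[n]}) (w : 'cV[{poly K}]_n) t :
  pev p (path_at w t) = (mmap polyC (fun i => w i 0) p).[t].
Proof.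
rewrite /pev mevalE /mmap horner_sum; apply: eq_bigr => m _.
rewrite hornerM hornerC /mmap1 horner_prod; congr (_ * _).
by apply: eq_bigr => i _; rewrite horner_exp mxE.
Qed.

Lemma path_irreducible (mem : 'cV[K]_n -> Prop) :
  (forall x, mem x -> x != 0) ->
  (forall x y, mem x -> mem y -> exists w,
    [/\ path_at w 0 = x, path_at w 1 = y &
        forall t, path_at w t != 0 -> mem (path_at w t)]) ->
  forall (d e : nat) (p q : {mpoly K[n]}),
    p \is d.-homog -> q \is e.-homog ->
    (forall x, mem x -> pev (p * q) x = 0) ->
    (forall x, mem x -> pev p x = 0) \/ (forall x, mem x -> pev q x = 0).
Proof.
move=> nz hw d e p q _ _ h; apply: contrapT => /not_orP[/existsNP[x hx] /existsNP[y hy]].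
have [Xx px] := (not_implyP _ _).1 hx; have [Xy qy] := (not_implyP _ _).1 hy.
have [w [w0 w1 wX]] := hw x y Xx Xy.
have [i xi] : exists i, x i 0 != 0.
  apply: contrapT => /forallNP h0; move/eqP: (nz x Xx); apply.
  apply/matrixP => i j; rewrite ord1 mxE.
  by apply/eqP; apply: contrapT => /negP; apply: h0.
pose P r := mmap polyC (fun i => w i 0) r.
have P0 : P p != 0.
  by apply/eqP => Pp; apply: px; rewrite -w0 pev_path -/(P p) Pp horner0.
have Q0 : P q != 0.
  by apply/eqP => Pq; apply: qy; rewrite -w1 pev_path -/(P q) Pq horner0.
have W0 : w i 0 != 0.
  by apply: contraNneq xi => wi; rewrite -w0 mxE wi horner0.
have [t] := poly_exneq0 (mulf_neq0 (mulf_neq0 P0 Q0) W0).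
rewrite !hornerM -!pev_path -pevM => ne0; move/eqP: (ne0); apply.
rewrite h ?mul0r //; apply: wX; apply: contra_neq ne0 => w0'.
have -> : (w i 0).[t] = path_at w t i 0 by rewrite mxE.
by rewrite w0' mxE mulr0.
Qed.

End Paths.

Section ProjectiveSpace.
Context (K : numClosedFieldType).

Lemma Pn_closed n : exists S : {mpoly K[n.+1]} -> Prop,
  (forall p, S p -> exists d, p \is d.-homog) /\
  (forall x : 'cV[K]_n.+1, x != 0 <-> x != 0 /\ forall p, S p -> pev p x = 0).
Proof. by exists (fun=> False); split=> // x; split=> [|[]]. Qed.

Lemma Pn_nonempty n : exists x : 'cV[K]_n.+1, x != 0.
Proof.
exists (const_mx 1); apply/eqP => /matrixP/(_ 0 0); rewrite !mxE.
by move/eqP; rewrite oner_eq0.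
Qed.

Definition segment n (x y : 'cV[K]_n) : 'cV[{poly K}]_n :=
  \col_i ((x i 0)%:P + 'X * (y i 0 - x i 0)%:P).

Lemma segmentE n (x y : 'cV[K]_n) t : path_at (segment x y) t = x + t *: (y - x).
Proof.
by apply/matrixP => i j; rewrite !mxE ord1 hornerD hornerM !hornerC hornerX.
Qed.

Lemma Pn_irreducible n (d e : nat) (p q : {mpoly K[n.+1]}) :
  p \is d.-homog -> q \is e.-homog ->
  (forall x : 'cV[K]_n.+1, x != 0 -> pev (p * q) x = 0) ->
  (forall x : 'cV[K]_n.+1, x != 0 -> pev p x = 0) \/
  (forall x : 'cV[K]_n.+1, x != 0 -> pev q x = 0).
Proof.
apply: path_irreducible => // x y x0 y0; exists (segment x y).
split; rewrite ?segmentE ?scale0r ?addr0 // scale1r.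
by rewrite addrC subrK.
Qed.

Definition Pn n : projvar K n :=
  ProjVar (Pn_closed n) (Pn_nonempty n) (@Pn_irreducible n).

End ProjectiveSpace.

Section Linear.
Context (K : numClosedFieldType) (n : nat).

Definition lin_map (A : 'M[K]_n.+1) : 'cV[{mpoly K[n.+1]}]_n.+1 :=
  \col_i \sum_j A i j *: 'X_j.

Lemma mev_lin A x : mev (lin_map A) x = A *m x.
Proof.
apply/matrixP => i j; rewrite !mxE ord1 /pev raddf_sum /=.
by apply: eq_bigr => k _; rewrite mevalZ mevalXU.
Qed.

Lemma unitmx_neq0 (A : 'M[K]_n.+1) (x : 'cV[K]_n.+1) :
  A \in unitmx -> x != 0 -> A *m x != 0.
Proof. by move=> uA; apply: contra_neq => h; rewrite -(mulKmx uA x) h mulmx0. Qed.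

Definition lin_stable (X : projvar K n) (A : 'M[K]_n.+1) : Prop :=
  [/\ A \in unitmx, forall x, X x -> X (A *m x) &
      forall x, X x -> X (invmx A *m x)].

Lemma lin_is_rat (X : projvar K n) A : A \in unitmx ->
  (forall x, X x -> X (A *m x)) -> is_rat X (lin_map A).
Proof.
move=> uA h; split.
- exists 1%N => i; rewrite mxE; apply: rpred_sum => j _; apply: rpredZ.
  by rewrite dhomogX /= mdeg1.
- have [x Xx] := pv_nonempty X; exists x => //; rewrite mev_lin.
  exact: unitmx_neq0 (pv_neq0 Xx).
by move=> x Xx _; rewrite mev_lin; apply: h.
Qed.

Lemma lin_is_birat (X : projvar K n) A : lin_stable X A -> is_birat X (lin_map A).
Proof.
move=> [uA h1 h2]; have uA' : invmx A \in unitmx by rewrite unitmx_inv.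
have r1 := lin_is_rat uA h1; have r2 := lin_is_rat uA' h2.
split=> //; exists (lin_map (invmx A)) => //; apply: (rat_inv_of r1 r2).
split; apply: genericS (rat_generic r1) => x Xx _; rewrite !mev_lin.
  by rewrite mulKVmx //; apply: same_point_refl.
by rewrite mulKmx //; apply: same_point_refl.
Qed.

Lemma lin_stable_inv X A : lin_stable X A -> lin_stable X (invmx A).
Proof. by move=> [? ? ?]; split; rewrite ?unitmx_inv ?invmxK. Qed.

Lemma lin_bir_mul X A B (hA : lin_stable X A) (hB : lin_stable X B)
  (hAB : lin_stable X (A *m B)) :
  (to_bir (lin_is_birat hA) * to_bir (lin_is_birat hB) =
     to_bir (lin_is_birat hAB))%g.
Proof.
rewrite [LHS]bir_mulE; apply/to_birP => x Xx; rewrite mev_comp !mev_lin mulmxA.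
by move=> _ _; apply: same_point_refl.
Qed.

Lemma lin_bir_regular X A (hA : lin_stable X A) :
  regular (to_bir (lin_is_birat hA)).
Proof.
move=> x Xx; exists (A *m x), (lin_map A), (lin_is_birat hA).
rewrite mev_lin; split => //; last exact: same_point_refl.
by case: hA => uA _ _; apply: unitmx_neq0 (pv_neq0 Xx).
Qed.

Lemma lin_bir_inv X A (hA : lin_stable X A) :
  ((to_bir (lin_is_birat hA))^-1 =
    to_bir (lin_is_birat (lin_stable_inv hA)))%g.
Proof.
apply: (mulgI (to_bir (lin_is_birat hA))); rewrite mulgV.
rewrite [RHS]bir_mulE; apply/to_birP => x Xx; rewrite mev_comp !mev_lin mev_id.
by case: hA => uA _ _ _ _; rewrite mulKVmx //; apply: same_point_refl.
Qed.

Lemma lin_bir_Aut X A (hA : lin_stable X A) : to_bir (lin_is_birat hA) \in Aut X.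
Proof. by apply/asboolP; rewrite lin_bir_inv; split; apply: lin_bir_regular. Qed.

End Linear.

Section ProjectiveLinearGroup.
Context (K : numClosedFieldType) (n : nat).

Record gl_rep := GlRep { gl_mx :> 'M[K]_n; _ : gl_mx \in unitmx }.

HB.instance Definition _ := [isSub for gl_mx].
HB.instance Definition _ := [Choice of gl_rep by <:].

Lemma gl_repP (A : gl_rep) : (A : 'M_n) \in unitmx.
Proof. by case: A. Qed.

Definition prop_mx (A B : 'M[K]_n) : Prop := exists2 c : K, c != 0 & B = c *: A.

Definition pgl_rel (A B : gl_rep) : bool := `[< prop_mx A B >].

Lemma pgl_rel_equiv : equiv_class_of pgl_rel.
Proof.
split.
- by move=> A; apply/asboolP; exists 1; rewrite ?oner_eq0 ?scale1r.
- suff s A B : prop_mx A B -> prop_mx B A by move=> A B; apply/asboolP/asboolP; apply: s.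
  by case=> c c0 ->; exists c^-1; rewrite ?invr_eq0 // scalerA mulVf // scale1r.
move=> A B C /asboolP[c c0 e1] /asboolP[d d0 e2]; apply/asboolP.
by exists (d * c); rewrite ?mulf_neq0 // e2 e1 scalerA.
Qed.

Canonical pgl_equiv := EquivRelPack pgl_rel_equiv.

Definition PGL := {eq_quot pgl_rel}.
HB.instance Definition _ := Choice.on PGL.
HB.instance Definition _ : EqQuotient _ pgl_equiv PGL := EqQuotient.on PGL.

Definition to_pgl (A : 'M[K]_n) (hA : A \in unitmx) : PGL := \pi_PGL (GlRep hA).

Lemma to_pglP A B (hA : A \in unitmx) (hB : B \in unitmx) :
  to_pgl hA = to_pgl hB <-> prop_mx A B.
Proof. by split=> [/eqmodP/asboolP //|h]; apply/eqmodP/asboolP. Qed.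

Lemma to_pgl_repr (g : PGL) : g = to_pgl (gl_repP (repr g)).
Proof. by rewrite -[LHS]reprK; congr (\pi_PGL _); apply: val_inj. Qed.

Lemma repr_pgl A (hA : A \in unitmx) : prop_mx A (repr (to_pgl hA)).
Proof. by apply/(to_pglP hA (gl_repP _)); apply: to_pgl_repr. Qed.

Lemma unitmx_mul_of (A B : 'M[K]_n) :
  A \in unitmx -> B \in unitmx -> A *m B \in unitmx.
Proof. by move=> uA uB; rewrite unitmx_mul uA. Qed.

Lemma unitmx_inv_of (A : 'M[K]_n) : A \in unitmx -> invmx A \in unitmx.
Proof. by rewrite unitmx_inv. Qed.

Definition pgl_mul (g h : PGL) : PGL :=
  to_pgl (unitmx_mul_of (gl_repP (repr g)) (gl_repP (repr h))).

Definition pgl_one : PGL := to_pgl (unitmx1 K n).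

Definition pgl_inv (g : PGL) : PGL := to_pgl (unitmx_inv_of (gl_repP (repr g))).

Lemma pgl_mulE A B (hA : A \in unitmx) (hB : B \in unitmx) :
  pgl_mul (to_pgl hA) (to_pgl hB) = to_pgl (unitmx_mul_of hA hB).
Proof.
apply/to_pglP.
have [c c0 ->] := repr_pgl hA; have [d d0 ->] := repr_pgl hB.
exists (c * d)^-1; first by rewrite invr_eq0 mulf_neq0.
rewrite -scalemxAl -scalemxAr !scalerA [X in X *: _](_ : _ = 1) ?scale1r //.
by field; rewrite ?c0 ?d0.
Qed.

Lemma pgl_mulA : associative pgl_mul.
Proof.
move=> f g h; rewrite (to_pgl_repr f) (to_pgl_repr g) (to_pgl_repr h) !pgl_mulE.
by apply/to_pglP; exists 1; rewrite ?oner_eq0 // scale1r mulmxA.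
Qed.

Lemma pgl_mul1g : left_id pgl_one pgl_mul.
Proof.
move=> f; rewrite (to_pgl_repr f) pgl_mulE.
by apply/to_pglP; exists 1; rewrite ?oner_eq0 // scale1r mul1mx.
Qed.

Lemma pgl_mulg1 : right_id pgl_one pgl_mul.
Proof.
move=> f; rewrite (to_pgl_repr f) pgl_mulE.
by apply/to_pglP; exists 1; rewrite ?oner_eq0 // scale1r mulmx1.
Qed.

Lemma pgl_mulVg : left_inverse pgl_one pgl_inv pgl_mul.
Proof.
move=> f; rewrite {2}(to_pgl_repr f) pgl_mulE.
by apply/to_pglP; exists 1; rewrite ?oner_eq0 // scale1r mulVmx ?gl_repP.
Qed.

Lemma pgl_mulgV : right_inverse pgl_one pgl_inv pgl_mul.
Proof.
move=> f; rewrite {1}(to_pgl_repr f) pgl_mulE.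
by apply/to_pglP; exists 1; rewrite ?oner_eq0 // scale1r mulmxV ?gl_repP.
Qed.

HB.instance Definition _ :=
  isGroup.Build PGL pgl_mulA pgl_mul1g pgl_mulg1 pgl_mulVg pgl_mulgV.

Lemma to_pglM A B (hA : A \in unitmx) (hB : B \in unitmx) :
  (to_pgl hA * to_pgl hB)%g = to_pgl (unitmx_mul_of hA hB).
Proof. exact: pgl_mulE. Qed.

Lemma contragredient_unit (A : 'M[K]_n) :
  A \in unitmx -> (invmx A)^T \in unitmx.
Proof. by rewrite unitmx_tr unitmx_inv. Qed.

Definition alpha (g : PGL) : PGL := to_pgl (contragredient_unit (gl_repP (repr g))).

Lemma alphaE A (hA : A \in unitmx) :
  alpha (to_pgl hA) = to_pgl (contragredient_unit hA).
Proof.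
have [c c0 e] := repr_pgl hA; have u := gl_repP (repr (to_pgl hA)).
apply/to_pglP; rewrite e in u *; exists c; rewrite // invmxZ //.
by apply/matrixP => i j; rewrite !mxE mulrA mulfV // mul1r.
Qed.

Lemma alphaM (g h : PGL) : alpha (g * h)%g = (alpha g * alpha h)%g.
Proof.
rewrite (to_pgl_repr g) (to_pgl_repr h) to_pglM !alphaE.
rewrite to_pglM; apply/to_pglP; exists 1; rewrite ?oner_eq0 // scale1r.
rewrite -trmx_mul; congr (_^T).
have hA := gl_repP (repr g); have hB := gl_repP (repr h).
by rewrite -[LHS](mulmxK (unitmx_mul_of hA hB)) mulmxA mulmxKV // mulVmx // mul1mx.
Qed.

End ProjectiveLinearGroup.

Section Grassmannian.
Context (K : numClosedFieldType).

Local Notation o k := (@Ordinal 4 k isT).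

(* Pluecker coordinates p01, p02, p03, p12, p13, p23. *)
Definition pl_fst (k : 'I_6) : 'I_4 := nth (o 0) [:: o 0; o 0; o 0; o 1; o 1; o 2] k.
Definition pl_snd (k : 'I_6) : 'I_4 := nth (o 0) [:: o 1; o 2; o 3; o 2; o 3; o 3] k.

Definition plucker (R : comNzRingType) (u v : 'cV[R]_4) : 'cV[R]_6 :=
  \col_k (u (pl_fst k) 0 * v (pl_snd k) 0 - u (pl_snd k) 0 * v (pl_fst k) 0).

(* x represents a line of P^3: plucker u v is nonzero exactly when u and v are
   linearly independent, and then it represents the line joining them. *)
Definition is_line (x : 'cV[K]_6) : Prop :=
  x != 0 /\ exists u v, x = plucker u v.

Definition line_eqn : {mpoly K[6]} :=
  'X_(@Ordinal 6 0 isT) * 'X_(@Ordinal 6 5 isT)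
  - 'X_(@Ordinal 6 1 isT) * 'X_(@Ordinal 6 4 isT)
  + 'X_(@Ordinal 6 2 isT) * 'X_(@Ordinal 6 3 isT).

Lemma ord6P (P : 'I_6 -> Prop) :
  P (@Ordinal 6 0 isT) -> P (@Ordinal 6 1 isT) -> P (@Ordinal 6 2 isT) ->
  P (@Ordinal 6 3 isT) -> P (@Ordinal 6 4 isT) -> P (@Ordinal 6 5 isT) ->
  forall k, P k.
Proof.
move=> p0 p1 p2 p3 p4 p5 [m lt_m].
case: m lt_m => [|[|[|[|[|[|//]]]]]] lt_m; rewrite (bool_irrelevance lt_m isT) //.
Qed.

Lemma sum4 (F : 'I_4 -> K) : \sum_i F i = F (o 0) + F (o 1) + F (o 2) + F (o 3).
Proof.
rewrite !big_ord_recr big_ord0 /= add0r.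
by congr (F _ + F _ + F _ + F _); apply: val_inj.
Qed.

Lemma sum6 (F : 'I_6 -> K) : \sum_i F i =
  F (@Ordinal 6 0 isT) + F (@Ordinal 6 1 isT) + F (@Ordinal 6 2 isT) +
  F (@Ordinal 6 3 isT) + F (@Ordinal 6 4 isT) + F (@Ordinal 6 5 isT).
Proof.
rewrite !big_ord_recr big_ord0 /= add0r.
by congr (F _ + F _ + F _ + F _ + F _ + F _); apply: val_inj.
Qed.

Lemma pev_line_eqn x : pev line_eqn x =
  x (@Ordinal 6 0 isT) 0 * x (@Ordinal 6 5 isT) 0
  - x (@Ordinal 6 1 isT) 0 * x (@Ordinal 6 4 isT) 0
  + x (@Ordinal 6 2 isT) 0 * x (@Ordinal 6 3 isT) 0.
Proof. by rewrite /pev mevalD mevalB !mevalM !mevalXU. Qed.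

Definition vec4 (a b c d : K) : 'cV[K]_4 := \col_(i < 4) nth 0 [:: a; b; c; d] i.

Lemma line_eqnP x : is_line x <-> x != 0 /\ pev line_eqn x = 0.
Proof.
split=> [[x0 [u [v e]]]|[x0 e]]; split => //.
  by rewrite e pev_line_eqn !mxE /=; ring.
rewrite pev_line_eqn in e.
set p01 := x _ 0 in e; set p23 := x _ 0 in e; set p02 := x _ 0 in e.
set p13 := x _ 0 in e; set p03 := x _ 0 in e; set p12 := x _ 0 in e.
have [i xi] : exists i, x i 0 != 0.
  apply: contrapT => /forallNP h0; move/eqP: x0; apply.
  apply/matrixP => i j; rewrite ord1 mxE.
  by apply/eqP; apply: contrapT => /negP; apply: h0.
have e1 : p01 * p23 = p02 * p13 - p03 * p12.
  by apply/subr0_eq; rewrite -e; ring.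
have e2 : p02 * p13 = p01 * p23 + p03 * p12 by rewrite e1; ring.
have e3 : p03 * p12 = p02 * p13 - p01 * p23 by rewrite e1; ring.
suff [u [v h]] : exists u v : 'cV[K]_4, forall k, x k 0 = plucker u v k 0.
  by exists u, v; apply/matrixP => k j; rewrite ord1.
elim/ord6P: i xi => xi.
- exists (vec4 0 p01 p02 p03), (p01^-1 *: (vec4 (- p01) 0 p12 p13)).
  elim/ord6P; rewrite !mxE /= -/p01 -/p02 -/p03 -/p12 -/p13 -/p23;
    try (by field); by field: e1.
- exists (vec4 0 p01 p02 p03), (p02^-1 *: (vec4 (- p02) (- p12) 0 p23)).
  elim/ord6P; rewrite !mxE /= -/p01 -/p02 -/p03 -/p12 -/p13 -/p23;
    try (by field); by field: e2.
- exists (vec4 0 p01 p02 p03), (p03^-1 *: (vec4 (- p03) (- p13) (- p23) 0)).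
  elim/ord6P; rewrite !mxE /= -/p01 -/p02 -/p03 -/p12 -/p13 -/p23;
    try (by field); by field: e3.
- exists (vec4 (- p01) 0 p12 p13), (p12^-1 *: (vec4 (- p02) (- p12) 0 p23)).
  elim/ord6P; rewrite !mxE /= -/p01 -/p02 -/p03 -/p12 -/p13 -/p23;
    try (by field); by field: e3.
- exists (vec4 (- p01) 0 p12 p13), (p13^-1 *: (vec4 (- p03) (- p13) (- p23) 0)).
  elim/ord6P; rewrite !mxE /= -/p01 -/p02 -/p03 -/p12 -/p13 -/p23;
    try (by field); by field: e2.
- exists (vec4 (- p02) (- p12) 0 p23), (p23^-1 *: (vec4 (- p03) (- p13) (- p23) 0)).
  elim/ord6P; rewrite !mxE /= -/p01 -/p02 -/p03 -/p12 -/p13 -/p23;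
    try (by field); by field: e1.
Qed.

Lemma line_closed : exists S : {mpoly K[6]} -> Prop,
  (forall p, S p -> exists d, p \is d.-homog) /\
  (forall x, is_line x <-> x != 0 /\ forall p, S p -> pev p x = 0).
Proof.
exists (fun p => p = line_eqn); split=> [p ->|x].
  exists 2%N; apply: rpredD; first apply: rpredB;
    by apply: (@dhomogM _ _ _ 1 _ 1); rewrite dhomogX /= mdeg1.
split=> [/line_eqnP[x0 e]|[x0 /(_ _ erefl) e]]; last exact/line_eqnP.
by split=> // p ->.
Qed.

Lemma line_nonempty : exists x, is_line x.
Proof.
exists (plucker (vec4 1 0 0 0) (vec4 0 1 0 0)); split; last by do 2!eexists.
apply/eqP => /matrixP/(_ 0 0) /eqP; rewrite !mxE /= mul1r mul0r subr0.
by rewrite oner_eq0.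
Qed.

Lemma line_irreducible (d e : nat) (p q : {mpoly K[6]}) :
  p \is d.-homog -> q \is e.-homog ->
  (forall x, is_line x -> pev (p * q) x = 0) ->
  (forall x, is_line x -> pev p x = 0) \/
  (forall x, is_line x -> pev q x = 0).
Proof.
apply: path_irreducible => [x [] //|x y [_ [u [v ->]]] [_ [u' [v' ->]]]].
pose w := plucker (segment u u') (segment v v').
have wE t : path_at w t = plucker (u + t *: (u' - u)) (v + t *: (v' - v)).
  by rewrite -!segmentE; apply/matrixP => i j; rewrite !mxE !hornerE.
exists w; split => [||t h]; rewrite ?wE ?scale0r ?scale1r ?addr0 //.
  by congr plucker; rewrite addrC subrK.
by rewrite wE in h; split => //; do 2!eexists.
Qed.

(* The Grassmannian of lines of P^3, as the image of the Pluecker embedding. *)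
Definition G13 : projvar K 5 :=
  @ProjVar K 5 is_line line_closed line_nonempty line_irreducible.

(* The second exterior power of A, i.e. the action of A on the Pluecker
   coordinates of lines, see [ext2E]. *)
Definition ext2 (A : 'M[K]_4) : 'M[K]_6 := \matrix_(k, l)
  (A (pl_fst k) (pl_fst l) * A (pl_snd k) (pl_snd l)
   - A (pl_fst k) (pl_snd l) * A (pl_snd k) (pl_fst l)).

Lemma ext2E A u v : ext2 A *m plucker u v = plucker (A *m u) (A *m v).
Proof. by apply/matrixP => k j; rewrite !mxE sum6 !mxE !sum4 /=; ring. Qed.

Lemma ext2_col A l : col l (ext2 A) = plucker (col (pl_fst l) A) (col (pl_snd l) A).
Proof. by apply/matrixP => k j; rewrite !mxE; ring. Qed.

Lemma ext2M A B : ext2 (A *m B) = ext2 A *m ext2 B.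
Proof.
have e l : col l (ext2 (A *m B)) = col l (ext2 A *m ext2 B).
  have cM m1 m2 (C : 'M[K]_(m1, m2)) m3 (D : 'M[K]_(m2, m3)) i :
      col i (C *m D) = C *m col i D by rewrite !colE mulmxA.
  by rewrite cM !ext2_col ext2E !cM.
by apply/matrixP => k l; have /matrixP/(_ k 0) := e l; rewrite mxE [X in _ = X]mxE.
Qed.

Lemma ext2_1 : ext2 1%:M = 1%:M.
Proof.
apply/matrixP => k l; move: k l.
by elim/ord6P; elim/ord6P; rewrite !mxE /= ?mulr1 ?mulr0 ?subr0 ?subrr.
Qed.

Lemma ext2Z c A : ext2 (c *: A) = c ^+ 2 *: ext2 A.
Proof. by apply/matrixP => k l; rewrite !mxE; ring. Qed.

Lemma ext2_unit A : A \in unitmx -> ext2 A \in unitmx.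
Proof.
move=> uA; apply: (proj1 (mulmx1_unit (_ : _ *m ext2 (invmx A) = 1%:M))).
by rewrite -ext2M mulmxV // ext2_1.
Qed.

Lemma ext2_inv A : A \in unitmx -> invmx (ext2 A) = ext2 (invmx A).
Proof.
move=> uA; rewrite -[RHS](mulmxK (ext2_unit uA)) -ext2M mulVmx //.
by rewrite ext2_1 mul1mx.
Qed.

Lemma ext2_line A x : A \in unitmx -> is_line x -> is_line (ext2 A *m x).
Proof.
move=> uA [x0 [u [v e]]]; split; first exact: unitmx_neq0 (ext2_unit uA) x0.
by exists (A *m u), (A *m v); rewrite e ext2E.
Qed.

Lemma ext2_stable A : A \in unitmx -> lin_stable G13 (ext2 A).
Proof.
move=> uA; split; first exact: ext2_unit.
  by move=> x; apply: ext2_line.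
by move=> x; rewrite ext2_inv //; apply: ext2_line; rewrite unitmx_inv.
Qed.

(* The line joining u and v is mapped to the line joining A u and A v. *)
Definition phiG (g : PGL K 4) : Bir G13 :=
  to_bir (lin_is_birat (ext2_stable (gl_repP (repr g)))).

Lemma phiGE A (hA : A \in unitmx) :
  phiG (to_pgl hA) = to_bir (lin_is_birat (ext2_stable hA)).
Proof.
apply/to_birP => x Xx _ _; rewrite !mev_lin.
have [c c0 ->] := repr_pgl hA; rewrite ext2Z -scalemxAl.
by apply: same_point_sym; exists (c ^+ 2); rewrite ?expf_neq0.
Qed.

Lemma phiGM (g h : PGL K 4) : phiG (g * h)%g = (phiG g * phiG h)%g.
Proof.
rewrite (to_pgl_repr g) (to_pgl_repr h) to_pglM !phiGE.
rewrite [RHS]bir_mulE; apply/to_birP => x Xx; rewrite mev_comp !mev_lin mulmxA ext2M.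
by move=> _ _; apply: same_point_refl.
Qed.

Lemma phiG_Aut g : phiG g \in Aut G13.
Proof. exact: lin_bir_Aut. Qed.

End Grassmannian.

Section Cremona.
Context (K : numClosedFieldType).

Lemma Pn_stable n (A : 'M[K]_n.+1) : A \in unitmx -> lin_stable (Pn K n) A.
Proof.
by move=> uA; split=> // x; apply: unitmx_neq0; rewrite ?unitmx_inv.
Qed.

Definition pgl_bir n (g : PGL K n.+1) : Bir (Pn K n) :=
  to_bir (lin_is_birat (Pn_stable (gl_repP (repr g)))).

Lemma pgl_birE n A (hA : A \in unitmx) :
  pgl_bir (to_pgl hA : PGL K n.+1) = to_bir (lin_is_birat (Pn_stable hA)).
Proof.
apply/to_birP => x Xx _ _; rewrite !mev_lin.
have [c c0 ->] := repr_pgl hA; rewrite -scalemxAl.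
by apply: same_point_sym; exists c.
Qed.

Lemma pgl_birM n (g h : PGL K n.+1) :
  pgl_bir (g * h)%g = (pgl_bir g * pgl_bir h)%g.
Proof.
rewrite (to_pgl_repr g) (to_pgl_repr h) to_pglM !pgl_birE.
rewrite [RHS]bir_mulE; apply/to_birP => x Xx; rewrite mev_comp !mev_lin mulmxA.
by move=> _ _; apply: same_point_refl.
Qed.

Definition pgl_sub n : {pred Bir (Pn K n)} :=
  [pred f | `[< exists g : PGL K n.+1, f = pgl_bir g >]].

(* The point [1 : t_1 : ... : t_n]. *)
Definition chart0 n (t : 'cV[K]_n) : 'cV[K]_(1 + n) := col_mx 1%:M t.

Definition torus n (t : 'cV[K]_n) : Prop := forall j, t j 0 != 0.

Definition monomial n (a : 'M[int]_n) (t : 'cV[K]_n) : 'cV[K]_n :=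
  \col_i \prod_j t j 0 ^ a i j.

(* The maps t |-> monomial a t in the chart x_0 = 1, for a in GL_n(Z); such a
   map is defined on the torus, which is dense, so it is determined by a. *)
Definition W n : {pred Bir (Pn K n)} := [pred f | `[< exists2 a : 'M[int]_n,
  a \in unitmx & forall t : 'cV[K]_n, torus t ->
    bir_maps f (chart0 t) (chart0 (monomial a t)) >]].

(* Each a in GL_n(Z) does define an element of W (see [mon_map_W]): the Laurent
   monomials are homogenized and multiplied by a common monomial. *)
Section MonomialExistence.
Context (n : nat).

Lemma monomialM (a b : 'M[int]_n) t : torus t ->
  monomial a (monomial b t) = monomial (a *m b) t.
Proof.
move=> ht; apply/matrixP => i j; rewrite !mxE.
under eq_bigr => k _ do rewrite mxE.
transitivity (\prod_k \prod_j0 t j0 0 ^ (a i k * b k j0)).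
  apply: eq_bigr => k _; elim/big_rec2: _ => [|l x y _ <-]; first by rewrite exp1rz.
  by rewrite expfzMl exprz_exp [b k l * _]mulrC.
rewrite exchange_big /=; apply: eq_bigr => l _; rewrite mxE.
elim/big_rec2: _ => [|k x y _ ->]; first by rewrite expr0z.
by rewrite expfzDr // ht.
Qed.

Lemma monomial_torus (a : 'M[int]_n) t : torus t -> torus (monomial a t).
Proof.
move=> ht i; rewrite mxE; apply/prodf_neq0 => j _.
by rewrite expfz_neq0 // ht.
Qed.

Lemma monomial1 (t : 'cV[K]_n) : monomial 1%:M t = t.
Proof.
apply/matrixP => i j; rewrite mxE ord1 (bigD1 i) //= big1 => [|k ki].
  by rewrite mxE eqxx mulr1.
by rewrite mxE eq_sym (negbTE ki) expr0z.
Qed.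

Definition hom_exp (a : 'M[int]_n) : 'M[int]_(1 + n) :=
  col_mx 0 (row_mx (- \col_i \sum_j a i j) a).

Lemma hom_exp_sum a i : \sum_j hom_exp a i j = 0.
Proof.
rewrite big_split_ord big_ord1 /=; case: (splitP i) => k e.
  have -> : i = lshift n k by apply: val_inj.
  by rewrite col_mxEu mxE add0r big1 // => j _; rewrite col_mxEu mxE.
have -> : i = rshift 1 k by apply: val_inj.
rewrite col_mxEd row_mxEl !mxE; apply/eqP; rewrite addrC subr_eq0; apply/eqP.
by apply: eq_bigr => j _; rewrite col_mxEd row_mxEr.
Qed.

Definition shift_exp a (j : 'I_(1 + n)) : nat := (\sum_i absz (hom_exp a i j))%N.

Definition mon_exp a (i : 'I_(1 + n)) : 'X_{1..1 + n} :=
  [multinom absz ((shift_exp a j)%:Z + hom_exp a i j)%R | j < 1 + n].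

Lemma mon_expE a i j : (mon_exp a i j)%:Z = (shift_exp a j)%:Z + hom_exp a i j.
Proof.
rewrite mnmE gez0_abs // /shift_exp (bigD1 i) //= PoszD addrAC.
rewrite addr_ge0 //; have := ler_norm (- hom_exp a i j).
by rewrite normrN -abszE -subr_ge0 opprK.
Qed.

Definition mon_map a : 'cV[{mpoly K[n.+1]}]_n.+1 := \col_i 'X_[mon_exp a i].

Lemma mon_map_homog a i : mon_map a i 0 \is (\sum_j shift_exp a j).-homog.
Proof.
rewrite mxE dhomogX /= mdegE -eqz_nat -!natz !natr_sum.
under eq_bigr => j _ do rewrite natz mon_expE -natz.
by rewrite big_split /= hom_exp_sum addr0.
Qed.

Lemma chart0_torus (t : 'cV[K]_n) : torus t -> torus (chart0 t : 'cV_(1 + n)).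
Proof.
move=> ht j; rewrite -(splitK j); case: (split j) => k /=.
  by rewrite col_mxEu mxE ord1 eqxx oner_neq0.
by rewrite col_mxEd.
Qed.

Lemma mev_mon_map a (t : 'cV[K]_n) : torus t ->
  mev (mon_map a) (chart0 t) =
    (\prod_j (chart0 t : 'cV_(1 + n)) j 0 ^+ shift_exp a j) *: chart0 (monomial a t).
Proof.
move=> ht; have hc := chart0_torus ht.
apply/matrixP => i z; rewrite !mxE /pev mevalX ord1.
transitivity (\prod_j ((chart0 t : 'cV_(1 + n)) j 0 ^+ shift_exp a j *
                       (chart0 t : 'cV_(1 + n)) j 0 ^ hom_exp a i j)).
  by apply: eq_bigr => j _; rewrite exprnP mon_expE expfzDr ?hc.
rewrite big_split /=; congr (_ * _); rewrite big_split_ord big_ord1 /=.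
rewrite col_mxEu mxE eqxx exp1rz mul1r.
under eq_bigr => j _ do rewrite col_mxEd.
case: (splitP (i : 'I_(1 + n))) => k e.
  have -> : i = lshift n k by apply: val_inj.
  rewrite big1 => [|j _]; last by rewrite col_mxEu mxE expr0z.
  by rewrite mxE ord1 eqxx.
have -> : i = rshift 1 k by apply: val_inj.
rewrite mxE; apply: eq_bigr => j _.
by rewrite col_mxEd row_mxEr.
Qed.

Lemma mon_map_same a (t : 'cV[K]_n) : torus t ->
  same_point (mev (mon_map a) (chart0 t)) (chart0 (monomial a t)).
Proof.
move=> ht; apply: same_point_sym; rewrite mev_mon_map //; eexists; last by [].
by apply/prodf_neq0 => j _; rewrite expf_neq0 // chart0_torus.
Qed.

Lemma chart0_neq0 (t : 'cV[K]_n) : chart0 t != 0.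
Proof.
apply/eqP => /matrixP/(_ (lshift n 0) 0) /eqP; rewrite col_mxEu !mxE eqxx.
by rewrite oner_eq0.
Qed.

Lemma generic_torus : generic (Pn K n) (fun x => exists2 t, torus t & same_point x (chart0 t)).
Proof.
exists (\sum_(i < 1 + n) 1)%N, (\prod_(i < 1 + n) 'X_i).
have E x : pev (\prod_(i < 1 + n) 'X_i) x = \prod_(i < 1 + n) x i 0.
  by rewrite /pev rmorph_prod; apply: eq_bigr => i _; apply: mevalXU.
split.
- elim/big_rec2: _ => [|i d p _ hp]; first exact: dhomog1.
  by apply: dhomogM => //; rewrite dhomogX /= mdeg1.
- exists (const_mx 1); last by rewrite E big1 ?oner_neq0 // => i _; rewrite mxE.
  by apply/eqP => /matrixP/(_ 0 0) /eqP; rewrite !mxE oner_eq0.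
move=> x x0; rewrite E => /prodf_neq0 nz; have x00 := nz (lshift n (0 : 'I_1)) isT.
exists (\col_j (x (rshift 1 j) 0 / x (lshift n (0 : 'I_1)) 0)).
  by move=> j; rewrite mxE mulf_neq0 ?invr_eq0 ?nz.
exists (x (lshift n (0 : 'I_1)) 0)^-1; first by rewrite invr_eq0.
apply/(@matrixP K (1 + n) 1) => i z; rewrite ord1 [RHS]mxE -[i]splitK.
case: (split _) => k /=; first by rewrite col_mxEu mxE ord1 eqxx mulVf.
by rewrite col_mxEd mxE mulrC.
Qed.

Lemma mon_is_rat a : is_rat (Pn K n) (mon_map a).
Proof.
split; first by eexists => i; apply: mon_map_homog.
- have [x Xx [t ht _]] := generic_ex generic_torus; exists (chart0 t).
    exact: chart0_neq0.
  by rewrite (same_point_neq0 (mon_map_same a ht)) chart0_neq0.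
- by [].
Qed.

Lemma mon_is_birat a : a \in unitmx -> is_birat (Pn K n) (mon_map a).
Proof.
move=> ua; have r1 := mon_is_rat a; have r2 := mon_is_rat (invmx a).
split; [exact: r1 | exists (mon_map (invmx a)); first exact: r2].
apply: (rat_inv_of r1 r2); split; apply: genericS generic_torus => x _ [t ht e];
  have e' := same_point_sym e.
- apply: same_point_trans (mev_same r1 (mev_same r2 e)) _; apply: same_point_trans e'.
  apply: same_point_trans (mev_same r1 (mon_map_same _ ht)) _.
  apply: same_point_trans (mon_map_same _ (monomial_torus _ ht)) _.
  by rewrite monomialM // mulmxV // monomial1; apply: same_point_refl.
apply: same_point_trans (mev_same r2 (mev_same r1 e)) _; apply: same_point_trans e'.
apply: same_point_trans (mev_same r2 (mon_map_same _ ht)) _.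
apply: same_point_trans (mon_map_same _ (monomial_torus _ ht)) _.
by rewrite monomialM // mulVmx // monomial1; apply: same_point_refl.
Qed.

Lemma mon_mapP a (ua : a \in unitmx) t : torus t ->
  bir_maps (to_bir (mon_is_birat ua)) (chart0 t) (chart0 (monomial a t)).
Proof.
move=> ht; exists (mon_map a), (mon_is_birat ua); split=> //.
  by rewrite (same_point_neq0 (mon_map_same a ht)) chart0_neq0.
exact: mon_map_same.
Qed.

Lemma mon_map_W a (ua : a \in unitmx) : to_bir (mon_is_birat ua) \in @W n.
Proof. by apply/asboolP; exists a => // t; apply: mon_mapP. Qed.

End MonomialExistence.

End Cremona.

Arguments pgl_sub K n : clear implicits.
Arguments W K n : clear implicits.

HB.instance Definition _ (K : numClosedFieldType) (n : nat) :=
  isMultiplicative.Build _ _ (@alpha K n) (@alphaM K n).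
HB.instance Definition _ (K : numClosedFieldType) :=
  isMultiplicative.Build _ _ (@phiG K) (@phiGM K).
HB.instance Definition _ (K : numClosedFieldType) (n : nat) :=
  isMultiplicative.Build _ _ (@pgl_bir K n) (@pgl_birM K n).

Section GeneratedSubgroup.
Context (G : groupType) (A : {pred G}).

Definition generated : pred G := fun x =>
  `[< forall S : {pred G}, group_closed S -> {subset A <= S} -> x \in S >].

Lemma generated_closed : group_closed generated.
Proof.
split=> [|x y /asboolP hx /asboolP hy]; apply/asboolP => S gS AS; first exact: gS.1.
by apply: gS.2; [apply: hx | apply: hy].
Qed.

Record gen_group := GenGroup { gen_val :> G; _ : generated gen_val }.

HB.instance Definition _ := [isSub for gen_val].
HB.instance Definition _ := [Choice of gen_group by <:].
HB.instance Definition _ :=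
  SubChoice_isSubGroup.Build G generated gen_group generated_closed.

End GeneratedSubgroup.

(* Main.v *)
Require Import Defs.
From mathcomp Require Import all_boot all_order all_algebra.
From mathcomp Require Import reals complex.
From mathcomp Require Import perm generic_quotient boolp mpoly ring.

Set Implicit Arguments.
Unset Strict Implicit.
Unset Printing Implicit Defensive.

Import GRing.Theory Num.Theory.
Local Open Scope ring_scope.

(* An automorphism f of G(1,3) lifts to polynomials P(u, v) in two points
   spanning a line: the given representatives have no common factor once their
   content, which exists by unique factorization, is removed, so P vanishes only
   where u and v are dependent, and it is semi-invariant under GL_2.
   Composing with the inverse of f shows that the degree of P is 1, so P is
   bilinear and alternating and f is linear on Pluecker coordinates. If A lifts
   f and A^T J A = c J for the Pluecker form J, then A^2 / c depends only on f;
   applied to the image of the diagonal torus this gives commuting matrices N(t),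
   multiplicative in t and normalized by the image of S_4.

   If N(t) = 1 for t = diag(i, 1, 1, 1), then diag(-1, 1, 1, 1) is killed, hence
   so are the elementary matrices, all of PGL_4, the permutation matrices in
   GL_3(Z), and finally W_3.

   Otherwise some weight of the torus is nontrivial. Its S_4-orbit has at most 6
   elements, and fewer than 4 if the weights in it are pairwise not inverse to
   each other; so N(t) is diagonalizable with weights a(t_i) a(t_j) / (a(t_k) a(t_l))
   for a multiplicative function a : K -> K. Let x be the monomial map with matrix
   [[1,0,0],[-1,1,0],[0,0,-1]]. It normalizes the torus; as the image of a is
   Zariski dense, the image of x maps orbits of the torus of weights to such
   orbits, although a itself may be discontinuous. The permutation v = (01)(23)
   preserves generic orbits, hence so does m = x v x^-1; therefore m fixes the
   three products of complementary eigencoordinates up to a common scalar, and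
   c = (123) permutes them cyclically. But m c = c^-1 m holds in GL_3(Z), so c and
   c^-1 would permute these products in the same way. *)

(** * Unique factorization in polynomial rings *)

Section Factorial.

(** An abstract homomorphism on PGL_4 may involve wild field automorphisms, so the theory of
    algebraic group actions does not apply; what remains is counting weights in dimension 6 and
    using the divisibility of K^*. A lift of an automorphism to GL_6 is defined up to a scalar, and
    normalizing its multiplier c would still leave a sign. Squaring the lift removes both
    ambiguities, at the price that N(t) lifts the image of t^2. This is why the test element has
    order 4: N(t) = 1 kills t^2 = diag(-1, 1, 1, 1), while N(t)^4 = 1 excludes Jordan blocks, so
    that otherwise a nontrivial weight exists. The group S_4 acts on the three pairs of opposite
    edges of the coordinate tetrahedron through S_3: v lies in the kernel and c acts as a 3-cycle.
    In S_4 no conjugate of v can invert c. The matrix x leaves S_4: it conjugates the matrix of v to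
    minus a transposition matrix, which does invert c. The image of x is only birational, hence the
    contradiction is reached at generic points of the quadric. *)

Definition divides (R : idomainType) (a b : R) : Prop := exists c, b = a * c.

Definition prime_elt (R : idomainType) (p : R) : Prop :=
  [/\ p != 0, p \isn't a GRing.unit &
      forall a b, divides p (a * b) -> divides p a \/ divides p b].

Definition prime_product (R : idomainType) (a : R) (s : seq R) : Prop :=
  (forall p, p \in s -> prime_elt p) /\
  exists2 u, u \is a GRing.unit & a = u * \prod_(p <- s) p.

Definition factorial_ring (R : idomainType) : Prop :=
  forall a : R, a != 0 -> exists s, prime_product a s.

Lemma prime_product_ind (R : idomainType) (P : R -> Prop) :
  (forall u, u \is a GRing.unit -> P u) ->
  (forall p a, prime_elt p -> P a -> P (p * a)) ->
  forall a s, prime_product a s -> P a.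
Proof.
move=> Pu Pp a s [hs [u uu ->]]; elim: s hs => [|p s IHs] hs.
  by rewrite big_nil mulr1; apply: Pu.
rewrite big_cons mulrCA; apply: Pp; first by apply: hs; rewrite mem_head.
by apply: IHs => q qs; apply: hs; rewrite inE qs orbT.
Qed.

Lemma prime_productM (R : idomainType) (a b : R) s t :
  prime_product a s -> prime_product b t -> prime_product (a * b) (s ++ t).
Proof.
move=> [hs [u uu ->]] [ht [v uv ->]]; split.
  by move=> p; rewrite mem_cat => /orP[/hs|/ht].
by exists (u * v); rewrite ?unitrM ?uu // big_cat /=; ring.
Qed.

(** The primes of c are treated one at a time: some P i escapes the prime p, so p divides h and can
    be cancelled. *)
Lemma divides_cancel (R : idomainType) (I : Type) (P : I -> R) :
  (exists i, P i != 0) ->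
  (forall p, prime_elt p -> exists i, ~ divides p (P i)) ->
  forall c s, prime_product c s ->
  forall h, (forall i, divides c (h * P i)) -> divides c h.
Proof.
move=> nzP prP c s hc; move: c s hc.
apply: (@prime_product_ind _ (fun c => forall h, (forall i, divides c (h * P i)) -> divides c h)).
  by move=> u uu h _; exists (u^-1 * h); rewrite mulVKr.
move=> p a pp IHa h hP.
have [i ni] := prP p pp; have [p0 _ pM] := pp.
have [|[h' eh]|//] := pM h (P i).
  by have [b ->] := hP i; exists (a * b); ring.
have [|b eb] := IHa h'.
  move=> j; have [b eb] := hP j; exists b; apply: (mulfI p0).
  by rewrite !mulrA -eh eb.
by exists b; rewrite eh eb; ring.
Qed.

(** The minors show that P i0 divides G i0 * P i for every i. Since P is primitive, P i0 divides G
    i0, and the quotient is h. *)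
Lemma primitive_proportional (R : idomainType) (I : Type) (P G : I -> R) :
  factorial_ring R -> (exists i, P i != 0) ->
  (forall p, prime_elt p -> exists i, ~ divides p (P i)) ->
  (forall i j, P i * G j = P j * G i) -> exists h, forall i, G i = h * P i.
Proof.
move=> facR nzP prP minors; have [i0 Pi0] := nzP; have [s hs] := facR _ Pi0.
have [|h eh] := divides_cancel nzP prP hs (h := G i0).
  by move=> i; exists (G i); rewrite mulrC minors.
by exists h => i; apply: (mulfI Pi0); rewrite minors eh; ring.
Qed.

(** Common prime factors are extracted one by one; the number of primes in a factorization of one
    nonzero entry decreases each time. *)
Lemma primitive_part (R : idomainType) (I : finType) (F : I -> R) :
  factorial_ring R -> (exists i, F i != 0) ->
  exists g P, (forall i, F i = g * P i) /\
    forall p, prime_elt p -> exists i, ~ divides p (P i).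
Proof.
move=> facR [i0 Fi0]; have [s hs] := facR _ Fi0.
elim: {s}_.+1 {-2}s (ltnSn (size s)) F Fi0 hs => // n IHn s sn F Fi0 hs.
have [ex|] := pselect (exists2 p, prime_elt p & forall i, divides p (F i)); last first.
  move=> /forall2NP ne; exists 1, F; split=> [i|p pp]; first by rewrite mul1r.
  by case: (ne p) => // /existsNP.
have [p pp /choice[F' eF]] := ex; have [p0 pu pM] := pp.
have F'i0 : F' i0 != 0 by apply: contra_neq Fi0 => e; rewrite eF e mulr0.
suff [t [tn ht]] : exists t, (size t < size s)%N /\ prime_product (F' i0) t.
  have [|g [P [eP prP]]] := IHn t _ F' F'i0 ht; first exact: leq_trans tn _.
  by exists (p * g), P; split => // i; rewrite eF eP mulrA.
case: hs; move: (F' i0) (F i0) F'i0 (eF i0) => x y x0 -> hs [u uu].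
move: {IHn sn eF Fi0 y} u uu x x0; elim: s hs => [|q s IHs] hs u uu x x0.
  by rewrite big_nil mulr1 => e; move: uu; rewrite -e unitrM (negbTE pu).
rewrite big_cons => e; have [q0 qu qM] := hs q (mem_head _ _).
have hs' z : z \in s -> prime_elt z by move=> zs; apply: hs; rewrite inE zs orbT.
case: (qM p x); first by rewrite e; exists (u * \prod_(j <- s) j); ring.
- move=> [c ec]; exists s; split => //; split => //.
  have uc : c \is a GRing.unit.
    case: (pM q c); first by exists 1; rewrite mulr1.
      move=> [d ed]; apply/unitrP; exists d; rewrite mulrC.
      by split; apply: (mulfI p0); rewrite mulr1 {2}ec ed; ring.
    move=> [d ed]; case/negP: qu; apply/unitrP; exists d; rewrite mulrC.
    by split; apply: (mulfI p0); rewrite mulr1 {2}ec ed; ring.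
  exists (u / c); first by rewrite unitrM uu unitrV.
  apply: (mulfI p0); rewrite e {1}ec.
  by rewrite -[q in LHS](mulrK uc); ring.
- move=> [c ec]; have c0 : c != 0 by apply: contra_neq x0; rewrite ec => ->; rewrite mulr0.
  have [|t [ts [ht [w uw ew]]]] := IHs hs' u uu c c0.
    by apply: (mulfI q0); rewrite mulrCA -ec e; ring.
  exists (q :: t); split => //; split.
    by move=> z; rewrite inE => /orP[/eqP->|/ht] //; apply: hs; apply: mem_head.
  by exists w; rewrite // big_cons ec ew; ring.
Qed.

Lemma dividesC (R : idomainType) (c : R) (f : {poly R}) :
  divides c%:P f <-> forall i, divides c f`_i.
Proof.
split=> [[g ->] i|/choice[g eg]]; first by exists g`_i; rewrite coefCM.
exists (\poly_(i < size f) g i); apply/polyP => i; rewrite coefCM coef_poly.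
by case: ltnP => [_|/(nth_default 0) ->] //; rewrite mulr0.
Qed.

(** Gauss's lemma. The prime divides the leading coefficient of a * b, hence that of a or of b;
    removing this leading term keeps the product divisible by p and lowers the size. *)
Lemma prime_eltC (R : idomainType) (p : R) : prime_elt p -> prime_elt p%:P.
Proof.
move=> [p0 pu pM]; split; rewrite ?polyC_eq0 //.
  by rewrite poly_unitE size_polyC p0 /= coefC eqxx.
move=> a b; elim: {a b}_.+1 {-2}a {-2}b (ltnSn (size a + size b)) => // n IHn a b.
have red (f : {poly R}) c : f != 0 -> lead_coef f = p * c ->
    (size (f - (p * c)%:P * 'X^((size f).-1))%R < size f)%N.
  move=> f0 <-; rewrite -[X in (_ < X)%N]prednK ?size_poly_gt0 // ltnS.
  apply/leq_sizeP => j; rewrite leq_eqVlt => /orP[/eqP<-|lj].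
    by rewrite coefB coefCM coefXn eqxx mulr1 subrr.
  rewrite coefB coefCM coefXn (gtn_eqF lj) mulr0 subr0 nth_default //.
  by rewrite -[X in (X <= _)%N]prednK ?size_poly_gt0.
have [->|a0] := eqVneq a 0; first by left; exists 0; rewrite mulr0.
have [->|b0] := eqVneq b 0; first by right; exists 0; rewrite mulr0.
move=> sn [c ec]; case: (pM (lead_coef a) (lead_coef b)).
- by rewrite -lead_coefM ec lead_coefM lead_coefC; exists (lead_coef c).
- move=> [d ed]; case: (IHn (a - (p * d)%:P * 'X^((size a).-1)) b) => //.
  + by rewrite -ltnS; apply: leq_trans sn; rewrite ltnS ltn_add2r (red _ _ a0 ed).
  + exists (c - d%:P * 'X^((size a).-1) * b).
    by rewrite mulrBl ec polyCM; ring.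
  + move=> [q eq]; left; exists (q + d%:P * 'X^((size a).-1)).
    by rewrite mulrDr -eq polyCM; ring.
  + by right.
- move=> [d ed]; case: (IHn a (b - (p * d)%:P * 'X^((size b).-1))) => //.
  + by rewrite -ltnS; apply: leq_trans sn; rewrite ltnS ltn_add2l (red _ _ b0 ed).
  + exists (c - d%:P * 'X^((size b).-1) * a).
    by rewrite mulrBr ec polyCM; ring.
  + by left.
  + move=> [q eq]; right; exists (q + d%:P * 'X^((size b).-1)).
    by rewrite mulrDr -eq polyCM; ring.
Qed.

End Factorial.

Section FactorialPoly.

Definition primitive (R : idomainType) (f : {poly R}) : Prop :=
  forall p : R, prime_elt p -> ~ divides p%:P f.

(** The relation %| is divisibility up to a nonzero constant c. The primes of c do not divide the
    primitive g, so by Gauss's lemma they divide the cofactor and cancel. *)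
Lemma primitive_dvdp (R : idomainType) (f g : {poly R}) :
  factorial_ring R -> primitive g -> g %| f -> divides g f.
Proof.
move=> facR prg /Pdiv.Idomain.dvdpP[[c h] /= c0 e].
have [s hs] := facR c c0; rewrite -mul_polyC mulrC in e.
move: c s hs f h e {c0}; apply: (@prime_product_ind _ (fun c => forall f h,
  f * c%:P = h * g -> divides g f)) => [u uu f h e|p a pp IHa f h e].
  exists (h * u^-1%:P); rewrite mulrCA mulrA -e -mulrA -polyCM mulrV //.
  by rewrite mulr1.
have [p0 _ pM] := prime_eltC pp.
have [[h' eh]|/prg//] : divides p%:P h \/ divides p%:P g.
  by apply: pM; exists (f * a%:P); rewrite -e polyCM; ring.
apply: (IHa f h'); apply: (mulfI p0).
by rewrite [RHS]mulrA -eh -e polyCM; ring.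
Qed.

Lemma primitive_factor (R : idomainType) (f : {poly R}) :
  factorial_ring R -> f != 0 -> exists g f0, [/\ g != 0, f = g%:P * f0 & primitive f0].
Proof.
move=> facR f0.
have [|g [P [eP prP]]] := @primitive_part R 'I_(size f) (fun i => f`_i) facR.
  have lt : ((size f).-1 < size f)%N by rewrite prednK ?size_poly_gt0.
  by exists (Ordinal lt); rewrite -lead_coefE lead_coef_eq0.
pose Q i := if insub i is Some j then P j else 0.
have e : f = g%:P * \poly_(i < size f) Q i.
  apply/polyP => i; rewrite coefCM coef_poly.
  case: ltnP => h; last by rewrite mulr0 nth_default.
  by rewrite /Q insubT /= -eP.
exists g, (\poly_(i < size f) Q i); split => //.
  by apply: contra_neq f0 => g0; rewrite e g0 mul0r.
move=> p pp /dividesC h; have [j] := prP p pp; apply.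
by have := h j; rewrite coef_poly ltn_ord /Q valK.
Qed.

Lemma prime_productC (R : idomainType) (a : R) s :
  prime_product a s -> prime_product a%:P (map polyC s).
Proof.
move=> [hs [u uu ->]]; split=> [p /mapP[q qs ->]|].
  by apply: prime_eltC; apply: hs.
exists u%:P; first by rewrite rmorph_unit.
by rewrite polyCM rmorph_prod big_map.
Qed.

(** The coprimality argument for %| takes place over the fraction field; [primitive_dvdp] brings its
    result back to R. *)
Lemma irreducible_prime_elt (R : idomainType) (f : {poly R}) :
  factorial_ring R -> primitive f -> irreducible_poly f -> prime_elt f.
Proof.
move=> facR prf irf; have [sf _] := irf; split.
- exact: irredp_neq0.
- by rewrite poly_unitE; case: eqP sf => // ->.
move=> a b [c ec]; have [fa|fa] := boolP (f %| a); first by left; apply: primitive_dvdp.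
right; apply: primitive_dvdp => //.
have cop : coprimep f a.
  apply: contraNT fa => sg; have := irf.2 _ sg (dvdp_gcdl f a).
  by case/andP => _ h; apply: dvdp_trans h (dvdp_gcdr f a).
by rewrite -(Gauss_dvdpr _ cop) ec dvdp_mulIl.
Qed.

(** The content is factored in R. A reducible primitive part has a proper divisor q; freed of its
    content, q divides it exactly and leaves two factors of smaller size. *)
Theorem factorial_poly (R : idomainType) : factorial_ring R -> factorial_ring {poly R}.
Proof.
move=> facR f; elim: {f}_.+1 {-2}f (ltnSn (size f)) => // n IHn f sf f0.
suff [f' [pf' e]] : exists f', (primitive f' -> f' != 0 ->
    (size f' <= size f)%N -> exists s, prime_product f' s) /\
    exists g, [/\ g != 0, f = g%:P * f' & primitive f'].
  have [g [g0 ef pr]] := e; have [s hs] := facR g g0.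
  have f'0 : f' != 0 by apply: contra_neq f0 => e0; rewrite ef e0 mulr0.
  case: pf' => // [|t ht]; first by rewrite ef mul_polyC size_scale.
  by exists (map polyC s ++ t); rewrite ef; apply: prime_productM (prime_productC hs) ht.
have [g [f' [g0 ef pr]]] := primitive_factor facR f0.
exists f'; split; last by exists g.
move=> _ f'0 sf'; have [s1|s1] := leqP (size f') 1.
  have ec := size1_polyC s1; have [|s hs] := facR f'`_0.
    by apply: contra_neq f'0; rewrite {2}ec => ->.
  by exists (map polyC s); rewrite ec; apply: prime_productC.
have [irr|] := pselect (irreducible_poly f').
  have pf := irreducible_prime_elt facR pr irr.
  exists [:: f']; split; first by move=> p; rewrite inE => /eqP->.
  by exists 1; rewrite ?unitr1 // big_seq1 mul1r.
move=> nirr; have [q [sq qf nq]] : exists q : {poly R}, [/\ size q != 1%N, q %| f' & ~~ (q %= f')].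
  apply: contrapT => /forallNP h; apply: nirr; split=> // q sq qf.
  by apply: contrapT => /negP nq; apply: (h q).
have q0 : q != 0 by apply: contraNneq f'0 => e; rewrite e dvd0p in qf.
have [c [q' [c0 eq prq]]] := primitive_factor facR q0.
have sqq : size q' = size q by rewrite eq mul_polyC size_scale.
have [r er] : divides q' f'.
  apply: primitive_dvdp => //; apply: dvdp_trans qf.
  by rewrite eq dvdp_mulIr.
have ltq : (size q < size f')%N.
  by rewrite ltn_neqAle dvdp_size_eqp // nq dvdp_leq.
have q'0 : q' != 0 by rewrite -size_poly_eq0 sqq size_poly_eq0.
have r0 : r != 0 by apply: contra_neq f'0; rewrite er => ->; rewrite mulr0.
have gtq : (1 < size q)%N by rewrite ltn_neqAle eq_sym sq size_poly_gt0.
have lt m : (m < size f')%N -> (m < n)%N.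
  by move=> h; apply: leq_trans h (leq_trans sf' _); rewrite -ltnS.
have [|s hs] := IHn q' _ q'0; first by apply: lt; rewrite sqq.
have [|t ht] := IHn r _ r0.
  apply: lt; rewrite er size_mul // sqq -{1}[size r]add0n.
  by case: (size q) gtq => [|[|k]] // _; rewrite addSn /= ltn_add2r.
by exists (s ++ t); rewrite er; apply: prime_productM.
Qed.

Lemma factorial_iso (R S : idomainType) (f : {rmorphism R -> S}) (g : {rmorphism S -> R}) :
  cancel f g -> cancel g f -> factorial_ring S -> factorial_ring R.
Proof.
move=> fK gK facS a a0; have fa0 : f a != 0.
  by apply: contra_neq a0 => e; rewrite -(fK a) e rmorph0.
have [s hs] := facS _ fa0; suff h b : (exists s, prime_product (g b) s) -> b = f a -> exists s, prime_product a s.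
  apply: (h (f a)) => //; move: (f a) s hs {h}.
  apply: prime_product_ind => [u uu|p b [p0 pu pM] [s hs]].
    exists [::]; split => //; exists (g u); first exact: rmorph_unit.
    by rewrite big_nil mulr1.
  exists (g p :: s); rewrite rmorphM; apply: (@prime_productM R (g p) (g b) [:: g p] s) => //.
  split; last by exists 1; rewrite ?unitr1 // big_seq1 mul1r.
  move=> q; rewrite inE => /eqP->; split.
  - by apply: contra_neq p0 => e; rewrite -(gK p) e rmorph0.
  - by apply: contra pu => /(rmorph_unit f); rewrite gK.
  move=> x y [z ez]; case: (pM (f x) (f y)).
  - by exists (f z); rewrite -rmorphM ez rmorphM gK.
  - by move=> [w ew]; left; exists (g w); rewrite -rmorphM -ew fK.
  - by move=> [w ew]; right; exists (g w); rewrite -rmorphM -ew fK.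
by move=> ex eb; rewrite eb fK in ex.
Qed.

Lemma rmorph_mpoly_eq (n : nat) (R : idomainType) (S : nzRingType) (f g : {rmorphism {mpoly R[n]} -> S}) :
  (forall c, f c%:MP = g c%:MP) -> (forall i, f 'X_i = g 'X_i) -> f =1 g.
Proof.
move=> hC hX p; rewrite (mpolyE p) !raddf_sum; apply: eq_bigr => m _ /=.
rewrite -mul_mpolyC !rmorphM /= hC mpolyXE_id !rmorph_prod; congr (_ * _).
by apply: eq_bigr => i _; rewrite !rmorphXn /= hX.
Qed.

Theorem factorial_mpoly (K : fieldType) n : factorial_ring {mpoly K[n]}.
Proof.
elim: n => [|n IHn].
  move=> a a0; exists [::]; split => //; exists a; last by rewrite big_nil mulr1.
  have e : a = (a@_0)%:MP.
    apply/mpolyP => m; rewrite mcoeffC.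
    have -> : m = 0%MM by apply/mnmP => -[].
    by rewrite eqxx mulr1.
  rewrite e rmorph_unit // unitfE; apply: contra_neq a0 => e0.
  by rewrite e e0.
(* The inverse of [muni], which takes the last variable as the indeterminate over the polynomials in
   the others. *)
pose g : {rmorphism {poly {mpoly K[n]}} -> {mpoly K[n.+1]}} :=
  horner_eval ('X_ord_max) \o map_poly (@mwiden n K).
have gC c : g c%:P = mwiden c by rewrite /= map_polyC /horner_eval hornerC.
have gX : g 'X = 'X_ord_max by rewrite /= map_polyX /horner_eval hornerX.
have wX (j : 'I_n) : mwiden 'X_j = 'X_(widen_ord (leqnSn n) j) :> {mpoly K[n.+1]}.
  by rewrite mwidenX mnmwiden1.
have uw (j : 'I_n) : muni ('X_(widen_ord (leqnSn n) j) : {mpoly K[n.+1]}) = ('X_j)%:P.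
  rewrite /muni mmapX mmap1U; case: splitP => /= k e.
    by congr ('X__)%:P; apply: val_inj.
  by move: (ltn_ord j); rewrite [X in (X < _)%N]e /= ltnNge leq_addr.
have uX : muni ('X_ord_max : {mpoly K[n.+1]}) = 'X.
  rewrite /muni mmapX mmap1U; case: splitP => //= k e.
  by move: (ltn_ord k); rewrite -e ltnn.
have [fK gK] : cancel (@muni n K) g /\ cancel g (@muni n K).
  split.
    apply: (@rmorph_mpoly_eq _ _ _ (g \o @muni n K) idfun) => [c|k].
      by rewrite [LHS](_ : _ = g (muni c%:MP)) // muniC gC mwidenC.
    rewrite [LHS](_ : _ = g (muni 'X_k)) //.
    case: (unliftP ord_max k) => [j|] ->; last by rewrite uX gX.
    have -> : lift ord_max j = widen_ord (leqnSn n) j by apply: val_inj; rewrite /= /bump leqNgt ltn_ord.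
    by rewrite uw gC wX.
  have uC : @muni n K \o @mwiden n K =1 @polyC {mpoly K[n]}.
    apply: rmorph_mpoly_eq => [c|k] /=; first by rewrite mwidenC muniC.
    by rewrite wX uw.
  elim/poly_ind => [|p c IHp]; first by rewrite !rmorph0.
  have -> : g (p * 'X + c%:P) = g p * 'X_ord_max + mwiden c.
    by rewrite rmorphD (rmorphM g) gX gC.
  by rewrite muniD muniM IHp uX; congr (_ + _); apply: uC.
exact: factorial_iso fK gK (factorial_poly IHn).
Qed.
End FactorialPoly.

(** * Polynomials as functions *)

Section PolynomialFunctions.
Context (K : numClosedFieldType).

Definition zariski_dense (S : K -> Prop) : Prop :=
  forall p : {poly K}, p != 0 -> exists2 t, S t & p.[t] != 0.

Lemma zariski_denseT : zariski_dense (fun=> True).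
Proof. by move=> p /poly_exneq0[t]; exists t. Qed.

(** Induction on n: the leading coefficient in the last variable is nonzero at some point with
    coordinates in S, and there p becomes a nonzero polynomial in one variable. *)
Lemma mpoly_dense n (S : K -> Prop) (p : {mpoly K[n]}) : zariski_dense S ->
  p != 0 -> exists2 x : 'cV[K]_n, (forall i, S (x i 0)) & pev p x != 0.
Proof.
move=> dS; elim: n p => [|n IHn] p p0.
  exists 0 => [[]//|]; rewrite /pev; apply: contra_neq p0 => e.
  have ep : p = (p@_0)%:MP.
    apply/mpolyP => m; rewrite mcoeffC.
    have -> : m = 0%MM by apply/mnmP => -[].
    by rewrite eqxx mulr1.
  by move: e; rewrite ep mevalC => ->.
have q0 : lead_coef (muni p) != 0.
  rewrite lead_coef_eq0; apply: contra_neq p0 => e.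
  (* [muni] loses no coefficient: that of m is found by splitting off the exponent of the last
     variable. *)
  apply/mpolyP => m; rewrite mcoeff0.
  have := congr1 (fun q : {poly {mpoly K[n]}} => (q`_(m ord_max))@_[multinom m (widen_ord (leqnSn n) i) | i < n]) e.
  rewrite coef0 mcoeff0 => <-; rewrite muniE coef_sum raddf_sum /=.
  rewrite {1}(mpolyE p) raddf_sum /=; apply: eq_bigr => m' _.
  rewrite coefZ coefXn mcoeffZ mcoeffX; case: (eqVneq m' m) => [->|ne].
    by rewrite eqxx !mulr1 mcoeffZ mcoeffX eqxx mulr1.
  case: (eqVneq (m ord_max) (m' ord_max)) => [e1|]; last by rewrite !mulr0 mcoeff0.
  rewrite mulr1 mcoeffZ mcoeffX; case: eqP => // e2; case/eqP: ne.
  apply/mnmP => i; case: (unliftP ord_max i) => [j|] -> //.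
  have -> : lift ord_max j = widen_ord (leqnSn n) j.
    by apply: val_inj; rewrite /= /bump leqNgt ltn_ord.
  by have /mnmP/(_ j) := e2; rewrite !mnmE.
have [x Sx px] := IHn _ q0.
pose q := map_poly (meval (fun i => x i 0)) (muni p).
have [|t St qt] := dS q.
  by apply: contra_neq px => e; rewrite /pev -[lead_coef _]/((muni p)`_(size (muni p)).-1) -coef_map -/q e coef0.
pose y : 'cV[K]_n.+1 := \col_i (if unlift ord_max i is Some j then x j 0 else t).
exists y => [i|]; first by rewrite mxE; case: unliftP.
suff -> : pev p y = q.[t] by [].
rewrite /pev /q.
apply: (@rmorph_mpoly_eq n.+1 K K (meval (fun i => y i 0))
  (horner_eval t \o map_poly (meval (fun i => x i 0)) \o @muni n K)) => [c|i].
  by rewrite /= /horner_eval muniC map_polyC /= hornerC !mevalC.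
rewrite /= mevalXU /horner_eval /muni mmapX mmap1U mxE; case: splitP => /= k e.
  rewrite map_polyC hornerC /= mevalXU; case: unliftP => [j ej|ei].
    by congr (x _ 0); apply: val_inj; rewrite -[RHS]e ej lift_max.
  by move: (ltn_ord k); rewrite -e ei ltnn.
rewrite map_polyX hornerX; case: unliftP => [j ej|//].
by move: (ltn_ord j); rewrite -[X in (X < _)%N]lift_max -ej [X in (X < _)%N]e ltnNge leq_addr.
Qed.

Lemma mpoly_eq0 n (p : {mpoly K[n]}) : (forall x, pev p x = 0) -> p = 0.
Proof.
move=> h; apply: contrapT => /eqP/(mpoly_dense zariski_denseT)[x _].
by rewrite h eqxx.
Qed.

Lemma mpoly_eq n (p q : {mpoly K[n]}) : (forall x, pev p x = pev q x) -> p = q.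
Proof.
by move=> h; apply/subr0_eq/mpoly_eq0 => x; rewrite /pev mevalB -!/(pev _ _) h subrr.
Qed.

Lemma mpoly_eq0_open n (p q : {mpoly K[n]}) : q != 0 ->
  (forall x, pev q x != 0 -> pev p x = 0) -> p = 0.
Proof.
move=> q0 h; have : p * q = 0.
  apply: mpoly_eq0 => x; rewrite pevM.
  by have [->|/h->] := eqVneq (pev q x) 0; rewrite (mulr0, mul0r).
by move/eqP; rewrite mulf_eq0 (negbTE q0) orbF => /eqP.
Qed.

(** This is how the scalar factors of lifts are shown to be constant along a line of parameters. *)
Lemma poly_nonvanishing (p : {poly K}) : (forall t, p.[t] != 0) -> p = (p.[0])%:P.
Proof.
move=> h; have : size p == 1%N.
  by apply: contraT => /closed_rootP[t /rootP] e; move: (h t); rewrite e eqxx.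
by move=> /eqP s1; rewrite (size1_polyC (eq_leq s1)) hornerC.
Qed.

Lemma col_neq0 n (x : 'cV[K]_n) : x != 0 -> exists i, x i 0 != 0.
Proof.
move=> x0; apply: contrapT => /forallNP h; move/eqP: x0; apply.
apply/matrixP => i j; rewrite ord1 mxE.
by apply/eqP; apply: contrapT => /negP; apply: h.
Qed.

End PolynomialFunctions.

(** * Automorphisms of the Grassmannian of lines are linear *)

Section Lifting.
Context (K : numClosedFieldType).
Local Notation pairs := 'cV[K]_(4 + 4).
Local Notation lifted := 'cV[{mpoly K[4 + 4]}]_6.

Definition pl_mp : lifted :=
  plucker (\col_i 'X_(lshift 4 i)) (\col_i 'X_(rshift 4 i)).

Definition pl (z : pairs) : 'cV[K]_6 := plucker (usubmx z) (dsubmx z).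

Lemma mev_pl_mp z : mev pl_mp z = pl z.
Proof. by apply/matrixP => i j; rewrite !mxE /pev mevalB !mevalM !mevalXU. Qed.

Lemma pl_col_mx u v : pl (col_mx u v) = plucker u v.
Proof. by rewrite /pl col_mxKu col_mxKd. Qed.

Definition pl_lift (F : 'cV[{mpoly K[6]}]_6) : lifted :=
  \col_i (F i 0 \mPo [tuple pl_mp j 0 | j < 6]).

Lemma mev_lift F z : mev (pl_lift F) z = mev F (pl z).
Proof.
apply/matrixP => i j; rewrite !mxE /pev comp_mpoly_meval.
by apply: meval_eq => k; rewrite tnth_mktuple -mev_pl_mp [RHS]mxE.
Qed.

Lemma pev_mev m n (F : 'cV[{mpoly K[n]}]_m) i x : pev (F i 0) x = mev F x i 0.
Proof. by rewrite mxE. Qed.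

Lemma line_pl z : pl z != 0 -> is_line (pl z).
Proof. by move=> nz; split=> //; exists (usubmx z), (dsubmx z). Qed.

Lemma line_ex x : is_line x -> exists2 z, pl z = x & pl z != 0.
Proof.
by move=> [x0 [u [v e]]]; exists (col_mx u v); rewrite pl_col_mx -e.
Qed.

Lemma pl_mp_neq0 : exists k, pl_mp k 0 != 0.
Proof.
have [x /line_ex[z _ /col_neq0[k nz]]] := @line_nonempty K; exists k.
by apply: contra_neq nz => e; rewrite -mev_pl_mp mxE e /pev meval0.
Qed.

Lemma mpoly_eq0_pl (p : {mpoly K[4 + 4]}) :
  (forall z, pl z != 0 -> pev p z = 0) -> p = 0.
Proof.
have [k kn] := pl_mp_neq0; move=> h; apply: (mpoly_eq0_open kn) => z nz.
by apply: h; rewrite -mev_pl_mp; apply: mev_neq0i nz.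
Qed.

(** P is the primitive part of one representative composed with the Pluecker map. Any other
    representative is proportional to it, hence a polynomial multiple of P; regularity provides at
    each line a representative that is nonzero there, so P is nonzero there too. *)
Lemma regular_lift (f : Bir (G13 K)) : regular f -> exists P : lifted,
  (forall p, prime_elt p -> exists i, ~ divides p (P i 0)) /\
  ((forall z, pl z != 0 -> mev P z != 0) /\
  (forall F (hF : is_birat (G13 K) F), f = to_bir hF ->
     exists2 h, h != 0 & forall i, pl_lift F i 0 = h * P i 0)).
Proof.
move=> rf; have [F [hF ef]] := birP f.
have nz F' (hF' : is_birat (G13 K) F') : exists i, pl_lift F' i 0 != 0.
  have [[_ [x /line_ex[z <- _] Fx] _] _] := hF'.
  have /mev_neq0[i nz] : mev (pl_lift F') z != 0 by rewrite mev_lift.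
  by exists i; apply: contra_neq nz => ->; rewrite /pev meval0.
have facM := @factorial_mpoly K (4 + 4).
have [g [P [eP prP]]] := primitive_part facM (nz F hF).
have g0 : g != 0 by have [k] := nz F hF; apply: contra_neq => e; rewrite eP e mul0r.
have [i0 Pi0] : exists i, P i != 0.
  by have [k] := nz F hF => ni; exists k; apply: contra_neq ni => e; rewrite eP e mulr0.
exists (\col_i P i); split; first by move=> p /prP[j]; exists j; rewrite mxE.
have main F' (hF' : is_birat (G13 K) F') : f = to_bir hF' ->
     exists2 h, h != 0 & forall i, pl_lift F' i 0 = h * (\col_i P i) i (0 : 'I_1).
  move=> ef'.
  have minors i j : pl_lift F i 0 * pl_lift F' j 0 = pl_lift F j 0 * pl_lift F' i 0.
    apply/subr0_eq/mpoly_eq0_pl => z /line_pl lz.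
    rewrite /pev mevalB !mevalM -!/(pev _ _) !pev_mev !mev_lift.
    have [->|n1] := eqVneq (mev F (pl z)) 0; first by rewrite !mxE !mul0r subrr.
    have [->|n2] := eqVneq (mev F' (pl z)) 0; first by rewrite !mxE !mulr0 subrr.
    have : Defs.rat_eq (G13 K) F F' by apply/(to_birP hF hF'); rewrite -ef -ef'.
    move=> /(_ _ lz n1 n2) /(same_point_minors n1 n2)/(_ i j) e.
    by rewrite e subrr.
  have minP i j : P i * pl_lift F' j 0 = P j * pl_lift F' i 0.
    by apply: (mulfI g0); rewrite !mulrA -!eP.
  have [h e] := primitive_proportional facM (ex_intro _ i0 Pi0) prP minP.
  exists h => [|i]; last by rewrite [RHS]mulrC mxE mulrC e.
  by have [k] := nz F' hF'; apply: contra_neq => e0; rewrite e e0 mul0r.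
split=> [z nzz|]; last exact: main.
have [y [F' [hF' [ef' n1 _]]]] := rf _ (line_pl nzz).
have [h _ eh] := main F' hF' ef'.
apply: contra_neq n1 => e; rewrite -mev_lift; apply/matrixP => i j.
by rewrite ord1 -pev_mev eh pevM pev_mev e !mxE mulr0.
Qed.

End Lifting.

(** * Semi-invariance of lifts under GL_2 *)

Section SemiInvariance.
Context (K : numClosedFieldType).

Lemma line_poly n (p : {mpoly K[n]}) (x y : 'cV[K]_n) :
  exists q : {poly K}, forall t, q.[t] = pev p (x + t *: y).
Proof.
exists (mmap polyC (fun i => segment x (x + y) i 0) p) => t.
by rewrite -pev_path segmentE addrAC subrr add0r.
Qed.

Lemma poly_nonvanishing0 (p : {poly K}) : (forall t, t != 0 -> p.[t] != 0) ->
  exists d, forall t, p.[t] = t ^+ d * p.[1].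
Proof.
move=> h; have p0 : p != 0.
  by have := h 1 (oner_neq0 _); apply: contra_neq => ->; rewrite horner0.
have [d [q nr e]] := multiplicity_XsubC p 0; rewrite p0 /= in nr.
have /poly_nonvanishing eq : forall t, q.[t] != 0.
  move=> t; have [->//|t0] := eqVneq t 0.
  by have := h t t0; rewrite e hornerM mulf_eq0 negb_or => /andP[].
exists d => t; rewrite e eq !hornerM !hornerC !horner_exp !hornerXsubC !subr0.
by rewrite expr1n mulr1 mulrC.
Qed.

Definition msubst n (L : 'M[K]_n) (p : {mpoly K[n]}) : {mpoly K[n]} :=
  p \mPo [tuple \sum_k L j k *: 'X_k | j < n].

Lemma pev_msubst n (L : 'M[K]_n) p z : pev (msubst L p) z = pev p (L *m z).
Proof.
rewrite /pev comp_mpoly_meval; apply: meval_eq => j.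
rewrite tnth_mktuple raddf_sum /= mxE; apply: eq_bigr => k _.
by rewrite mevalZ mevalXU.
Qed.

Lemma mpoly_unitE n (h k : {mpoly K[n]}) : h * k = 1 ->
  exists2 c, c != 0 & forall z, pev h z = c.
Proof.
move=> e; have /mpoly_intro_unit/andP[/eqP eh u] : k * h = 1 by rewrite mulrC.
by exists (h@_0); rewrite -?unitfE // => z; rewrite eh /pev mevalC mcoeffC eqxx mulr1.
Qed.

Definition is_lift (f : Bir (G13 K)) (P : 'cV[{mpoly K[4 + 4]}]_6) : Prop :=
  (forall p, prime_elt p -> exists i, ~ divides p (P i 0)) /\
  ((forall z, pl z != 0 -> mev P z != 0) /\
  (forall F (hF : is_birat (G13 K) F), f = to_bir hF ->
     exists2 h, h != 0 & forall i, pl_lift F i 0 = h * P i 0)).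

Context (f : Bir (G13 K)) (P : 'cV[{mpoly K[4 + 4]}]_6) (hP : is_lift f P).

Lemma lift_neq0 : exists i, P i 0 != 0.
Proof.
have [x /line_ex[z _ nz]] := @line_nonempty K.
have [_ [/(_ z nz)/mev_neq0[k pk] _]] := hP; exists k.
by apply: contra_neq pk => ->; rewrite /pev meval0.
Qed.

(** F is homogeneous, so scaling the Pluecker vector sends P to a proportional family; primitivity
    makes the ratio a polynomial. *)
Lemma lift_subst (L : 'M[K]_(4 + 4)) c : L \in unitmx -> c != 0 ->
  (forall z, pl (L *m z) = c *: pl z) ->
  exists h, forall i, msubst L (P i 0) = h * P i 0.
Proof.
move=> uL c0 plL; have [prP [nzP repP]] := hP; have [F [hF ef]] := birP f.
have [h h0 eh] := repP F hF ef; have [[[D hD] _ _] _] := hF.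
apply: (primitive_proportional (@factorial_mpoly K (4 + 4)) lift_neq0 prP).
move=> i j; have g0 : msubst L h * h != 0.
  rewrite mulf_neq0 //.
  have [z _] := mpoly_dense (@zariski_denseT K) h0.
  rewrite -[z](mulKVmx uL) -pev_msubst; apply: contra_neq => ->.
  by rewrite /pev meval0.
apply: (mulfI g0); apply: mpoly_eq => z.
have E k w : pev h w * pev (P k 0) w = mev F (pl w) k 0.
  by rewrite -pevM -eh pev_mev mev_lift.
have S k : mev F (pl (L *m z)) k 0 = c ^+ D * mev F (pl z) k 0.
  by rewrite plL !mxE (pevZ _ _ (hD k)).
transitivity (mev F (pl z) i 0 * mev F (pl (L *m z)) j 0).
  by rewrite !pevM !pev_msubst -!E; ring.
transitivity (mev F (pl z) j 0 * mev F (pl (L *m z)) i 0).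
  by rewrite !S; ring.
by rewrite !pevM !pev_msubst -!E; ring.
Qed.

(** The inverse substitution has a polynomial factor as well, so the factor of L is a unit, that is,
    a nonzero constant. *)
Lemma lift_semi (L : 'M[K]_(4 + 4)) c : L \in unitmx -> c != 0 ->
  (forall z, pl (L *m z) = c *: pl z) ->
  exists2 a, a != 0 & forall z, mev P (L *m z) = a *: mev P z.
Proof.
move=> uL c0 plL; have [h eh] := lift_subst uL c0 plL.
have [|||k ek] := @lift_subst (invmx L) c^-1.
- by rewrite unitmx_inv.
- by rewrite invr_eq0.
- by move=> z; rewrite -{2}[z](mulKVmx uL) plL scalerA mulVf // scale1r.
have [i0 Pi0] := lift_neq0.
have [|a a0 ea] := @mpoly_unitE _ h (msubst L k).
  apply: (mulIf Pi0); rewrite mul1r; apply: mpoly_eq => z.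
  rewrite mulrAC -eh pevM !pev_msubst mulrC -pevM -ek pev_msubst.
  by rewrite mulKmx.
exists a => // z; apply/matrixP => i j; rewrite ord1 [RHS]mxE -!pev_mev.
by rewrite -pev_msubst eh pevM ea.
Qed.

Definition pair_ev (u v : 'cV[K]_4) : 'cV[K]_6 := mev P (col_mx u v).

Lemma pair_ev_neq0 u v : plucker u v != 0 -> pair_ev u v != 0.
Proof. by move=> nz; apply: hP.2.1; rewrite pl_col_mx. Qed.

Lemma lines_ex : exists u v : 'cV[K]_4, plucker u v != 0.
Proof.
have [x /line_ex[z _ nz]] := @line_nonempty K.
by exists (usubmx z), (dsubmx z).
Qed.

(** The factor by which this shear acts is, up to a constant, a polynomial in s; it has no zero
    because the shear by -s undoes it. *)
Lemma pair_evU s u v : pair_ev (u + s *: v) v = pair_ev u v.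
Proof.
have sc t : exists a, forall u v, pair_ev (u + t *: v) v = a *: pair_ev u v.
  have [||| a _ ea] := @lift_semi (block_mx 1%:M t%:M 0 1%:M) 1.
  - by rewrite unitmxE det_ublock !det1 mulr1 unitr1.
  - exact: oner_neq0.
  - move=> z; rewrite -[z]vsubmxK mul_block_col !mul1mx mul0mx add0r mul_scalar_mx.
    rewrite !pl_col_mx scale1r; apply/matrixP => i j; rewrite !mxE; ring.
  exists a => x y; rewrite /pair_ev -ea mul_block_col !mul1mx mul0mx add0r.
  by rewrite mul_scalar_mx.
have [u0 [v0 nz]] := lines_ex; have /mev_neq0[k nk] := pair_ev_neq0 nz.
have [q eq] := line_poly (P k 0) (col_mx u0 v0) (col_mx v0 0).
have qE t : q.[t] = pair_ev (u0 + t *: v0) v0 k 0.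
  by rewrite eq scale_col_mx add_col_mx scaler0 addr0 pev_mev.
have /poly_nonvanishing cst : forall t, q.[t] != 0.
  move=> t; rewrite qE; have [a ea] := sc t; have [b eb] := sc (- t).
  have := eb (u0 + t *: v0) v0; rewrite scaleNr addrK => e0.
  by apply: contra_neq nk => e; rewrite pev_mev -/(pair_ev _ _) e0 mxE e mulr0.
have [a ea] := sc s; suff a1 : a = 1 by rewrite ea a1 scale1r.
have := qE s; rewrite ea cst hornerC qE scale0r addr0 [RHS]mxE => e.
by apply: (mulIf nk); rewrite mul1r pev_mev [RHS]e.
Qed.

Lemma pair_evL s u v : pair_ev u (v + s *: u) = pair_ev u v.
Proof.
have sc t : exists a, forall u v, pair_ev u (v + t *: u) = a *: pair_ev u v.
  have [||| a _ ea] := @lift_semi (block_mx 1%:M 0 t%:M 1%:M) 1.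
  - by rewrite unitmxE det_lblock !det1 mulr1 unitr1.
  - exact: oner_neq0.
  - move=> z; rewrite -[z]vsubmxK mul_block_col !mul1mx mul0mx addr0 mul_scalar_mx.
    rewrite !pl_col_mx scale1r; apply/matrixP => i j; rewrite !mxE; ring.
  exists a => x y; rewrite /pair_ev -ea mul_block_col !mul1mx mul0mx addr0.
  by rewrite mul_scalar_mx addrC.
have [u0 [v0 nz]] := lines_ex; have /mev_neq0[k nk] := pair_ev_neq0 nz.
have [q eq] := line_poly (P k 0) (col_mx u0 v0) (col_mx 0 u0).
have qE t : q.[t] = pair_ev u0 (v0 + t *: u0) k 0.
  by rewrite eq scale_col_mx add_col_mx scaler0 addr0 pev_mev.
have /poly_nonvanishing cst : forall t, q.[t] != 0.
  move=> t; rewrite qE; have [b eb] := sc (- t).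
  have := eb u0 (v0 + t *: u0); rewrite scaleNr addrK => e0.
  by apply: contra_neq nk => e; rewrite pev_mev -/(pair_ev _ _) e0 mxE e mulr0.
have [a ea] := sc s; suff a1 : a = 1 by rewrite ea a1 scale1r.
have := qE s; rewrite ea cst hornerC qE scale0r addr0 [RHS]mxE => e.
by apply: (mulIf nk); rewrite mul1r pev_mev [RHS]e.
Qed.

(** The rotation of the pair is a product of three shears: (u, v), (u + v, v), (u + v, - u), (v, -
    u). *)
Lemma pair_ev_swap u v : pair_ev v (- u) = pair_ev u v.
Proof.
rewrite -(pair_evU 1 u v) scale1r -(pair_evL (-1) (u + v) v) scaleN1r opprD.
by rewrite addrCA subrr addr0 -(pair_evU 1 (u + v)) scale1r addrAC subrr add0r.
Qed.

(** The factor is a polynomial in t without zeros outside 0, hence a power of t up to a constant,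
    which is 1 by evaluation at t = 1. *)
Lemma pair_evT : exists d, forall t u v, t != 0 ->
  pair_ev (t *: u) v = t ^+ d *: pair_ev u v.
Proof.
have sc t : t != 0 -> exists2 a, a != 0 & forall u v, pair_ev (t *: u) v = a *: pair_ev u v.
  move=> t0; have [||| a a0 ea] := @lift_semi (block_mx t%:M 0 0 1%:M) t => //.
  - by rewrite unitmxE det_ublock det1 mulr1 det_scalar unitrX // unitfE.
  - move=> z; rewrite -[z]vsubmxK mul_block_col !mul1mx !mul0mx addr0 add0r mul_scalar_mx.
    rewrite !pl_col_mx; apply/matrixP => i j; rewrite !mxE; ring.
  exists a => // x y; rewrite /pair_ev -ea mul_block_col !mul1mx !mul0mx addr0 add0r.
  by rewrite mul_scalar_mx.
have [u0 [v0 nz]] := lines_ex; have /mev_neq0[k nk] := pair_ev_neq0 nz.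
have [q eq] := line_poly (P k 0) (col_mx 0 v0) (col_mx u0 0).
have qE t : q.[t] = pair_ev (t *: u0) v0 k 0.
  by rewrite eq scale_col_mx add_col_mx scaler0 addr0 add0r pev_mev.
have [|d ed] := @poly_nonvanishing0 q.
  move=> t /sc[a a0 ea]; rewrite qE ea mxE mulf_neq0 //.
  by rewrite pev_mev in nk.
exists d => t u v t0; have [a a0 ea] := sc t t0; rewrite ea; congr (_ *: _).
have := ed t; rewrite !qE ea scale1r mxE; apply: mulIf.
by rewrite pev_mev in nk.
Qed.

(** Gaussian elimination writes a 2 by 2 matrix with nonzero corner as shears and scalings; shears
    act trivially, so only the determinant counts. *)
Lemma pair_evGL : exists d, forall u v a b c e, a * e - b * c != 0 ->
  pair_ev (a *: u + b *: v) (c *: u + e *: v) = (a * e - b * c) ^+ d *: pair_ev u v.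
Proof.
have [d hd] := pair_evT; exists d => u v a b c e; set D := a * e - b * c => D0.
have hd' t x y : t != 0 -> pair_ev x (t *: y) = t ^+ d *: pair_ev x y.
  by move=> t0; rewrite -[t *: y]opprK pair_ev_swap -scalerN hd // -pair_ev_swap opprK.
have main x y a' b' c' e' : a' != 0 -> a' * e' - b' * c' != 0 ->
  pair_ev (a' *: x + b' *: y) (c' *: x + e' *: y) = (a' * e' - b' * c') ^+ d *: pair_ev x y.
  move=> a0 D'0.
  have -> : c' *: x + e' *: y = ((a' * e' - b' * c') / a') *: y + (c' / a') *: (a' *: x + b' *: y).
    apply/matrixP => i j; rewrite !mxE; field; exact: a0.
  rewrite pair_evL hd' ?mulf_neq0 ?invr_eq0 // pair_evU hd // scalerA.
  by rewrite -exprMn divfK.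
have [a0|a0] := eqVneq a 0; last exact: main.
have c0 : c != 0 by apply: contra_neq D0 => c0; rewrite /D a0 c0; ring.
(* For a = 0, adding the second vector to the first makes the corner equal to c, which is
   nonzero. *)
rewrite -(pair_evU 1) scale1r.
have -> : a *: u + b *: v + (c *: u + e *: v) = c *: u + (b + e) *: v.
  by rewrite a0 scale0r add0r scalerDl addrCA.
have eD : D = c * e - (b + e) * c by rewrite /D a0; ring.
by rewrite eD main // -eD.
Qed.

End SemiInvariance.

(** * Polynomials in one variable *)

Section UnivariateTools.
Context (K : numClosedFieldType).

(** The Nullstellensatz in one variable: the gcd of the A i has no root, so it is a nonzero
    constant. *)
Lemma bezout_finite (I : finType) (A : I -> {poly K}) :
  (forall t, exists i, (A i).[t] != 0) -> exists c, \sum_i c i * A i = 1.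
Proof.
move=> hA; pose comb (g : {poly K}) := exists c, g = \sum_i c i * A i.
have combD g h a b : comb g -> comb h -> comb (a * g + b * h).
  move=> [c ->] [c' ->]; exists (fun i => a * c i + b * c' i).
  by rewrite !mulr_sumr -big_split /=; apply: eq_bigr => i _; ring.
have combA i : comb (A i).
  exists (fun j => (j == i)%:R); rewrite (bigD1 i) //= eqxx mul1r big1 ?addr0 //.
  by move=> j /negbTE ->; rewrite mul0r.
have [g [[c eg] gA]] : exists g, comb g /\ forall i, i \in enum I -> g %| A i.
  elim: (enum I) => [|x r [g [cg hg]]].
    by exists 0; split => //; exists (fun=> 0); rewrite big1 // => i _; rewrite mul0r.
  have [[a b] /= e] := Bezoutp (A x) g; exists (a * A x + b * g); split.
    exact: combD.
  move=> i; rewrite inE (eqp_dvdl _ e) => /orP[/eqP->|/hg h]; first exact: dvdp_gcdl.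
  exact: dvdp_trans (dvdp_gcdr _ _) h.
have /poly_nonvanishing g0 : forall t, g.[t] != 0.
  move=> t; have [j nj] := hA t; apply: contra_neq nj => e; apply/eqP.
  have : root g t by apply/rootP.
  by move/(dvdp_trans _): (gA j (mem_enum _ j)); rewrite -dvdp_XsubCl => h /h; rewrite dvdp_XsubCl.
have nz : g.[0] != 0.
  have [j nj] := hA 0; apply: contra_neq nj => e.
  have := gA j (mem_enum _ j); rewrite g0 e dvd0p => /eqP ->; exact: horner0.
exists (fun i => (g.[0]^-1)%:P * c i); under eq_bigr => i _ do rewrite -mulrA.
by rewrite -mulr_sumr -eg [X in _ * X]g0 -polyCM mulVf.
Qed.

(** A function that near each point is a quotient of polynomials is a polynomial: if the c i * A i
    sum to 1, then k is the sum of the c i * B i. *)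
Lemma polynomial_quotient (I : finType) (A B : I -> {poly K}) (k : K -> K) :
  (forall t, exists i, (A i).[t] != 0) ->
  (forall t i, k t * (A i).[t] = (B i).[t]) -> exists q : {poly K}, forall t, q.[t] = k t.
Proof.
move=> /bezout_finite[c ec] kA; exists (\sum_i c i * B i) => t.
have e1 : (\sum_i c i * A i).[t] = 1 by rewrite ec hornerC.
rewrite -[RHS]mulr1 -e1 !horner_sum mulr_sumr.
by apply: eq_bigr => i _; rewrite !hornerM -kA; ring.
Qed.

Lemma poly_eq_nonzero (p q : {poly K}) : (forall t, t != 0 -> p.[t] = q.[t]) -> p = q.
Proof.
move=> h; apply: contrapT => /eqP; rewrite -subr_eq0 => ne.
have [t] := poly_exneq0 (mulf_neq0 ne (negbT (polyX_eq0 K))).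
rewrite hornerM hornerX mulf_eq0 negb_or => /andP[+ t0].
by rewrite hornerD hornerN h // subrr eqxx.
Qed.

(* r(s) = s r'(1/s) forces r_0 = r'_1, r_1 = r'_0 and r_k = 0 for k > 1. *)
Lemma linear_reversal (r r' : {poly K}) :
  (forall s, s != 0 -> r.[s] = s * r'.[s^-1]) -> r.[1] = r.[0] + r'.[0].
Proof.
move=> h; pose N := size r'.
(* X^N clears the denominators of s r'(1/s), whose coefficients then run backwards from degree N +
   1. *)
have e : 'X^N * r = \poly_(i < N.+2) r'`_(N.+1 - i).
  apply: poly_eq_nonzero => s s0; rewrite hornerM hornerXn h // horner_poly.
  rewrite (horner_coef_wide _ (leq_trans (leqnSn N) (leqnSn _))) !mulr_sumr.
  rewrite (reindex_inj rev_ord_inj) /=; apply: eq_bigr => i _.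
  have le : (i <= N.+1)%N by rewrite -ltnS.
  rewrite subSS exprVn [s ^+ N * _]mulrA -exprSr -{1}(subnK le) exprD; field.
  by rewrite expf_neq0.
have c k : r`_k = if (k < 2)%N then r'`_(1 - k) else 0.
  have := congr1 (fun q : {poly K} => q`_(N + k)) e; rewrite coefXnM coef_poly.
  rewrite ltnNge leq_addr /= addKn => ->.
  by rewrite -addn2 ltn_add2l -[N.+1]addn1 subnDl.
have -> : r = r'`_1 *: 1 + r'`_0 *: 'X.
  apply/polyP => k; rewrite c coefD !coefZ coef1 coefX.
  by case: k => [|[|k]] /=; rewrite ?mulr0 ?mulr1 ?addr0 ?add0r.
by rewrite !hornerE -horner_coef0.
Qed.

End UnivariateTools.

Section PolynomialMaps.
Context (K : numClosedFieldType).

Definition polyfun (phi : K -> K) : Prop := exists q : {poly K}, forall t, q.[t] = phi t.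

Lemma polyfunC c : polyfun (fun=> c).
Proof. by exists c%:P => t; rewrite hornerC. Qed.

Lemma polyfunM a b : polyfun a -> polyfun b -> polyfun (fun t => a t * b t).
Proof. by move=> [p hp] [q hq]; exists (p * q) => t; rewrite hornerM hp hq. Qed.

Lemma polyfunX a n : polyfun a -> polyfun (fun t => a t ^+ n).
Proof. by move=> [p hp]; exists (p ^+ n) => t; rewrite horner_exp hp. Qed.

Lemma polyfun_sum (I : finType) (a : I -> K -> K) :
  (forall i, polyfun (a i)) -> polyfun (fun t => \sum_i a i t).
Proof.
move=> /choice[q hq]; exists (\sum_i q i) => t.
by rewrite horner_sum; apply: eq_bigr => i _.
Qed.

Lemma polyfun_pev n (p : {mpoly K[n]}) (x : K -> 'cV[K]_n) :
  (forall j, polyfun (fun t => x t j 0)) -> polyfun (fun t => pev p (x t)).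
Proof.
move=> /choice[q hq]; exists (mmap polyC (fun i => (\col_j q j) i (0 : 'I_1)) p) => t.
by rewrite -pev_path; congr pev; apply/matrixP => i j; rewrite !mxE hq ord1.
Qed.

End PolynomialMaps.

Section RowContraction.
Context (K : numClosedFieldType).

(** The entries of the alternating 4 by 4 matrix with Pluecker coordinates p. *)
Definition plucker_entry (p : 'cV[K]_6) (i j : 'I_4) : K :=
  \sum_k p k 0 * (((pl_fst k == i) && (pl_snd k == j))%:R
                  - ((pl_fst k == j) && (pl_snd k == i))%:R).

Definition plucker_row (p : 'cV[K]_6) (i : 'I_4) : 'cV[K]_4 :=
  \col_j plucker_entry p i j.

Lemma ord4P (Q : 'I_4 -> Prop) :
  Q (@Ordinal 4 0 isT) -> Q (@Ordinal 4 1 isT) -> Q (@Ordinal 4 2 isT) ->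
  Q (@Ordinal 4 3 isT) -> forall k, Q k.
Proof.
move=> p0 p1 p2 p3 [m lt_m].
by case: m lt_m => [|[|[|[|//]]]] lt_m; rewrite (bool_irrelevance lt_m isT).
Qed.

(** The alternating matrix is u v^T - v u^T, so its rows lie in the span of u and v. This recovers
    points of a line polynomially from its Pluecker vector. *)
Lemma plucker_row_plucker u v i :
  plucker_row (plucker u v) i = (- v i 0) *: u + u i 0 *: v.
Proof.
apply/matrixP => j k; rewrite !mxE ord1 /plucker_entry sum6 !mxE.
by elim/ord4P: i; elim/ord4P: j; rewrite /= ; ring.
Qed.

Lemma plucker_rowZ c p i : plucker_row (c *: p) i = c *: plucker_row p i.
Proof.
apply/matrixP => j k; rewrite !mxE /plucker_entry mulr_sumr.
by apply: eq_bigr => l _; rewrite mxE mulrA.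
Qed.

End RowContraction.

Section Composition.
Context (K : numClosedFieldType).
Variables (f : Bir (G13 K)) (P Q : 'cV[{mpoly K[4 + 4]}]_6).
Hypotheses (rf : regular f) (rg : regular f^-1%g).
Hypotheses (hP : is_lift f P) (hQ : is_lift f^-1%g Q).

Lemma lift_rep F (hF : is_birat (G13 K) F) z : f = to_bir hF ->
  mev F (pl z) != 0 -> exists2 c, c != 0 & mev F (pl z) = c *: mev P z.
Proof.
move=> ef nz; have [h _ eh] := hP.2.2 F hF ef; exists (pev h z); last first.
  rewrite -mev_lift; apply/matrixP => i j.
  by rewrite ord1 [RHS]mxE -!pev_mev eh pevM.
apply: contra_neq nz => e; rewrite -mev_lift; apply/matrixP => i j.
by rewrite ord1 -pev_mev eh pevM e mul0r mxE.
Qed.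

Lemma pair_ev_line u v : plucker u v != 0 -> is_line (pair_ev P u v).
Proof.
rewrite -pl_col_mx => nz; have [y [F [hF [ef n1 _]]]] := rf (line_pl nz).
have [c c0 e] := lift_rep ef n1; have [[_ _ FX] _] := hF.
have := FX _ (line_pl nz) n1; rewrite e => h.
rewrite /pair_ev -[mev P _]scale1r -(mulVf c0) -scalerA.
by apply: (@pv_scale K 5 (G13 K)) => //; rewrite invr_eq0.
Qed.

End Composition.

(** * The degree of the lift *)

Section Degree.
Context (K : numClosedFieldType).
Variables (f : Bir (G13 K)) (P Q : 'cV[{mpoly K[4 + 4]}]_6) (d e : nat).
Hypotheses (rf : regular f) (rg : regular f^-1%g).
Hypotheses (hP : is_lift f P) (hQ : is_lift f^-1%g Q).
Hypotheses (P_gl : forall u v a b c e, a * e - b * c != 0 ->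
  pair_ev P (a *: u + b *: v) (c *: u + e *: v) = (a * e - b * c) ^+ d *: pair_ev P u v).
Hypotheses (Q_gl : forall u v a b c e', a * e' - b * c != 0 ->
  pair_ev Q (a *: u + b *: v) (c *: u + e' *: v) = (a * e' - b * c) ^+ e *: pair_ev Q u v).

Lemma pair_ev_comp u v u' v' : plucker u v != 0 -> plucker u' v' = pair_ev P u v ->
  exists2 k, k != 0 & pair_ev Q u' v' = k *: plucker u v.
Proof.
move=> nz e'; have lx : is_line (plucker u v) by rewrite -pl_col_mx; apply: line_pl; rewrite pl_col_mx.
have [_ [F [hF [ef n1 _]]]] := rf lx.
have [c c0 ec] : exists2 c, c != 0 & mev F (plucker u v) = c *: pair_ev P u v.
  by move: n1; rewrite -pl_col_mx; apply: (lift_rep hP ef).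
have ly : is_line (mev F (plucker u v)) by have [[_ _ h] _] := hF; apply: h.
have [_ [G [hG [eg n2 _]]]] := rg ly.
have ey : mev F (plucker u v) = plucker (c *: u') v'.
  by rewrite ec -e'; apply/matrixP => i j; rewrite !mxE; ring.
have [b b0 eb] : exists2 b, b != 0 & mev G (mev F (plucker u v)) = b *: pair_ev Q (c *: u') v'.
  by move: n2; rewrite ey -pl_col_mx; apply: (lift_rep hQ eg).
have eQ : pair_ev Q (c *: u') v' = c ^+ e *: pair_ev Q u' v'.
  have := @Q_gl u' v' c 0 0 1; rewrite mulr1 mulr0 subr0 !scale0r addr0 add0r scale1r.
  by move->.
have : Defs.rat_eq (G13 K) (rat_comp G F) (@rat_id K 5).
  apply/(to_birP (is_birat_comp hG hF) (is_birat_id (G13 K))).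
  rewrite -bir_mulE -ef -eg; exact: mulVg.
case/(_ _ lx); rewrite ?mev_comp ?mev_id // => k k0 ek.
exists (k * b * c ^+ e)^-1; first by rewrite invr_eq0 !mulf_neq0 ?expf_neq0.
rewrite ek eb eQ !scalerA mulVf ?scale1r //.
by rewrite !mulf_neq0 ?expf_neq0.
Qed.

Local Notation row1 p k := (plucker_row p (pl_fst k)).
Local Notation row2 p k := (plucker_row p (pl_snd k)).

(** By [plucker_row_plucker] the two rows are the images of u and v under a 2 by 2 matrix whose
    determinant is the k-th Pluecker coordinate. *)
Lemma pair_ev_rows u v k : plucker u v k 0 != 0 ->
  pair_ev Q (row1 (plucker u v) k) (row2 (plucker u v) k) =
    (plucker u v k 0) ^+ e *: pair_ev Q u v.
Proof.
rewrite mxE => nz; rewrite !plucker_row_plucker Q_gl; last first.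
  by move: nz; congr (_ != 0); ring.
by congr (_ ^+ _ *: _); ring.
Qed.

(* The composite of the two lifts multiplies the Pluecker coordinates by kap. *)
Definition is_factor u v kap := kap != 0 /\ forall k,
  pair_ev P u v k 0 != 0 ->
  pair_ev Q (row1 (pair_ev P u v) k) (row2 (pair_ev P u v) k) =
    (pair_ev P u v k 0 ^+ e * kap) *: plucker u v.

Lemma factor_ex u v : plucker u v != 0 -> exists kap, is_factor u v kap.
Proof.
move=> nz; have [_ [u' [v' e']]] := pair_ev_line rf hP nz.
have [k k0 ek] := pair_ev_comp nz (esym e'); exists k; split => // i.
by rewrite e' => ni; rewrite pair_ev_rows // ek scalerA.
Qed.

(** Replacing v by t v multiplies the Pluecker vector by t and the composite of the lifts by t^(d
    e). *)
Lemma factor_scale u v t a b : plucker u v != 0 -> t != 0 ->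
  is_factor u v a -> is_factor u (t *: v) b -> t * b = t ^+ (d * e) * a.
Proof.
move=> nz t0 [a0 ha] [b0 hb].
have [k nk] : exists k, pair_ev P u v k 0 != 0.
  by apply/col_neq0/(pair_ev_neq0 hP).
have eP : pair_ev P u (t *: v) = t ^+ d *: pair_ev P u v.
  have := @P_gl u v 1 0 0 t; rewrite mul1r mulr0 subr0 !scale0r addr0 add0r scale1r.
  by move->.
have := hb k; rewrite eP [X in X != 0]mxE [X in (X ^+ e * b)]mxE mulf_neq0 ?expf_neq0 // => /(_ isT).
rewrite !plucker_rowZ; set s := t ^+ d; have s0 : s != 0 by rewrite expf_neq0.
have := @Q_gl (row1 (pair_ev P u v) k) (row2 (pair_ev P u v) k) s 0 0 s.
rewrite mulr0 subr0 !scale0r addr0 add0r mulf_neq0 // => -> //.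
have -> : plucker u (t *: v) = t *: plucker u v.
  by apply/matrixP => i j; rewrite !mxE; ring.
rewrite ha // !scalerA; set pk := pair_ev P u v k 0.
move/eqP; rewrite -subr_eq0 -scalerBl scaler_eq0 (negbTE nz) orbF subr_eq0 => /eqP E.
have : (s * pk) ^+ e * (t * b) = (s * pk) ^+ e * (s ^+ e * a).
  transitivity ((s * s) ^+ e * (pk ^+ e * a)); last by rewrite !exprMn; ring.
  by rewrite E; ring.
by move/(mulfI (expf_neq0 e (mulf_neq0 s0 nk))) ->; rewrite /s exprM.
Qed.

Lemma factor_uniq u v a b : plucker u v != 0 ->
  is_factor u v a -> is_factor u v b -> a = b.
Proof.
move=> nz [_ ha] [_ hb].
have [k nk] : exists k, pair_ev P u v k 0 != 0 by apply/col_neq0/(pair_ev_neq0 hP).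
move: (hb k nk); rewrite ha // => /eqP.
rewrite -subr_eq0 -scalerBl scaler_eq0 (negbTE nz) orbF subr_eq0 => /eqP.
by move/(mulfI (expf_neq0 e nk)).
Qed.

(** Along a pencil of lines through u the factor is locally a quotient of polynomials in t, hence a
    polynomial; it never vanishes, so it is constant. *)
Lemma factor_line u v w a s b : (forall t, plucker u (v + t *: w) != 0) ->
  is_factor u v a -> is_factor u (v + s *: w) b -> a = b.
Proof.
move=> nz; have ex t : exists k, is_factor u (v + t *: w) k by apply: factor_ex.
have [kap hk] := choice ex.
pose p t := pair_ev P u (v + t *: w).
have pp k : polyfun (fun t => p t k 0).
  have [q eq] := line_poly (P k 0) (col_mx u v) (col_mx 0 w); exists q => t.
  by rewrite eq pev_mev scale_col_mx add_col_mx scaler0 addr0.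
have pl' m : polyfun (fun t => plucker u (v + t *: w) m 0).
  have [q eq] := line_poly (pl_mp K m 0) (col_mx u v) (col_mx 0 w); exists q => t.
  by rewrite eq pev_mev mev_pl_mp scale_col_mx add_col_mx pl_col_mx scaler0 addr0.
have pr i j : polyfun (fun t => plucker_row (p t) i j 0).
  have [q eq] : polyfun (fun t => plucker_entry (p t) i j).
    by apply: polyfun_sum => k; apply: polyfunM => //; apply: polyfunC.
  by exists q => t; rewrite mxE.
(* One more factor [p t x.1 0] than in [is_factor] is put on both sides, so that the identity
   survives where this coordinate vanishes. *)
have pA (x : 'I_6 * 'I_6) : polyfun (fun t => p t x.1 0 ^+ e.+1 * plucker u (v + t *: w) x.2 0).
  by apply: polyfunM => //; apply: polyfunX.
have pB (x : 'I_6 * 'I_6) : polyfun (fun t => p t x.1 0 * pair_ev Q (row1 (p t) x.1) (row2 (p t) x.1) x.2 0).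
  apply: polyfunM => //.
  have [|q eq] := @polyfun_pev K _ (Q x.2 0) (fun t => col_mx (row1 (p t) x.1) (row2 (p t) x.1)); last first.
    by exists q => t; rewrite eq pev_mev.
  move=> j; case: (split_ordP j) => i ->.
    by have [q eq] := pr (pl_fst x.1) i; exists q => t; rewrite eq col_mxEu.
  by have [q eq] := pr (pl_snd x.1) i; exists q => t; rewrite eq col_mxEd.
have [A hA] := choice pA; have [B hB] := choice pB.
have [||q eq] := @polynomial_quotient K _ A B kap.
- move=> t; have [k nk] : exists k, p t k 0 != 0 by apply/col_neq0/(pair_ev_neq0 hP).
  have [m nm] := col_neq0 (nz t); exists (k, m).
  by rewrite hA mulf_neq0 // expf_neq0.
- move=> t [k m]; rewrite hA hB /=; have [p0|p0] := eqVneq (p t k 0) 0.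
    by rewrite p0 expr0n !mul0r mulr0.
  rewrite (hk t).2 // -/(p t).
  have -> c (x : 'cV[K]_6) : (c *: x) m 0 = c * x m 0 by rewrite mxE.
  by rewrite exprS; ring.
have /poly_nonvanishing eq0 : forall t, q.[t] != 0 by move=> t; rewrite eq (hk t).1.
move=> ha hb; have h0 := hk 0; have nz0 := nz 0; rewrite scale0r addr0 in h0 nz0.
by rewrite -(factor_uniq nz0 h0 ha) -(factor_uniq (nz s) (hk s) hb) -!eq eq0 !hornerC.
Qed.

(** The line joining u to v + s w is the one joining u to w + s^-1 v, with second vectors differing
    by the scalar s. Since the factors a and b are constant on the two pencils, s a = s^(d e) b for
    all nonzero s; the values s = 1 and s = 2 decide. *)
Lemma lift_degree : (d * e = 1)%N.
Proof.
pose u : 'cV[K]_4 := vec4 1 0 0 0.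
pose v : 'cV[K]_4 := vec4 0 1 0 0; pose w : 'cV[K]_4 := vec4 0 0 1 0.
have nz1 t : plucker u (v + t *: w) != 0.
  apply/eqP => /matrixP/(_ (@Ordinal 6 0 isT) 0); rewrite !mxE /= => /eqP.
  by rewrite mulr0 addr0 mul1r mul0r subr0 oner_eq0.
have nz2 t : plucker u (w + t *: v) != 0.
  apply/eqP => /matrixP/(_ (@Ordinal 6 1 isT) 0); rewrite !mxE /= => /eqP.
  by rewrite mulr0 addr0 mul1r mul0r subr0 oner_eq0.
have [a ha] : exists a, is_factor u v a.
  by apply: factor_ex; have := nz1 0; rewrite scale0r addr0.
have [b hb] : exists a, is_factor u w a.
  by apply: factor_ex; have := nz2 0; rewrite scale0r addr0.
have key (s : K) : s != 0 -> s * a = s ^+ (d * e) * b.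
  move=> s0; have [a' ha'] := factor_ex (nz1 s); have [b' hb'] := factor_ex (nz2 s^-1).
  have ea := factor_line nz1 ha ha'; have eb := factor_line nz2 hb hb'.
  rewrite ea eb; apply: (factor_scale (nz2 s^-1) s0 hb').
  suff -> : s *: (w + s^-1 *: v) = v + s *: w by [].
  by rewrite scalerDr scalerA mulfV // scale1r addrC.
have ab : a = b by have := key 1 (oner_neq0 _); rewrite expr1n !mul1r.
have two : 2%:R != 0 :> K by rewrite pnatr_eq0.
have := key 2%:R two; rewrite ab => /(mulIf hb.1) /eqP.
rewrite -natrX eqr_nat -{1}[2%N]expn1 eqn_exp2l // => /eqP <-.
by [].
Qed.

End Degree.

Section LinearAutomorphisms.
Context (K : numClosedFieldType).

Lemma scalar_on_lines (M : 'M[K]_6) :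
  (forall x, is_line x -> exists c, M *m x = c *: x) -> exists c, M = c%:M.
Proof.
move=> hM.
have lE k : is_line (delta_mx k 0 : 'cV[K]_6).
  apply/line_eqnP; split.
    by apply/eqP => /matrixP/(_ k 0); rewrite !mxE !eqxx => /eqP; rewrite oner_eq0.
  by rewrite pev_line_eqn !mxE; elim/ord6P: k; rewrite /= ?mulr0 ?mul0r ?subr0 ?addr0.
have /choice[k hk] : forall i, exists c, M *m delta_mx i 0 = c *: delta_mx i (0 : 'I_1).
  by move=> i; have [c ec] := hM _ (lE i); exists c.
(* A point of the quadric with no zero coordinate, as 1 * 1 - 1 * 2 + 1 * 1 = 0; it forces the six
   eigenvalues to agree. *)
pose x0 : 'cV[K]_6 := \col_i (if i == @Ordinal 6 4 isT then 2%:R else 1).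
have lx0 : is_line x0.
  apply/line_eqnP; split; last by rewrite pev_line_eqn !mxE /=; ring.
  by apply/eqP => /matrixP/(_ 0 0); rewrite !mxE /= => /eqP; rewrite oner_eq0.
have [c ec] := hM _ lx0.
have kc i : k i = c.
  have ni : x0 i 0 != 0 by rewrite mxE; case: ifP; rewrite ?oner_eq0 ?pnatr_eq0.
  apply: (mulIf ni); have /matrixP/(_ i 0) := ec; rewrite [RHS]mxE => <-.
  have {2}-> : x0 = \sum_j x0 j 0 *: delta_mx j 0.
    by rewrite {1}[x0]matrix_sum_delta; apply: eq_bigr => j _; rewrite big_ord1.
  rewrite mulmx_sumr summxE (bigD1 i) //= big1 => [|j ji].
    by rewrite addr0 -scalemxAr hk scalerA [RHS]mxE [delta_mx _ _ _ _]mxE !eqxx mulr1 mulrC.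
  by rewrite -scalemxAr hk scalerA [LHS]mxE [delta_mx _ _ _ _]mxE eq_sym (negbTE ji) mulr0.
exists c; apply/matrixP => i j; have /matrixP/(_ i 0) := hk j.
by rewrite -colE !mxE eqxx andbT kc mulr_natr => ->.
Qed.

Section Bilinear.
Variables (f : Bir (G13 K)) (P : 'cV[{mpoly K[4 + 4]}]_6).
Hypotheses (hP : is_lift f P).
Hypotheses (P_gl : forall u v a b c e, a * e - b * c != 0 ->
  pair_ev P (a *: u + b *: v) (c *: u + e *: v) = (a * e - b * c) ^+ 1 *: pair_ev P u v).

Lemma pair_evZl t u v : t != 0 -> pair_ev P (t *: u) v = t *: pair_ev P u v.
Proof.
move=> t0; have := @P_gl u v t 0 0 1; rewrite mulr1 mulr0 subr0 !scale0r addr0 add0r scale1r.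
by move->.
Qed.

(** Homogeneity of degree 1 gives q(s) = s q'(1/s) for the restrictions to the lines x + t y and y +
    t x, so both are linear in t by [linear_reversal]. *)
Lemma pair_evDl x y v : pair_ev P (x + y) v = pair_ev P x v + pair_ev P y v.
Proof.
apply/matrixP => k j; rewrite ord1 [RHS]mxE.
have [q eq] := line_poly (P k 0) (col_mx x v) (col_mx y 0).
have [q' eq'] := line_poly (P k 0) (col_mx y v) (col_mx x 0).
have E t : q.[t] = pair_ev P (x + t *: y) v k 0.
  by rewrite eq pev_mev scale_col_mx add_col_mx scaler0 addr0.
have E' t : q'.[t] = pair_ev P (y + t *: x) v k 0.
  by rewrite eq' pev_mev scale_col_mx add_col_mx scaler0 addr0.
have := @linear_reversal _ q q' _; rewrite !E !E' scale1r !scale0r !addr0; apply.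
move=> s s0; rewrite E E'.
have -> : x + s *: y = s *: (y + s^-1 *: x).
  by rewrite scalerDr scalerA mulfV // scale1r addrC.
by rewrite pair_evZl // [LHS]mxE.
Qed.

Lemma pair_evZ t u v : pair_ev P (t *: u) v = t *: pair_ev P u v.
Proof.
have [->|] := eqVneq t 0; last exact: pair_evZl.
rewrite !scale0r; apply/(addrI (pair_ev P 0 v)).
by rewrite -pair_evDl !addr0.
Qed.

Lemma pair_evC u v : pair_ev P v u = - pair_ev P u v.
Proof.
by rewrite -{1}[u]opprK (pair_ev_swap hP) -scaleN1r pair_evZ scaleN1r.
Qed.

Lemma pair_ev_sum u v : pair_ev P u v = \sum_i u i 0 *: pair_ev P (delta_mx i 0) v.
Proof.
have -> : u = \sum_i u i 0 *: delta_mx i 0.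
  by rewrite {1}[u]matrix_sum_delta; apply: eq_bigr => i _; rewrite big_ord1.
transitivity (\sum_i pair_ev P (u i 0 *: delta_mx i 0) v).
  rewrite (big_morph (fun x => pair_ev P x v) (id1 := 0) (op1 := +%R)) //.
    by move=> x y; rewrite pair_evDl.
  by rewrite -(scale0r 0) pair_evZ scale0r.
apply: eq_bigr => i _; rewrite pair_evZ; congr (_ *: _).
rewrite summxE (bigD1 i) //= mxE mxE !eqxx mulr1 big1 ?addr0 // => j ji.
by rewrite !mxE eq_sym (negbTE ji) mulr0.
Qed.

Lemma pair_ev_linear : exists A : 'M[K]_6, forall u v, pair_ev P u v = A *m plucker u v.
Proof.
pose b m i j := pair_ev P (delta_mx i 0) (delta_mx j 0) m 0.
have bC m i j : b m j i = - b m i j by rewrite /b pair_evC [LHS]mxE.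
have b0 m i : b m i i = 0 by apply/eqP; rewrite -eqNr -bC.
exists (\matrix_(m, k) b m (pl_fst k) (pl_snd k)) => u v.
have e m : pair_ev P u v m 0 = \sum_i u i 0 * \sum_j v j 0 * b m i j.
  rewrite pair_ev_sum summxE; apply: eq_bigr => i _; rewrite [LHS]mxE; congr (_ * _).
  rewrite pair_evC [LHS]mxE pair_ev_sum summxE -sumrN; apply: eq_bigr => j _.
  by rewrite [X in - X]mxE -mulrN [in RHS]bC.
apply/matrixP => m j; rewrite ord1 e [RHS]mxE sum6 !sum4 !mxE /=.
rewrite !b0.
by rewrite (bC m (@Ordinal 4 0 isT) (@Ordinal 4 1 isT))
  (bC m (@Ordinal 4 0 isT) (@Ordinal 4 2 isT)) (bC m (@Ordinal 4 0 isT) (@Ordinal 4 3 isT))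
  (bC m (@Ordinal 4 1 isT) (@Ordinal 4 2 isT)) (bC m (@Ordinal 4 1 isT) (@Ordinal 4 3 isT))
  (bC m (@Ordinal 4 2 isT) (@Ordinal 4 3 isT)); ring.
Qed.

End Bilinear.

Lemma regular_bilinear (f : Bir (G13 K)) : regular f -> regular f^-1%g ->
  exists A : 'M[K]_6, exists2 P, is_lift f P & forall u v, pair_ev P u v = A *m plucker u v.
Proof.
move=> rf rg; have [P hP] := regular_lift rf; have [Q hQ] := regular_lift rg.
have [d hd] := pair_evGL hP; have [e he] := pair_evGL hQ.
have := lift_degree rf rg hP hQ hd he => /eqP; rewrite muln_eq1 => /andP[/eqP d1 _].
rewrite d1 in hd; have [A hA] := pair_ev_linear hP hd.
by exists A, P.
Qed.

(** If A and B come from lifts of f and of its inverse, then B A fixes every point of the quadric;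
    it is therefore a nonzero scalar, and A is invertible. *)
Theorem Aut_linear (f : Bir (G13 K)) : f \in Aut (G13 K) ->
  exists A, exists hA : lin_stable (G13 K) A, f = to_bir (lin_is_birat hA).
Proof.
move=> /asboolP[rf rg]; have rf' : regular (f^-1)^-1%g by rewrite invgK.
have [A [P hP hA]] := regular_bilinear rf rg.
have [B [Q hQ hB]] := regular_bilinear rg rf'.
have [d hd] := pair_evGL hP; have [e he] := pair_evGL hQ.
have linA x : is_line x -> is_line (A *m x).
  by move=> [x0 [u [v ex]]]; rewrite ex -hA; apply: (pair_ev_line rf hP); rewrite -ex.
have linB x : is_line x -> is_line (B *m x).
  by move=> [x0 [u [v ex]]]; rewrite ex -hB; apply: (pair_ev_line rg hQ); rewrite -ex.
have BA x : is_line x -> exists2 k, k != 0 & B *m A *m x = k *: x.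
  move=> lx; have [x0 [u [v ex]]] := lx; have [_ [u' [v' e']]] := linA x lx.
  have [||k k0 ek] := pair_ev_comp rf rg hP hQ he (u := u) (v := v) (u' := u') (v' := v').
  - by rewrite -ex.
  - by rewrite hA -ex e'.
  by exists k => //; rewrite -mulmxA e' -hB ek -ex.
have [c eBA] : exists c, B *m A = c%:M.
  by apply: scalar_on_lines => x /BA[c _ ec]; exists c.
have c0 : c != 0.
  have [x lx] := @line_nonempty K; have [k k0] := BA x lx.
  rewrite eBA mul_scalar_mx => /eqP; rewrite -subr_eq0 -scalerBl scaler_eq0 subr_eq0.
  by rewrite (negbTE lx.1) orbF => /eqP ->.
have uA : A \in unitmx.
  have : B *m A \in unitmx by rewrite eBA unitmxE det_scalar unitrX // unitfE.
  by rewrite unitmx_mul => /andP[].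
have iA : invmx A = c^-1 *: B.
  apply: (can_inj (mulmxK uA)); rewrite mulVmx // -scalemxAl eBA scale_scalar_mx.
  by rewrite mulVf.
have sA : lin_stable (G13 K) A.
  split=> // x lx; rewrite iA -scalemxAl.
  by apply: (@pv_scale K 5 (G13 K)); [apply: linB|rewrite invr_eq0].
exists A, sA; have [F [hF ef]] := birP f; rewrite ef; apply/to_birP => x lx n1 n2.
have [_ [u [v ex]]] := lx; have [] := lift_rep hP ef (z := col_mx u v).
  by rewrite pl_col_mx -ex.
move=> b b0; rewrite pl_col_mx -ex -/(pair_ev P u v) hA -ex => ->.
rewrite mev_lin; apply: same_point_sym; exact: (ex_intro2 _ _ b b0 erefl).
Qed.

End LinearAutomorphisms.

(** * Linear lifts and the Pluecker form *)

Section LinearTransformations.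
Context (K : numClosedFieldType).
Local Notation delta k := (delta_mx k 0 : 'cV[K]_6).

Definition pl_sign (k : 'I_6) : K := if (k == 1 :> nat) || (k == 4 :> nat) then -1 else 1.

(* rev_ord k is the index of the pair complementary to that of k. *)
Definition pl_form : 'M[K]_6 := \matrix_(k, l) (pl_sign k *+ (l == rev_ord k)).

Definition bilin n (S : 'M[K]_n) (x y : 'cV[K]_n) : K := (x^T *m S *m y) 0 0.

Lemma bilinDl n (S : 'M[K]_n) x y z : bilin S (x + y) z = bilin S x z + bilin S y z.
Proof. by rewrite /bilin linearD /= !mulmxDl mxE. Qed.

Lemma bilinDr n (S : 'M[K]_n) x y z : bilin S x (y + z) = bilin S x y + bilin S x z.
Proof. by rewrite /bilin mulmxDr mxE. Qed.

Lemma bilinZl n (S : 'M[K]_n) c x y : bilin S (c *: x) y = c * bilin S x y.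
Proof. by rewrite /bilin linearZ /= -!scalemxAl mxE. Qed.

Lemma bilinZr n (S : 'M[K]_n) c x y : bilin S x (c *: y) = c * bilin S x y.
Proof. by rewrite /bilin -scalemxAr mxE. Qed.

Lemma bilin_delta n (S : 'M[K]_n) k l : bilin S (delta_mx k 0) (delta_mx l 0) = S k l.
Proof. by rewrite /bilin trmx_delta -rowE -colE !mxE. Qed.

Lemma bilin_mul n m (S : 'M[K]_n) (A : 'M[K]_(n, m)) x y :
  bilin S (A *m x) (A *m y) = bilin (A^T *m S *m A) x y.
Proof. by rewrite /bilin trmx_mul !mulmxA. Qed.

Lemma pl_form_tr : pl_form^T = pl_form.
Proof.
by apply/matrixP => i j; rewrite !mxE; elim/ord6P: i; elim/ord6P: j.
Qed.

Lemma pl_form_sqr : pl_form *m pl_form = 1%:M.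
Proof.
apply/matrixP => i j; rewrite mxE sum6 !mxE /pl_sign.
by elim/ord6P: i; elim/ord6P: j; rewrite /= ?mulr0n ?mulr1n; ring.
Qed.

Lemma bilin_pl_form x : bilin pl_form x x = 2%:R * pev (line_eqn K) x.
Proof.
rewrite /bilin mxE sum6 !mxE !sum6 !mxE pev_line_eqn /pl_sign /=.
by rewrite ?mulr0n ?mulr1n; ring.
Qed.

Lemma line_form x : is_line x <-> x != 0 /\ bilin pl_form x x = 0.
Proof.
split=> [/line_eqnP[x0 e]|[x0]]; first by rewrite bilin_pl_form e mulr0.
rewrite bilin_pl_form => /eqP; rewrite mulf_eq0 pnatr_eq0 /= => /eqP e.
by apply/line_eqnP.
Qed.

(** The form is tested on points of the quadric: e_k removes the diagonal, e_k + e_l removes the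
    entries at non-complementary pairs, and two sums of four terms tie the three remaining entries
    together. *)
Lemma pl_form_uniq (S : 'M[K]_6) : S^T = S ->
  (forall x, is_line x -> bilin S x x = 0) -> exists c, S = c *: pl_form.
Proof.
move=> sS S0; have symS i j : S j i = S i j by rewrite -[in LHS]sS mxE.
have nz (x : 'cV[K]_6) k : x k 0 != 0 -> x != 0.
  by apply: contra_neq => ->; rewrite mxE.
have z0 k : S k k = 0.
  rewrite -bilin_delta; apply/S0/line_eqnP; split.
    by apply: (nz _ k); rewrite mxE !eqxx oner_eq0.
  by rewrite pev_line_eqn !mxE; elim/ord6P: k; rewrite /= ?mulr0 ?mul0r ?subr0 ?addr0.
have z1 k l : k != l -> l != rev_ord k -> S k l = 0.
  move=> kl klr; have : bilin S (delta k + delta l) (delta k + delta l) = 0.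
    apply/S0/line_eqnP; split.
      by apply: (nz _ k); rewrite !mxE !eqxx (negbTE kl) addr0 oner_eq0.
    rewrite pev_line_eqn !mxE; elim/ord6P: k kl klr; elim/ord6P: l => //= _ _;
      by rewrite ?addr0 ?add0r ?mulr0 ?mul0r ?subr0 ?addr0.
  rewrite !(bilinDl, bilinDr) !bilin_delta !z0 symS add0r addr0 => /eqP.
  by rewrite -mulr2n mulrn_eq0 /= => /eqP.
have h1 : S (@Ordinal 6 0 isT) (@Ordinal 6 5 isT) + S (@Ordinal 6 1 isT) (@Ordinal 6 4 isT) = 0.
  pose x := delta (@Ordinal 6 0 isT) + delta (@Ordinal 6 5 isT)
            + delta (@Ordinal 6 1 isT) + delta (@Ordinal 6 4 isT).
  have : bilin S x x = 0.
    apply/S0/line_eqnP; split; last by rewrite pev_line_eqn !mxE /=; ring.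
    by apply: (nz _ 0); rewrite !mxE /= !addr0 oner_eq0.
  rewrite /x !(bilinDl, bilinDr) !bilin_delta !z0.
  rewrite ![S _ (@Ordinal 6 0 isT)]symS ![S (@Ordinal 6 4 isT) (@Ordinal 6 1 isT)]symS.
  rewrite (z1 (@Ordinal 6 0 isT) (@Ordinal 6 1 isT)) // (z1 (@Ordinal 6 0 isT) (@Ordinal 6 4 isT)) //.
  rewrite (z1 (@Ordinal 6 5 isT) (@Ordinal 6 1 isT)) // (z1 (@Ordinal 6 5 isT) (@Ordinal 6 4 isT)) //.
  rewrite (z1 (@Ordinal 6 1 isT) (@Ordinal 6 5 isT)) // (z1 (@Ordinal 6 4 isT) (@Ordinal 6 5 isT)) //.
  move=> e; apply/eqP; have := mulrn_eq0 (S (@Ordinal 6 0 isT) (@Ordinal 6 5 isT) + S (@Ordinal 6 1 isT) (@Ordinal 6 4 isT)) 2.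
  by move=> /= <-; apply/eqP; rewrite -[RHS]e mulr2n; ring.
have h2 : S (@Ordinal 6 0 isT) (@Ordinal 6 5 isT) - S (@Ordinal 6 2 isT) (@Ordinal 6 3 isT) = 0.
  pose x := delta (@Ordinal 6 0 isT) + delta (@Ordinal 6 5 isT)
            + delta (@Ordinal 6 2 isT) + (-1) *: delta (@Ordinal 6 3 isT).
  have : bilin S x x = 0.
    apply/S0/line_eqnP; split; last by rewrite pev_line_eqn !mxE /=; ring.
    by apply: (nz _ 0); rewrite !mxE /= mulr0 !addr0 oner_eq0.
  rewrite /x !(bilinDl, bilinDr, bilinZl, bilinZr) !bilin_delta !z0.
  rewrite ![S _ (@Ordinal 6 0 isT)]symS ![S (@Ordinal 6 3 isT) (@Ordinal 6 2 isT)]symS.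
  rewrite (z1 (@Ordinal 6 0 isT) (@Ordinal 6 2 isT)) // (z1 (@Ordinal 6 0 isT) (@Ordinal 6 3 isT)) //.
  rewrite (z1 (@Ordinal 6 5 isT) (@Ordinal 6 2 isT)) // (z1 (@Ordinal 6 5 isT) (@Ordinal 6 3 isT)) //.
  rewrite (z1 (@Ordinal 6 2 isT) (@Ordinal 6 5 isT)) // (z1 (@Ordinal 6 3 isT) (@Ordinal 6 5 isT)) //.
  move=> e; apply/eqP; have := mulrn_eq0 (S (@Ordinal 6 0 isT) (@Ordinal 6 5 isT) - S (@Ordinal 6 2 isT) (@Ordinal 6 3 isT)) 2.
  by move=> /= <-; apply/eqP; rewrite -[RHS]e mulr2n; ring.
exists (S (@Ordinal 6 0 isT) (@Ordinal 6 5 isT)); apply/matrixP => i j; rewrite !mxE.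
have [->|jr] := eqVneq j (rev_ord i); last first.
  rewrite mulr0; have [->|ij] := eqVneq i j; first exact: z0.
  exact: z1.
have r0 : rev_ord (@Ordinal 6 0 isT) = @Ordinal 6 5 isT by apply: val_inj.
have r1 : rev_ord (@Ordinal 6 1 isT) = @Ordinal 6 4 isT by apply: val_inj.
have r2 : rev_ord (@Ordinal 6 2 isT) = @Ordinal 6 3 isT by apply: val_inj.
have r3 : rev_ord (@Ordinal 6 3 isT) = @Ordinal 6 2 isT by apply: val_inj.
have r4 : rev_ord (@Ordinal 6 4 isT) = @Ordinal 6 1 isT by apply: val_inj.
have r5 : rev_ord (@Ordinal 6 5 isT) = @Ordinal 6 0 isT by apply: val_inj.
rewrite mulr1n /pl_sign; elim/ord6P: i; rewrite ?r0 ?r1 ?r2 ?r3 ?r4 ?r5 //= ?mulr1 ?mulrN1 //.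
- by apply/eqP; rewrite -addr_eq0 addrC h1.
- by apply/esym/subr0_eq.
- by rewrite symS; apply/esym/subr0_eq.
- by rewrite symS; apply/eqP; rewrite -addr_eq0 addrC h1.
Qed.

End LinearTransformations.

Section LinearBirational.
Context (K : numClosedFieldType).
Implicit Types A B : 'M[K]_6.

Lemma lin_birP A B (hA : lin_stable (G13 K) A) (hB : lin_stable (G13 K) B) :
  to_bir (lin_is_birat hA) = to_bir (lin_is_birat hB) ->
  exists2 c, c != 0 & B = c *: A.
Proof.
move=> /to_birP e; have [uA _ _] := hA; have [uB _ _] := hB.
have [|c ec] := @scalar_on_lines K (invmx A *m B).
  move=> x lx; have n1 : mev (lin_map A) x != 0 by rewrite mev_lin unitmx_neq0 // lx.1.
  have n2 : mev (lin_map B) x != 0 by rewrite mev_lin unitmx_neq0 // lx.1.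
  have [c c0] := e x lx n1 n2; rewrite !mev_lin => ec.
  by exists c; rewrite -mulmxA ec -scalemxAr mulKmx.
have eB : B = c *: A by rewrite -[B](mulKVmx uA) ec mul_mx_scalar.
exists c => //; apply: contraTneq uB => c0; rewrite eB c0 scale0r.
by rewrite unitmxE det0 unitr0.
Qed.

Lemma lin_stable_form A : lin_stable (G13 K) A ->
  exists2 c, c != 0 & A^T *m pl_form K *m A = c *: pl_form K.
Proof.
move=> [uA sA _]; have [||c ec] := @pl_form_uniq K (A^T *m pl_form K *m A).
- by rewrite !trmx_mul trmxK pl_form_tr mulmxA.
- by move=> x lx; rewrite -bilin_mul; have /line_form[] := sA x lx.
exists c => //; apply: contra_eq_neq ec => ->; rewrite scale0r; apply/eqP => e.
have uJ : pl_form K \in unitmx by case/mulmx1_unit: (pl_form_sqr K).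
have : A^T *m pl_form K *m A \in unitmx by rewrite !unitmx_mul unitmx_tr uA uJ.
by rewrite e unitmxE det0 unitr0.
Qed.

Lemma lin_bir_stableM A B : lin_stable (G13 K) A -> lin_stable (G13 K) B ->
  lin_stable (G13 K) (A *m B).
Proof.
move=> [uA sA sA'] [uB sB sB']; split; first by rewrite unitmx_mul uA.
  by move=> x /sB/sA; rewrite mulmxA.
move=> x /sA'/sB'; rewrite mulmxA.
suff -> : invmx (A *m B) = invmx B *m invmx A by [].
apply: (can_inj (mulKmx (_ : A *m B \in unitmx))); first by rewrite unitmx_mul uA.
by rewrite mulmxV ?unitmx_mul ?uA // -mulmxA mulKVmx // mulmxV.
Qed.

End LinearBirational.

Section SquareForm.
Context (K : numClosedFieldType).
Local Notation J := (pl_form K).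
Implicit Types f g : Bir (G13 K).

Definition linear_lift f (A : 'M[K]_6) : Prop :=
  exists hA : lin_stable (G13 K) A, f = to_bir (lin_is_birat hA).

(* For A lifting f with A^T J A = c J, the matrix A^2 / c is independent of the
   choice of A and lifts f^2. *)
Definition square_lift f (N : 'M[K]_6) : Prop := exists A c,
  [/\ linear_lift f A, c != 0, A^T *m J *m A = c *: J & N = c^-1 *: (A *m A)].

Lemma linear_liftM f g A B :
  linear_lift f A -> linear_lift g B -> linear_lift (f * g)%g (A *m B).
Proof.
move=> [hA ->] [hB ->]; exists (lin_bir_stableM hA hB); exact: lin_bir_mul.
Qed.

Lemma linear_liftZ f A c : c != 0 -> linear_lift f A -> linear_lift f (c *: A).
Proof.
move=> c0 [hA ->]; have [uA sA sA'] := hA.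
have hcA : lin_stable (G13 K) (c *: A).
  split; first by rewrite unitmxZ ?unitfE.
    by move=> x lx; rewrite -scalemxAl; apply: (@pv_scale K 5 (G13 K)) => //; apply: sA.
  move=> x lx; rewrite invmxZ ?unitmxZ ?unitfE // -scalemxAl.
  by apply: (@pv_scale K 5 (G13 K)); rewrite ?invr_eq0 //; apply: sA'.
exists hcA; apply/to_birP => x lx _ _; rewrite !mev_lin -scalemxAl.
by exists c.
Qed.

Lemma linear_lift_uniq f A B : linear_lift f A -> linear_lift f B ->
  exists2 c, c != 0 & B = c *: A.
Proof. by move=> [hA ->] [hB /lin_birP]. Qed.

Lemma linear_lift_unit f A : linear_lift f A -> A \in unitmx.
Proof. by move=> [[]]. Qed.

Lemma linear_lift1 : linear_lift 1%g 1%:M.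
Proof.
have h : lin_stable (G13 K) 1%:M.
  by split; rewrite ?unitmx1 // => x lx; rewrite ?invmx1 mul1mx.
exists h; apply/to_birP => x lx _ _; rewrite mev_lin mev_id mul1mx.
exact: same_point_refl.
Qed.

Lemma linear_lift_inv f A : linear_lift f A -> linear_lift f^-1%g (invmx A).
Proof. by move=> [hA ->]; exists (lin_stable_inv hA); exact: lin_bir_inv. Qed.

Lemma linear_lift_form f A : linear_lift f A ->
  exists2 c, c != 0 & A^T *m J *m A = c *: J.
Proof. by move=> [hA _]; apply: lin_stable_form. Qed.

Lemma pl_form_unit : J \in unitmx.
Proof. by case/mulmx1_unit: (pl_form_sqr K). Qed.

Lemma pl_form_neq0 : J != 0.
Proof. by apply: contraTneq pl_form_unit => ->; rewrite unitmxE det0 unitr0. Qed.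

(** Passing from A to b A multiplies both A^2 and c by b^2. *)
Lemma square_lift_uniq f M N : square_lift f M -> square_lift f N -> M = N.
Proof.
move=> [A [c [lA c0 eA ->]]] [B [d [lB d0 eB ->]]].
have [b b0 eb] := linear_lift_uniq lA lB.
have e : d = b * b * c.
  move/eqP: eB; rewrite eb -scalemxAr [(b *: A)^T]linearZ /= -!scalemxAl eA !scalerA.
  by rewrite -subr_eq0 -scalerBl scaler_eq0 (negbTE pl_form_neq0) orbF subr_eq0 => /eqP <-.
rewrite eb -scalemxAl -scalemxAr !scalerA; congr (_ *: _).
by rewrite e; field; rewrite b0 c0.
Qed.

Lemma square_lift1 : square_lift 1%g 1%:M.
Proof.
exists 1%:M, 1; split; rewrite ?oner_eq0 ?invr1 ?scale1r ?mulmx1 //.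
  exact: linear_lift1.
by rewrite trmx1 mul1mx.
Qed.

(** Multipliers are multiplicative, but (A B)^2 = A^2 B^2 asks the lifts to commute in GL_6 and not
    only projectively. *)
Lemma square_liftM f g A B M N : linear_lift f A -> linear_lift g B ->
  A *m B = B *m A -> square_lift f M -> square_lift g N -> square_lift (f * g)%g (M *m N).
Proof.
move=> lA lB AB hM hN.
have [c c0 eA] := linear_lift_form lA; have [d d0 eB] := linear_lift_form lB.
have -> : M = c^-1 *: (A *m A) by apply: square_lift_uniq hM _; exists A, c.
have -> : N = d^-1 *: (B *m B) by apply: square_lift_uniq hN _; exists B, d.
exists (A *m B), (c * d); split; rewrite ?mulf_neq0 //; first exact: linear_liftM.
  rewrite trmx_mul -!mulmxA (mulmxA _ J) (mulmxA _ A) eA.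
  by rewrite -scalemxAl -scalemxAr mulmxA eB scalerA.
rewrite -scalemxAl -scalemxAr scalerA -invfM; congr (_ *: _).
by rewrite -!mulmxA (mulmxA B A) -AB !mulmxA.
Qed.

Lemma square_liftJ f g A M : linear_lift f A -> square_lift g M ->
  square_lift (f * g * f^-1)%g (A *m M *m invmx A).
Proof.
move=> lA [B [d [lB d0 eB ->]]]; have [c c0 eA] := linear_lift_form lA.
have uA := linear_lift_unit lA.
exists (A *m B *m invmx A), d; split => //.
- by apply: linear_liftM (linear_lift_inv lA); apply: linear_liftM.
- have eA' : (invmx A)^T *m J *m invmx A = c^-1 *: J.
    apply: (can_inj (mulmxK uA)); rewrite mulmxKV // -scalemxAl.
    have uT : A^T \in unitmx by rewrite unitmx_tr.
    apply: (can_inj (mulKmx uT)); rewrite mulmxA -trmx_mul mulVmx // trmx1 mul1mx.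
    by rewrite -scalemxAr mulmxA eA scalerA mulVf // scale1r.
  have eA2 X : A^T *m (J *m (A *m X)) = c *: (J *m X) :> 'M_6 by rewrite !mulmxA eA -scalemxAl.
  have eB2 X : B^T *m (J *m (B *m X)) = d *: (J *m X) :> 'M_6 by rewrite !mulmxA eB -scalemxAl.
  rewrite !trmx_mul -!mulmxA eA2 -!scalemxAr eB2 -!scalemxAr mulmxA eA' !scalerA.
  by rewrite mulrAC mulfV ?mul1r.
- rewrite -scalemxAr -scalemxAl; congr (_ *: _).
  by rewrite !mulmxA mulmxKV.
Qed.

(** A^2 has multiplier c^2, which the factor c^-1 normalizes to 1. The form acts on rows here
    because the eigenvectors used later are rows. *)
Lemma square_lift_form f N : square_lift f N -> N *m J *m N^T = J.
Proof.
move=> [A [c [lA c0 eA ->]]]; have uA := linear_lift_unit lA.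
have eA' : A *m J *m A^T = c *: J.
  have uAT : A^T \in unitmx by rewrite unitmx_tr.
  have e : (c^-1 *: (J *m A^T *m J)) *m A = 1%:M.
    rewrite -scalemxAl -!mulmxA (mulmxA A^T) eA -scalemxAr scalerA mulVf //.
    by rewrite scale1r pl_form_sqr.
  have := mulmx1C e; rewrite -scalemxAr => e'.
  have -> : A *m J *m A^T = A *m J *m A^T *m (J *m J) by rewrite pl_form_sqr mulmx1.
  rewrite !mulmxA -(mulmxA A) -(mulmxA A) -[X in X *m J]scale1r -(mulfV c0) -scalerA e'.
  by rewrite -scalemxAl mul1mx.
have eA2 X : A *m (J *m (A^T *m X)) = c *: (J *m X) :> 'M_6 by rewrite !mulmxA eA' -scalemxAl.
rewrite [(_ *: _)^T]linearZ /= -scalemxAr -!scalemxAl trmx_mul -!mulmxA eA2.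
rewrite -scalemxAr mulmxA eA' !scalerA -[RHS]scale1r; congr (_ *: _); field.
by rewrite c0.
Qed.

Lemma square_lift_lift f N : square_lift f N -> linear_lift (f * f)%g N.
Proof.
move=> [A [c [lA c0 eA ->]]]; apply: linear_liftZ; rewrite ?invr_eq0 //.
exact: linear_liftM.
Qed.

End SquareForm.

(** * Weights of the diagonal torus *)

Section JointEigenvectors.
Context (K : numClosedFieldType).

Lemma eigenvector_sub n m (M : 'M[K]_n) (W : 'M[K]_(m, n)) :
  W != 0 -> (W *m M <= W)%MS ->
  exists c, exists2 v : 'rV[K]_n, v != 0 & (v <= W)%MS /\ v *m M = c *: v.
Proof.
move=> W0 WM; pose B := row_base W.
have r0 : (0 < \rank W)%N by rewrite lt0n mxrank_eq0.
have BM : (B *m M <= B)%MS.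
  by rewrite (eqmxMr M (eq_row_base W)) (submx_trans WM) // eq_row_base.
have [C eC] := submxP BM.
have [c rc] : exists c, root (char_poly C) c.
  by apply/closed_rootP; rewrite size_char_poly eqSS -lt0n.
have /eigenvalueP[u eu u0] : eigenvalue C c by rewrite eigenvalue_root_char.
exists c, (u *m B); last split.
- apply: contra_neq u0 => e; apply: (row_free_inj (row_base_free W)).
  by rewrite e mul0mx.
- by rewrite (submx_trans (submxMl _ _)) // eq_row_base.
- by rewrite -mulmxA eC mulmxA eu -scalemxAl.
Qed.

(** Induction on the rank of W. If some M t is not scalar on W, one of its eigenspaces in W is
    nonzero, smaller, and stable under the whole family by commutation. *)
Lemma joint_eigenvector n m (T : Type) (M : T -> 'M[K]_n) (W : 'M[K]_(m, n)) :
  (forall s t, M s *m M t = M t *m M s) -> W != 0 ->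
  (forall t, (W *m M t <= W)%MS) ->
  exists2 v : 'rV[K]_n, v != 0 & (v <= W)%MS /\ forall t, exists c, v *m M t = c *: v.
Proof.
move=> MC; have [r] := ubnP (\rank W); elim: r m W => // r IHr m W rW W0 WM.
have [sc|] := pselect (forall t, exists c, W *m M t = c *: W).
  have [i0 wi] : exists i, row i W != 0.
    apply: contrapT => /forallNP h; case/eqP: W0; apply/row_matrixP => i.
    by rewrite row0; apply/eqP; apply: contrapT => /negP; apply: h.
  exists (row i0 W) => //; split=> [|t]; first exact: row_sub.
  by have [c ec] := sc t; exists c; rewrite -row_mul ec linearZ.
move=> /existsNP[t nt].
have [c [v v0 [vW ev]]] := eigenvector_sub W0 (WM t).
pose E := kermx (M t - c%:M); have inE (p : nat) (A : 'M_(p, n)) : (A <= E)%MS = (A *m M t == c *: A).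
  by rewrite sub_kermx mulmxBr mul_mx_scalar subr_eq0.
have [|||u u0 [uW hu]] := IHr _ (W :&: E)%MS.
- rewrite -ltnS; apply: leq_trans rW; rewrite ltnS; apply: rank_ltmx; rewrite ltmxE capmxSl /=.
  apply/negP => h; apply: nt; exists c; apply/eqP; rewrite -inE.
  exact: submx_trans h (capmxSr _ _).
- apply: contra_neq v0 => e; apply/eqP; rewrite -submx0 -e sub_capmx vW inE.
  by rewrite ev eqxx.
- move=> s; rewrite sub_capmx (submx_trans (submxMr _ (capmxSl _ _)) (WM s)) /=.
  rewrite inE -mulmxA MC mulmxA; have /eqP -> : (W :&: E)%MS *m M t == c *: (W :&: E)%MS.
    by rewrite -inE capmxSr.
  by rewrite -scalemxAl.
exists u => //; split => //; exact: submx_trans uW (capmxSl _ _).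
Qed.

(** Dedekind's argument: applying M t - psi i0 t to a relation removes the index i0 and keeps the
    index j where the two weights differ. *)
Lemma weights_free n m (T : Type) (M : T -> 'M[K]_n) (V : 'M[K]_(m, n)) (psi : 'I_m -> T -> K) :
  (forall i t, row i V *m M t = psi i t *: row i V) -> (forall i, row i V != 0) ->
  (forall i j, i != j -> exists t, psi i t != psi j t) -> row_free V.
Proof.
move=> hV V0 dpsi; suff h (u : 'rV_m) : u *m V = 0 -> u = 0.
  rewrite -kermx_eq0; apply/eqP/row_matrixP => i; rewrite row0; apply: h.
  by apply/sub_kermxP/row_sub.
have [r] := ubnP #|[set i | u 0 i != 0]|; elim: r u => // r IHr u su uV.
apply: contrapT => /eqP u0.
have [i0 ui] : exists i, u 0 i != 0.
  apply: contrapT => /forallNP h; case/eqP: u0; apply/rowP => i; rewrite mxE.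
  by apply/eqP; apply: contrapT => /negP; apply: h.
have [[j [ji uj]]|] := pselect (exists j, j != i0 /\ u 0 j != 0); last first.
  move=> /forallNP h; have := uV; rewrite mulmx_sum_row (bigD1 i0) //= big1 => [|j ji].
    by rewrite addr0 => /eqP; rewrite scaler_eq0 (negbTE ui) (negbTE (V0 i0)).
  by have := h j; rewrite ji => /not_andP[//|/negP/negPn/eqP->]; rewrite scale0r.
have [t nt] := dpsi _ _ ji.
pose w : 'rV_m := \row_k (u 0 k * (psi k t - psi i0 t)).
have w0 : w = 0.
  apply: IHr.
    rewrite -ltnS; apply: leq_trans su; rewrite ltnS; apply/proper_card/properP; split.
      by apply/subsetP => k; rewrite !inE mxE; apply: contra_neq => ->; rewrite mul0r.
    by exists i0; rewrite !inE // mxE subrr mulr0 eqxx.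
  rewrite mulmx_sum_row; transitivity (u *m V *m M t - psi i0 t *: (u *m V)).
    rewrite [u *m V]mulmx_sum_row mulmx_suml scaler_sumr -sumrB; apply: eq_bigr => k _.
    by rewrite -scalemxAl hV !scalerA -scalerBl mxE; congr (_ *: _); ring.
  by rewrite uV mul0mx scaler0 subr0.
have /rowP/(_ j) := w0; rewrite !mxE => /eqP.
by rewrite mulf_eq0 (negbTE uj) subr_eq0 (negbTE nt).
Qed.

End JointEigenvectors.

Section MatrixToPGL.
Context (K : numClosedFieldType) (n : nat).

(* The class of A, or 1 when A is singular. *)
Definition pgl_of (A : 'M[K]_n) : PGL K n :=
  if @idP (A \in unitmx) is ReflectT h then to_pgl h else 1%g.

Lemma pgl_ofE A (hA : A \in unitmx) : pgl_of A = to_pgl hA.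
Proof.
rewrite /pgl_of; case: {-}_ / idP => [h|//].
by apply/to_pglP; exists 1; rewrite ?oner_eq0 ?scale1r.
Qed.

Lemma pgl_of_singular A : A \notin unitmx -> pgl_of A = 1%g.
Proof. by move=> uA; rewrite /pgl_of; case: {-}_ / idP => // h; rewrite h in uA. Qed.

Lemma pgl_of_surj (g : PGL K n) : exists2 A, A \in unitmx & g = pgl_of A.
Proof.
exists (repr g); first exact: gl_repP.
by rewrite (pgl_ofE (gl_repP (repr g))) -to_pgl_repr.
Qed.

Lemma pgl_ofM A B : A \in unitmx -> B \in unitmx ->
  pgl_of (A *m B) = (pgl_of A * pgl_of B)%g.
Proof.
move=> hA hB; rewrite (pgl_ofE hA) (pgl_ofE hB) to_pglM.
by rewrite (pgl_ofE (unitmx_mul_of hA hB)).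
Qed.

Lemma pgl_ofZ c A : c != 0 -> pgl_of (c *: A) = pgl_of A.
Proof.
move=> c0; have [uA|uA] := boolP (A \in unitmx); last first.
  have ucA : c *: A \notin unitmx by rewrite unitmxZ ?unitfE.
  by rewrite !pgl_of_singular.
have ucA : c *: A \in unitmx by rewrite unitmxZ ?unitfE.
rewrite (pgl_ofE uA) (pgl_ofE ucA); apply/to_pglP; exists c^-1; rewrite ?invr_eq0 //.
by rewrite scalerA mulVf // scale1r.
Qed.

Lemma pgl_of1 : pgl_of 1%:M = 1%g.
Proof. by rewrite (pgl_ofE (unitmx1 K n)). Qed.

End MatrixToPGL.

Section GroupMorphism.
Context (G H : groupType) (f : G -> H).
Hypothesis fM : forall x y, f (x * y)%g = (f x * f y)%g.

Lemma morph_g1 : f 1%g = 1%g.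
Proof. by apply: (mulgI (f 1%g)); rewrite -fM !mulg1. Qed.

Lemma morph_gV x : f x^-1%g = (f x)^-1%g.
Proof. by apply: (mulgI (f x)); rewrite -fM !mulgV morph_g1. Qed.

End GroupMorphism.

Section DiagonalSquares.
Context (K : numClosedFieldType) (phi : PGL K 4 -> Bir (G13 K)).
Hypothesis phiM : forall g h, phi (g * h)%g = (phi g * phi h)%g.
Hypothesis phiAut : forall g, phi g \in Aut (G13 K).
Implicit Types s t : 'rV[K]_4.

Lemma linear_lift_ex g : exists A, linear_lift (phi g) A.
Proof. by have [A [hA e]] := Aut_linear (phiAut g); exists A, hA. Qed.

Lemma square_lift_ex g : exists N, square_lift (phi g) N.
Proof.
have [A lA] := linear_lift_ex g; have [c c0 eA] := linear_lift_form lA.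
by exists (c^-1 *: (A *m A)), A, c.
Qed.

Definition in_torus t := forall i, t 0 i != 0.

Definition torus_mul s t : 'rV[K]_4 := \row_i (s 0 i * t 0 i).

Definition diag_pgl t : PGL K 4 := pgl_of (diag_mx t).

Lemma diag_unit t : in_torus t -> diag_mx t \in unitmx.
Proof.
by move=> ht; rewrite unitmxE det_diag unitfE; apply/prodf_neq0 => i _; apply: ht.
Qed.

Lemma torus_mul_torus s t : in_torus s -> in_torus t -> in_torus (torus_mul s t).
Proof. by move=> hs ht i; rewrite mxE mulf_neq0. Qed.

Lemma diag_pglM s t : in_torus s -> in_torus t ->
  diag_pgl (torus_mul s t) = (diag_pgl s * diag_pgl t)%g.
Proof.
move=> hs ht; rewrite /diag_pgl -pgl_ofM ?diag_unit // mulmx_diag.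
by congr (pgl_of (diag_mx _)); apply/rowP => i; rewrite !mxE.
Qed.

Lemma torus_mulC s t : torus_mul s t = torus_mul t s.
Proof. by apply/rowP => i; rewrite !mxE mulrC. Qed.

Lemma phi_diagM s t : in_torus s -> in_torus t ->
  phi (diag_pgl (torus_mul s t)) = (phi (diag_pgl s) * phi (diag_pgl t))%g.
Proof. by move=> hs ht; rewrite diag_pglM // phiM. Qed.

(* The commutator of two lifts is a sixth root of unity, and the torus is
   6-divisible. *)
Lemma diag_lifts_commute s t A B : in_torus s -> in_torus t ->
  linear_lift (phi (diag_pgl s)) A -> linear_lift (phi (diag_pgl t)) B ->
  A *m B = B *m A.
Proof.
move=> hs ht lA lB; pose r : 'rV[K]_4 := \row_i (6.-root (t 0 i)).
have hr : in_torus r by move=> i; rewrite mxE rootC_eq0.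
have [C lC] := linear_lift_ex (diag_pgl r).
have [k k0 ek] : exists2 k, k != 0 & A *m C = k *: (C *m A).
  apply: (@linear_lift_uniq K (phi (diag_pgl (torus_mul r s)))).
    by rewrite phi_diagM //; apply: linear_liftM.
  by rewrite torus_mulC phi_diagM //; apply: linear_liftM.
have k6 : k ^+ 6 = 1.
  have uA := linear_lift_unit lA; have uC := linear_lift_unit lC.
  have nz : \det (C *m A) != 0 by rewrite -unitfE -unitmxE unitmx_mul uA uC.
  by apply: (mulIf nz); rewrite mul1r -detZ -ek !det_mulmx mulrC.
pose r2 := torus_mul r r; pose r3 := torus_mul r r2.
have h2 : in_torus r2 by apply: torus_mul_torus.
have h3 : in_torus r3 by apply: torus_mul_torus.
have et : t = torus_mul r3 r3.
  apply/rowP => i; rewrite /r3 /r2 /r !mxE; set x := 6.-root _.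
  have -> : t 0 i = x ^+ 6 by rewrite rootCK.
  ring.
have l3 : linear_lift (phi (diag_pgl r3)) (C *m (C *m C)).
  by rewrite !phi_diagM //; apply: linear_liftM => //; apply: linear_liftM.
have [b b0 ->] : exists2 b, b != 0 & B = b *: (C *m (C *m C) *m (C *m (C *m C))).
  apply: linear_lift_uniq lB; rewrite et phi_diagM //; exact: linear_liftM.
rewrite -scalemxAr -scalemxAl; congr (_ *: _).
have ekX (X : 'M_6) : A *m (C *m X) = k *: (C *m (A *m X)).
  by rewrite mulmxA ek -scalemxAl mulmxA.
rewrite -!mulmxA !(ekX, ek) -!scalemxAr !scalerA.
have -> : k * (k * k * k * k * k) = k ^+ 6 by ring.
by rewrite k6 scale1r.
Qed.

Definition diag_sq t : 'M[K]_6 := projT1 (cid (square_lift_ex (diag_pgl t))).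

Lemma diag_sqP t : square_lift (phi (diag_pgl t)) (diag_sq t).
Proof. exact: (projT2 (cid _)). Qed.

Lemma diag_sqM s t : in_torus s -> in_torus t ->
  diag_sq (torus_mul s t) = diag_sq s *m diag_sq t.
Proof.
move=> hs ht; apply: square_lift_uniq (diag_sqP _) _; rewrite phi_diagM //.
have [A lA] := linear_lift_ex (diag_pgl s); have [B lB] := linear_lift_ex (diag_pgl t).
by apply: (square_liftM lA lB (diag_lifts_commute hs ht lA lB)); apply: diag_sqP.
Qed.

Lemma diag_sq_scalar c : c != 0 -> diag_sq (const_mx c) = 1%:M.
Proof.
move=> c0; apply: square_lift_uniq (diag_sqP _) _.
suff -> : diag_pgl (const_mx c) = 1%g by rewrite (morph_g1 phiM); apply: square_lift1.
by rewrite /diag_pgl diag_const_mx -scalemx1 pgl_ofZ // pgl_of1.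
Qed.

(** The default value of [pgl_of] makes N trivial off the torus, so that all rows index one
    commuting family. *)
Lemma diag_sq_singular t : ~ in_torus t -> diag_sq t = 1%:M.
Proof.
move=> ht; apply: square_lift_uniq (diag_sqP _) _.
suff -> : diag_pgl t = 1%g by rewrite (morph_g1 phiM); apply: square_lift1.
rewrite /diag_pgl pgl_of_singular //; apply/negP => h; case: ht => i.
by move: h; rewrite unitmxE det_diag unitfE => /prodf_neq0/(_ i isT).
Qed.

Lemma diag_sqC s t : diag_sq s *m diag_sq t = diag_sq t *m diag_sq s.
Proof.
have [hs|/diag_sq_singular ->] := pselect (in_torus s); last by rewrite mul1mx mulmx1.
have [ht|/diag_sq_singular ->] := pselect (in_torus t); last by rewrite mul1mx mulmx1.
by rewrite -!diag_sqM // torus_mulC.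
Qed.

Lemma diag_sq_form t : diag_sq t *m pl_form K *m (diag_sq t)^T = pl_form K.
Proof. exact: square_lift_form (diag_sqP t). Qed.

Definition torus_perm (s : 'S_4) t : 'rV[K]_4 := \row_i t 0 (s i).

Lemma diag_pgl_perm (s : 'S_4) t : in_torus t ->
  diag_pgl (torus_perm s t) = (pgl_of (perm_mx s) * diag_pgl t * (pgl_of (perm_mx s))^-1)%g.
Proof.
move=> ht; apply/esym/(canLR (mulgK _)); have up := unitmx_perm K s.
rewrite /diag_pgl -!pgl_ofM ?diag_unit //; last by move=> i; rewrite mxE.
congr pgl_of; apply/matrixP => i j; rewrite mul_diag_mx mul_mx_diag !mxE.
by case: eqP => [->|]; rewrite ?mulr1 ?mul1r ?mulr0 ?mul0r.
Qed.

Lemma diag_sq_perm (s : 'S_4) t B : in_torus t ->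
  linear_lift (phi (pgl_of (perm_mx s))) B ->
  diag_sq (torus_perm s t) = B *m diag_sq t *m invmx B.
Proof.
move=> ht lB; apply: square_lift_uniq (diag_sqP _) _.
rewrite diag_pgl_perm // !phiM (morph_gV phiM); exact: square_liftJ lB (diag_sqP t).
Qed.

End DiagonalSquares.

Section Weights.
Context (K : numClosedFieldType) (phi : PGL K 4 -> Bir (G13 K)).
Hypothesis phiM : forall g h, phi (g * h)%g = (phi g * phi h)%g.
Hypothesis phiAut : forall g, phi g \in Aut (G13 K).
Implicit Types (s t : 'rV[K]_4) (w : 'I_4 -> K -> K) (a b c d : K -> K).
Local Notation N := (diag_sq phiAut).

(** A homomorphism of K^*, extended by 0, so that two characters equal on K^* are equal as
    functions. *)
Definition character a : Prop := [/\ a 0 = 0, a 1 = 1 & forall x y, a (x * y) = a x * a y].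

Definition weight w t : K := \prod_i w i (t 0 i).

Definition is_weight w : Prop := (forall i, character (w i)) /\
  exists2 v : 'rV[K]_6, v != 0 & forall t, in_torus t -> v *m N t = weight w t *: v.

Definition coord_row (i : 'I_4) (x : K) : 'rV[K]_4 := \row_j (if j == i then x else 1).

Lemma prod4 (F : 'I_4 -> K) : \prod_i F i = F (@Ordinal 4 0 isT) * F (@Ordinal 4 1 isT)
  * F (@Ordinal 4 2 isT) * F (@Ordinal 4 3 isT).
Proof.
rewrite !big_ord_recr big_ord0 /= mul1r.
by congr (F _ * F _ * F _ * F _); apply: val_inj.
Qed.

Lemma coord_row_torus i x : x != 0 -> in_torus (coord_row i x).
Proof. by move=> x0 j; rewrite mxE; case: ifP => // _; apply: oner_neq0. Qed.

Lemma coord_rowM i x y : torus_mul (coord_row i x) (coord_row i y) = coord_row i (x * y).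
Proof. by apply/rowP => j; rewrite !mxE; case: ifP; rewrite ?mulr1. Qed.

Lemma weight_coord_row w i x : (forall j, character (w j)) ->
  weight w (coord_row i x) = w i x.
Proof.
move=> hw; rewrite /weight (bigD1 i) //= mxE eqxx big1 ?mulr1 // => j /negbTE ji.
by rewrite mxE ji; case: (hw j).
Qed.

Lemma character_neq0 a x : character a -> x != 0 -> a x != 0.
Proof.
move=> [_ a1 aM] x0; apply: contra_eq_neq a1 => e.
by rewrite -{1}(mulfV x0) aM e mul0r eq_sym oner_neq0.
Qed.

Lemma characterX a n x : character a -> a (x ^+ n) = a x ^+ n.
Proof. by move=> [_ a1 aM]; elim: n => [|n IHn]; rewrite ?expr0 // !exprS aM IHn. Qed.

(** K^* is divisible: every x is an n-th power. *)
Lemma character_torsion_free a n : character a -> (0 < n)%N ->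
  (forall x, x != 0 -> a x ^+ n = 1) -> forall x, x != 0 -> a x = 1.
Proof.
move=> ha n0 h x x0; rewrite -(@rootCK K n n0 x) characterX // h //.
by rewrite rootC_eq0.
Qed.

(** The joint eigenvector v is taken in the image of M - 1, where M = N t0. If its weight at t0 were
    1, then v = u (M - 1) would give u M^4 = u + 4 v, whereas M^4 = 1. *)
Lemma weight_ex t0 : in_torus t0 ->
  torus_mul (torus_mul t0 t0) (torus_mul t0 t0) = const_mx 1 -> N t0 != 1%:M ->
  exists2 w, is_weight w & weight w t0 != 1.
Proof.
move=> ht t04 N1; set M := N t0; pose W := M - 1%:M.
have W0 : W != 0 by rewrite subr_eq0.
have [|||v v0 [vW /choice[psi hpsi]]] := @joint_eigenvector K _ _ _ N W.
- exact: diag_sqC.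
- exact: W0.
- move=> t; rewrite mulmxBl mul1mx [M *m _]diag_sqC // -[X in _ - X]mulmx1 -mulmxBr.
  exact: submxMl.
have psiE t (k : K) : v *m N t = k *: v -> psi t = k.
  by rewrite hpsi => /eqP; rewrite -subr_eq0 -scalerBl scaler_eq0 (negbTE v0) orbF subr_eq0 => /eqP.
have psi1 : psi (const_mx 1) = 1.
  by apply: psiE; rewrite diag_sq_scalar ?oner_neq0 // mulmx1 scale1r.
have psiM s t : in_torus s -> in_torus t -> psi (torus_mul s t) = psi s * psi t.
  move=> hs ht'; apply: psiE; rewrite diag_sqM // mulmxA hpsi -scalemxAl hpsi scalerA.
  by [].
pose w i x := if x == 0 then 0 else psi (coord_row i x).
have hw i : character (w i).
  split=> [||x y]; rewrite /w ?eqxx //.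
    rewrite oner_eq0 -[RHS]psi1; congr psi; apply/rowP => j; rewrite !mxE.
    by case: ifP.
  rewrite mulf_eq0; have [_|x0] := eqVneq x 0; first by rewrite mul0r.
  have [_|y0] := eqVneq y 0; first by rewrite mulr0.
  by rewrite -psiM ?coord_rowM //; apply: coord_row_torus.
have hpw t : in_torus t -> psi t = weight w t.
  move=> ht'; rewrite /weight prod4 /w !(negbTE (ht' _)).
  rewrite -!psiM; do ?[apply: torus_mul_torus | apply: coord_row_torus | exact: ht'].
  congr psi; apply/rowP => j; rewrite !mxE.
  by elim/ord4P: j; rewrite /= ?mulr1 ?mul1r.
exists w; first by split=> //; exists v => // t /hpw <-.
rewrite -hpw //; apply/eqP => e1; have [u eu] := submxP vW.
have uM : u *m M = u + v by rewrite eu mulmxBr mulmx1 addrC subrK.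
have vM : v *m M = v by rewrite hpsi e1 scale1r.
have M4 : M *m M *m (M *m M) = 1%:M.
  by rewrite -!diag_sqM ?t04 ?diag_sq_scalar ?oner_neq0 //; apply: torus_mul_torus.
have : u *m (M *m M *m (M *m M)) = u + v *+ 4.
  rewrite !mulmxA !(uM, mulmxDl, vM) !mulrS mulr0n addr0 !addrA; congr (_ + _).
rewrite M4 mulmx1 => /eqP; rewrite -subr_eq0 opprD addrA subrr sub0r oppr_eq0.
by rewrite -scaler_nat scaler_eq0 pnatr_eq0 (negbTE v0).
Qed.

(** The permutation matrix normalizes the torus; conjugation by its lift B moves the eigenvector v
    to v B^-1. *)
Lemma is_weight_perm w (p : 'S_4) : is_weight w -> is_weight (fun i => w (p i)).
Proof.
move=> [hw [v v0 hv]]; split=> [i|]; first exact: hw.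
have [B lB] := linear_lift_ex phiAut (pgl_of (perm_mx p)).
have uB := linear_lift_unit lB.
exists (v *m invmx B).
  by apply: contra_neq v0 => e; rewrite -(mulmxKV uB v) e mul0mx.
move=> t ht; pose t' := torus_perm (p^-1)%g t.
have et : t = torus_perm p t' by apply/rowP => i; rewrite !mxE permK.
have ht' : in_torus t' by move=> i; rewrite mxE.
rewrite {1}et (diag_sq_perm phiM _ ht' lB) // !mulmxA mulmxKV // hv // -scalemxAl.
congr (_ *: _); rewrite /weight (reindex_inj (@perm_inj _ p)) /=.
by apply: eq_bigr => i _; rewrite mxE permK.
Qed.

(** Scalar matrices are trivial in PGL_4. *)
Lemma weight_scalar w x : is_weight w -> x != 0 -> \prod_i w i x = 1.
Proof.
move=> [hw [v v0 hv]] x0; have ht : in_torus (const_mx x) by move=> i; rewrite mxE.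
have := hv _ ht; rewrite diag_sq_scalar // mulmx1 => /eqP.
rewrite -{1}[v]scale1r -subr_eq0 -scalerBl scaler_eq0 (negbTE v0) orbF subr_eq0.
by move=> /eqP e; rewrite [RHS]e; apply: eq_bigr => i _; rewrite mxE.
Qed.

Lemma weight_neq w w' : (forall i, character (w i)) -> (forall i, character (w' i)) ->
  w <> w' -> exists2 t, in_torus t & weight w t != weight w' t.
Proof.
move=> hw hw' ne; have [i [x nx]] : exists i x, w i x != w' i x.
  apply: contrapT => /forallNP h; apply: ne; apply/funext => i; apply/funext => x.
  by apply/eqP; apply: contrapT => /negP nx; apply: (h i); exists x.
exists (coord_row i x); last by rewrite !weight_coord_row.
apply: coord_row_torus; apply: contra_neq nx => ->.
by have [-> _ _] := hw i; have [-> _ _] := hw' i.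
Qed.

Lemma weights_basis m (ws : 'I_m -> 'I_4 -> K -> K) :
  (forall k, is_weight (ws k)) -> injective ws -> exists V : 'M[K]_(m, 6),
  row_free V /\ forall k t, in_torus t -> row k V *m N t = weight (ws k) t *: row k V.
Proof.
move=> hws inj.
have /choice[v hv] : forall k, exists v : 'rV[K]_6, v != 0 /\
    forall t, in_torus t -> v *m N t = weight (ws k) t *: v.
  by move=> k; have [_ [v v0 ev]] := hws k; exists v.
pose V := \matrix_k v k; have rV k : row k V = v k by apply: rowK.
exists V; split; last by move=> k t ht; rewrite rV (hv k).2.
pose psi k t := if `[< in_torus t >] then weight (ws k) t else 1.
apply: (@weights_free K 6 m _ N V psi) => [k t|k|k l kl].
- rewrite rV /psi; case: asboolP => ht; first by rewrite (hv k).2.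
  by rewrite diag_sq_singular // mulmx1 scale1r.
- by rewrite rV (hv k).1.
have [||ne|t ht nt] := @weight_neq (ws k) (ws l).
- by case: (hws k).
- by case: (hws l).
- by move/eqP: kl; apply; apply: inj.
by exists t; rewrite /psi; case: asboolP.
Qed.

(** N preserves the Pluecker form, so two eigenvectors are orthogonal unless their weights are
    inverse to each other. The span is totally isotropic, of dimension at most half of 6. *)
Lemma weights_isotropic m (ws : 'I_m -> 'I_4 -> K -> K) :
  (forall k, is_weight (ws k)) -> injective ws ->
  (forall k l, exists2 t, in_torus t & weight (ws k) t * weight (ws l) t != 1) ->
  (m + m <= 6)%N.
Proof.
move=> hws inj hne; have [V [fV hV]] := weights_basis hws inj.
have e0 : V *m pl_form K *m V^T = 0.
  apply/matrixP => k l; have [t ht nt] := hne k l.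
  have E : (V *m pl_form K *m V^T) k l = (row k V *m pl_form K *m (row l V)^T) 0 0.
    by rewrite tr_row colE mulmxA -colE -!row_mul [RHS]mxE [RHS]mxE.
  apply/eqP; have : (weight (ws k) t * weight (ws l) t - 1) * (V *m pl_form K *m V^T) k l = 0.
    rewrite mulrBl mul1r E -{2}(diag_sq_form phiAut t).
    rewrite !mulmxA hV // -!mulmxA -trmx_mul hV // linearZ /= -scalemxAl -!scalemxAr.
    by rewrite !mxE mulrA subrr.
  by move/eqP; rewrite mulf_eq0 subr_eq0 (negbTE nt) [X in _ -> _ == X]mxE.
have := mulmx0_rank_max e0; rewrite mxrank_tr mxrankMfree; last first.
  by rewrite row_free_unit; apply: pl_form_unit.
by rewrite (eqP fV).
Qed.

End Weights.

Section WeightClassification.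
Context (K : numClosedFieldType) (phi : PGL K 4 -> Bir (G13 K)).
Hypothesis phiM : forall g h, phi (g * h)%g = (phi g * phi h)%g.
Hypothesis phiAut : forall g, phi g \in Aut (G13 K).
Implicit Types (a b c d : K -> K).
Local Notation o k := (@Ordinal 4 k isT).

Definition weight4 a b c d (i : 'I_4) : K -> K := nth a [:: a; b; c; d] i.

Local Notation isw a b c d := (is_weight phiAut (weight4 a b c d)).

Lemma isw_swap01 a b c d : isw a b c d -> isw b a c d.
Proof.
move=> /(is_weight_perm phiM (tperm (o 0) (o 1))); congr is_weight.
by apply/funext; elim/ord4P; rewrite /weight4 permE.
Qed.

Lemma isw_swap12 a b c d : isw a b c d -> isw a c b d.
Proof.
move=> /(is_weight_perm phiM (tperm (o 1) (o 2))); congr is_weight.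
by apply/funext; elim/ord4P; rewrite /weight4 permE.
Qed.

Lemma isw_swap23 a b c d : isw a b c d -> isw a b d c.
Proof.
move=> /(is_weight_perm phiM (tperm (o 2) (o 3))); congr is_weight.
by apply/funext; elim/ord4P; rewrite /weight4 permE.
Qed.

Definition quad : Type := ((K -> K) * (K -> K) * (K -> K) * (K -> K))%type.

Definition weight_quad (q : quad) := weight4 q.1.1.1 q.1.1.2 q.1.2 q.2.

Lemma weight_quad_inj : injective weight_quad.
Proof.
move=> [[[a b] c] d] [[[a' b'] c'] d'] e.
have E i : weight_quad (a, b, c, d) i = weight_quad (a', b', c', d') i by rewrite e.
move: (E (o 0)) (E (o 1)) (E (o 2)) (E (o 3)).
by rewrite /weight_quad /weight4 /= => -> -> -> ->.
Qed.

Lemma quad_nth_inj (l : seq quad) : uniq l ->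
  injective (fun k : 'I_(size l) => weight_quad (tnth (in_tuple l) k)).
Proof.
move=> ul; have inj : injective (tnth (in_tuple l)) by apply/tuple_uniqP.
by move=> i j /weight_quad_inj/inj.
Qed.

Lemma weights_le6 (l : seq quad) : uniq l ->
  (forall q, q \in l -> is_weight phiAut (weight_quad q)) -> (size l <= 6)%N.
Proof.
move=> ul hl.
have hw (k : 'I_(size l)) : is_weight phiAut (weight_quad (tnth (in_tuple l) k)).
  by apply/hl/mem_tnth.
have [V [fV _]] := weights_basis phiM hw (quad_nth_inj ul).
by rewrite -(eqP fV) rank_leq_col.
Qed.

(* Permuting the values would give seven distinct weights in dimension 6. *)
Lemma isw_not_3_values a b c d : isw a b c d -> a != b -> a != c -> b != c -> False.
Proof.
move=> h ab ac bc.
have h1 := isw_swap01 h; have h2 := isw_swap12 h; have h3 := isw_swap12 h1.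
have h4 := isw_swap01 h2; have h5 := isw_swap12 h4.
have ba : b != a by rewrite eq_sym.
have ca : c != a by rewrite eq_sym.
have cb : c != b by rewrite eq_sym.
pose l6 : seq quad := [:: (a, b, c, d); (b, a, c, d); (a, c, b, d); (b, c, a, d); (c, a, b, d); (c, b, a, d)].
have u6 : uniq l6.
  rewrite /= !inE !xpair_eqE !eqxx !(negbTE ab) !(negbTE ac) !(negbTE bc).
  by rewrite !(negbTE ba) !(negbTE ca) !(negbTE cb) /= ?andbF.
have hl6 q : q \in l6 -> is_weight phiAut (weight_quad q).
  by rewrite !inE => /or4P[|||/or3P[]] /eqP ->.
suff [q [hq dq]] : exists q : quad, is_weight phiAut (weight_quad q) /\ q.2 != d.
  suff : (size (q :: l6) <= 6)%N by [].
  apply: weights_le6.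
    rewrite -[uniq _]/((q \notin l6) && uniq l6) u6 andbT.
    apply/negP; rewrite !inE => /or4P[|||/or3P[]] /eqP e;
      by move: dq; rewrite e eqxx.
  by move=> q'; rewrite inE => /orP[/eqP->|/hl6].
have [ad|ad] := eqVneq a d.
  exists (a, c, d, b); split; last by rewrite /= -ad.
  exact: isw_swap23 h2.
exists (b, c, d, a); split => //; exact: isw_swap23 h3.
Qed.

Lemma isw_char a b c d : isw a b c d ->
  [/\ character a, character b, character c & character d].
Proof. by move=> [h _]; split; [apply: (h (o 0))|apply: (h (o 1))|apply: (h (o 2))|apply: (h (o 3))]. Qed.

Lemma isw_scalar a b c d x : isw a b c d -> x != 0 -> a x * b x * c x * d x = 1.
Proof. by move=> h x0; have := weight_scalar phiM h x0; rewrite prod4. Qed.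

Lemma character_eq a b : character a -> character b -> (forall x, x != 0 -> a x = b x) -> a = b.
Proof.
move=> [a0 _ _] [b0 _ _] h; apply/funext => x.
by have [->|/h//] := eqVneq x 0; rewrite a0 b0.
Qed.

(* The four permuted weights would span a totally isotropic subspace, whose
   dimension is at most 3. *)
Lemma isw_not_3_1 a b : isw a a a b -> a != b -> False.
Proof.
move=> h ab; have [ha _ _ hb] := isw_char h.
have ba : b != a by rewrite eq_sym.
(* If a^2 = 1, divisibility gives a = 1, and triviality on scalars then gives b = 1 = a. *)
have [x x0 nx] : exists2 x, x != 0 & a x * a x != 1.
  apply: contrapT => /forall2NP hx.
  have a1 x : x != 0 -> a x = 1.
    apply: (@character_torsion_free K a 2 ha isT) => {}x x0.
    by rewrite expr2; case: (hx x) => // /negP/negPn/eqP.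
  case/eqP: ab; apply: character_eq => // x x0.
  by have := isw_scalar h x0; rewrite !(a1 x x0) !mul1r => ->; rewrite ?a1.
have h1 := isw_swap23 h; have h2 := isw_swap12 h1; have h3 := isw_swap01 h2.
pose l : seq quad := [:: (a, a, a, b); (a, a, b, a); (a, b, a, a); (b, a, a, a)].
have ul : uniq l.
  by rewrite /= !inE !xpair_eqE !eqxx !(negbTE ab) !(negbTE ba).
have hw (k : 'I_(size l)) : is_weight phiAut (weight_quad (tnth (in_tuple l) k)).
  have : tnth (in_tuple l) k \in l by apply: mem_tnth.
  by rewrite !inE => /or4P[] /eqP ->.
suff : (size l + size l <= 6)%N by [].
apply: (weights_isotropic phiM hw (quad_nth_inj ul)) => k k'.
(* Each of the four weights has b in one place only, so any two of them share a coordinate with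
   value a. *)
have [i [hi hi']] : exists i, weight_quad (tnth (in_tuple l) k) i = a /\
    weight_quad (tnth (in_tuple l) k') i = a.
  have : tnth (in_tuple l) k \in l by apply: mem_tnth.
  have : tnth (in_tuple l) k' \in l by apply: mem_tnth.
  rewrite !inE => /or4P[] /eqP -> /or4P[] /eqP ->;
    first [by exists (o 0)|by exists (o 1)|by exists (o 2)|by exists (o 3)].
have hch m : forall j, character (weight_quad (tnth (in_tuple l) m) j).
  have : tnth (in_tuple l) m \in l by apply: mem_tnth.
  by rewrite !inE => /or4P[] /eqP -> ; elim/ord4P.
exists (coord_row i x); first exact: coord_row_torus.
by rewrite !weight_coord_row // hi hi'.
Qed.

(** Three distinct values and the pattern 3 + 1 are excluded, and four equal values give a^4 = 1,
    hence a trivial weight. The pattern 2 + 2 remains, where a^2 b^2 = 1 forces a b = 1. *)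
Theorem weight_pairs w t : is_weight phiAut w -> in_torus t -> weight w t != 1 ->
  exists a b, [/\ isw a a b b, a != b & forall x, x != 0 -> a x * b x = 1].
Proof.
move=> hw ht nt.
have ew : w = weight4 (w (o 0)) (w (o 1)) (w (o 2)) (w (o 3)).
  by apply/funext; elim/ord4P.
move: nt hw; rewrite ew; move: (w (o 0)) (w (o 1)) (w (o 2)) (w (o 3)) => a b c d nt hw {w ew}.
suff [a' [b' [h ab]]] : exists a' b', isw a' a' b' b' /\ a' != b'.
  exists a', b'; split => // x x0; have [ha _ hb _] := isw_char h.
  have [_ _ aM] := ha; have [_ _ bM] := hb.
  have habc : character (fun x => a' x * b' x).
    have [a0 a1 _] := ha; have [b0 b1 _] := hb.
    by split=> [||y z]; rewrite ?a0 ?b0 ?a1 ?b1 ?mul1r ?mulr0 // aM bM; ring.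
  apply: (character_torsion_free habc (isT : (0 < 2)%N)) => // y y0.
  by rewrite -(isw_scalar h y0); ring.
have [eab|ab] := eqVneq a b.
  subst b; have [eac|ac] := eqVneq a c.
    subst c; have [ead|ad] := eqVneq a d; last by case: (isw_not_3_1 hw ad).
    subst d; case/eqP: nt; rewrite /weight; have [ha _ _ _] := isw_char hw.
    have a1 x : x != 0 -> a x = 1.
      apply: (@character_torsion_free K a 4 ha isT) => {}x x0.
      by rewrite -(isw_scalar hw x0); ring.
    by rewrite prod4 /weight4 /= !a1 // !mulr1.
  have [eda|da] := eqVneq d a.
    by subst d; case: (isw_not_3_1 (isw_swap23 hw) ac).
  have [edc|dc] := eqVneq d c; first by subst d; exists a, c.
  by case: (isw_not_3_values (isw_swap23 (isw_swap12 hw)) ac); rewrite eq_sym.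
have [eca|ca] := eqVneq c a.
  subst c; have [eda|da] := eqVneq d a.
    by subst d; case: (isw_not_3_1 (isw_swap23 (isw_swap12 hw)) ab).
  have [edb|db] := eqVneq d b; first by subst d; exists a, b; split=> //; apply: isw_swap12.
  by case: (isw_not_3_values (isw_swap23 hw) ab); rewrite eq_sym.
have [ecb|cb] := eqVneq c b; last by case: (isw_not_3_values hw ab); rewrite eq_sym.
subst c; have [eda|da] := eqVneq d a.
  by subst d; exists a, b; split=> //; apply/isw_swap12/isw_swap23.
have [edb|db] := eqVneq d b.
  subst d; case: (isw_not_3_1 (isw_swap23 (isw_swap12 (isw_swap01 hw)))) => //.
by case: (isw_not_3_values (isw_swap23 hw) ab); rewrite eq_sym.
Qed.

End WeightClassification.

(** * Coordinates diagonalizing the torus *)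

Section Eigenbasis.
Context (K : numClosedFieldType) (phi : PGL K 4 -> Bir (G13 K)).
Hypothesis phiM : forall g h, phi (g * h)%g = (phi g * phi h)%g.
Hypothesis phiAut : forall g, phi g \in Aut (G13 K).
Implicit Types (t : 'rV[K]_4) (k l : 'I_6) (x y : 'cV[K]_6).
Local Notation N := (diag_sq phiAut).
Local Notation J := (pl_form K).

Definition on_line k (i : 'I_4) : bool := (i == pl_fst k) || (i == pl_snd k).

Definition line_weight (a : K -> K) k t : K :=
  \prod_i (if on_line k i then a (t 0 i) else (a (t 0 i))^-1).

(** The rows of E are eigenvectors, one for each pair of coordinates; the condition on a^2 separates
    their six weights. *)
Definition eigenbasis (E : 'M[K]_6) (a : K -> K) : Prop :=
  [/\ E \in unitmx, character a, exists2 x, x != 0 & a x ^+ 2 != 1 &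
      forall t, in_torus t -> E *m N t = diag_mx (\row_k line_weight a k t) *m E].

Lemma on_line_inj k l : on_line k =1 on_line l -> k = l.
Proof.
move=> e; move: (e (@Ordinal 4 0 isT)) (e (@Ordinal 4 1 isT)) (e (@Ordinal 4 2 isT)).
by elim/ord6P: k {e}; elim/ord6P: l.
Qed.

Lemma on_line_rev k i : on_line (rev_ord k) i = ~~ on_line k i.
Proof. by elim/ord6P: k; elim/ord4P: i. Qed.

Lemma on_line_meet k l : l != rev_ord k -> exists i, on_line k i = on_line l i.
Proof.
move=> h; apply: contrapT => /forallNP ne; case/eqP: h; apply: on_line_inj => i.
by rewrite on_line_rev; move: (ne i); case: (on_line k i); case: (on_line l i).
Qed.

(** The S_4-orbit of (a, a, b, b) has six members, indexed by the pairs of places that carry a. They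
    are distinct, so their eigenvectors fill dimension 6. *)
Theorem eigenbasis_ex t : in_torus t ->
  torus_mul (torus_mul t t) (torus_mul t t) = const_mx 1 -> N t != 1%:M ->
  exists E a, eigenbasis E a.
Proof.
move=> ht t4 N1; have [w hw wt] := weight_ex phiM ht t4 N1.
have [a [b [h ab abx]]] := weight_pairs phiM hw ht wt.
have [ha _ hb _] := isw_char h.
pose ws k i := if on_line k i then a else b.
have hws k : is_weight phiAut (ws k).
  have h1 := isw_swap12 phiM h; have h2 := isw_swap01 phiM h1.
  have h3 := isw_swap23 phiM h1; have h4 := isw_swap23 phiM h2.
  have h5 := isw_swap12 phiM h4.
  have E (a0 a1 a2 a3 : K -> K) : is_weight phiAut (weight4 a0 a1 a2 a3) ->
    ws k = weight4 a0 a1 a2 a3 -> is_weight phiAut (ws k) by move=> ? ->.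
  elim/ord6P: k E => E; [apply: (E _ _ _ _ h)|apply: (E _ _ _ _ h1)|apply: (E _ _ _ _ h3)
   |apply: (E _ _ _ _ h2)|apply: (E _ _ _ _ h4)|apply: (E _ _ _ _ h5)];
   by apply/funext; elim/ord4P.
have wsi : injective ws.
  move=> k l e; apply: on_line_inj => i; have := congr1 (fun f => f i) e.
  rewrite /ws; case: (on_line k i); case: (on_line l i) => // e'; move/eqP: ab => [] //.
have [V [fV hV]] := weights_basis phiM hws wsi.
have ab1 (x : K) : x != 0 -> b x = (a x)^-1.
  move=> x0; apply: (mulfI (character_neq0 ha x0)).
  by rewrite abx // mulfV // character_neq0.
exists V, a; split => //.
- by rewrite -row_free_unit.
- apply: contrapT => /forall2NP hx; case/eqP: ab; apply: character_eq => // x x0.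
  have a1 (y : K) : y != 0 -> a y = 1.
    apply: (character_torsion_free ha (isT : (0 < 2)%N)) => {}y y0.
    by case: (hx y) => // /negP/negPn/eqP.
  by rewrite ab1 // a1 // invr1.
move=> s hs; apply/row_matrixP => k; rewrite row_mul hV // mul_diag_mx.
apply/rowP => j; rewrite !mxE; congr (_ * _).
by apply: eq_bigr => i _; rewrite /ws; case: ifP => // _; rewrite ab1 // hs.
Qed.

Variables (E : 'M[K]_6) (a : K -> K).
Hypothesis hE : eigenbasis E a.

Lemma eigen_unit : E \in unitmx. Proof. by case: hE. Qed.

Lemma eigen_char : character a. Proof. by case: hE. Qed.

Lemma line_weight_coord k i (x : K) : x != 0 ->
  line_weight a k (coord_row i x) = if on_line k i then a x else (a x)^-1.
Proof.
move=> x0; have [_ a1 _] := eigen_char.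
rewrite /line_weight (bigD1 i) //= mxE eqxx big1 ?mulr1 // => j /negbTE ji.
by rewrite mxE ji a1 invr1 if_same.
Qed.

Lemma line_weight_neq k l : k != l ->
  exists2 t, in_torus t & line_weight a k t != line_weight a l t.
Proof.
move=> kl; have [i ni] : exists i, on_line k i != on_line l i.
  apply: contrapT => /forallNP h; case/eqP: kl; apply: on_line_inj => i.
  by apply/eqP; apply: contrapT => /negP; apply: h.
have [_ ha [x x0 nx] _] := hE; exists (coord_row i x); first exact: coord_row_torus.
rewrite !line_weight_coord //; have nz := character_neq0 ha x0.
have nz2 : a x != (a x)^-1.
  by apply: contra_neq nx => e; rewrite expr2 {2}e mulfV.
by case: (on_line k i) (on_line l i) ni => -[] // _; rewrite eq_sym.
Qed.

Lemma line_weightM_neq k l : l != rev_ord k ->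
  exists2 t, in_torus t & line_weight a k t * line_weight a l t != 1.
Proof.
move=> /on_line_meet[i ei].
have [_ ha [x x0 nx] _] := hE; exists (coord_row i x); first exact: coord_row_torus.
rewrite !line_weight_coord // -ei -expr2; case: ifP => // _.
by rewrite exprVn invr_eq1.
Qed.

Lemma eigen_row (u : 'rV[K]_6) k :
  (forall t, in_torus t -> u *m N t = line_weight a k t *: u) ->
  exists c, u = c *: row k E.
Proof.
move=> hu; have [uE _ _ hEN] := hE; pose c := u *m invmx E.
have eu : u = c *m E by rewrite mulmxKV.
have c0 l : l != k -> c 0 l = 0.
  move=> lk; have [t ht nt] := line_weight_neq lk.
  have : c *m diag_mx (\row_k line_weight a k t) = line_weight a k t *: c.
    apply: (can_inj (mulmxK uE)); rewrite -mulmxA -hEN // mulmxA -eu hu //.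
    by rewrite eu -scalemxAl.
  move=> /rowP/(_ l); rewrite mul_mx_diag !mxE mulrC => /eqP.
  by rewrite -subr_eq0 -mulrBl mulf_eq0 subr_eq0 (negbTE nt) => /eqP.
exists (c 0 k); rewrite {1}eu mulmx_sum_row (bigD1 k) //= big1 ?addr0 // => l lk.
by rewrite c0 // scale0r.
Qed.

(** The rows of E serve as linear forms; in these coordinates every N t with t in the torus is
    diagonal. *)
Definition ecoord (x : 'cV[K]_6) (k : 'I_6) : K := (E *m x) k 0.

(** The lift of p permutes the weight spaces, which are one-dimensional by [eigen_row]. *)
Lemma perm_coord (p : 'S_4) (pi : 'I_6 -> 'I_6) B :
  (forall k i, on_line (pi k) (p i) = on_line k i) ->
  linear_lift (phi (pgl_of (perm_mx p))) B ->
  exists beta, forall k x, ecoord (B *m x) k = beta k * ecoord x (pi k).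
Proof.
move=> hpi lB; have uB := linear_lift_unit lB; have [uE _ _ hEN] := hE.
have /choice[beta hb] : forall k, exists c, row k (E *m B) = c *: row (pi k) E.
  move=> k; apply: eigen_row => t ht.
  have eBN : B *m N t = N (torus_perm p t) *m B.
    by rewrite (diag_sq_perm phiM _ ht lB) mulmxKV.
  have hpt : in_torus (torus_perm p t) by move=> i; rewrite mxE.
  rewrite -row_mul -mulmxA eBN mulmxA hEN // -mulmxA.
  have -> : line_weight a (pi k) t = line_weight a k (torus_perm p t).
    rewrite /line_weight (reindex_inj (@perm_inj _ p)) /=.
    by apply: eq_bigr => i _; rewrite hpi mxE.
  by apply/rowP => j; rewrite mul_diag_mx !mxE.
exists beta => k x; rewrite /ecoord mulmxA.
have E1 (M : 'M[K]_6) j : (M *m x) j 0 = (row j M *m x) 0 0 by rewrite -row_mul [RHS]mxE.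
by rewrite E1 hb -scalemxAl mxE -E1.
Qed.

Definition coord_form : 'M[K]_6 := (invmx E)^T *m J *m invmx E.

Lemma coord_form_tr : coord_form^T = coord_form.
Proof. by rewrite /coord_form !trmx_mul trmxK pl_form_tr mulmxA. Qed.

(** Invariance under N t lets J couple two eigencoordinates only if their weights are inverse, which
    singles out complementary pairs. *)
Lemma coord_form_rev k l : l != rev_ord k -> coord_form k l = 0.
Proof.
move=> h; have [t ht nt] := line_weightM_neq h; have [uE _ _ hEN] := hE.
set D := diag_mx (\row_k line_weight a k t).
(* Since J^2 = 1, invariance on rows passes to columns. *)
have NJ : (N t)^T *m J *m N t = J.
  have e : N t *m (J *m (N t)^T *m J) = 1%:M.
    by rewrite !mulmxA diag_sq_form pl_form_sqr.
  by have := congr1 (mulmx J) (mulmx1C e); rewrite mulmx1 !mulmxA pl_form_sqr mul1mx.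
have eG : D *m coord_form *m D = coord_form.
  have eN : N t *m invmx E = invmx E *m D.
    by apply: (can_inj (mulKmx uE)); rewrite !mulmxA hEN // mulmxK // mulmxV // mul1mx.
  have DT : D^T = D by rewrite tr_diag_mx.
  have eN' : (invmx E)^T *m (N t)^T = D *m (invmx E)^T by rewrite -trmx_mul eN trmx_mul DT.
  rewrite /coord_form !mulmxA -eN' -!mulmxA -eN; congr (_ *m _).
  by rewrite -[J in RHS]NJ !mulmxA.
move: eG; move: coord_form => G eG.
apply/eqP; have /matrixP/(_ k l) := eG; rewrite /D mul_mx_diag mul_diag_mx !mxE.
rewrite mulrAC => /eqP; rewrite -subr_eq0 -{2}[_ k l]mul1r -mulrBl mulf_eq0 subr_eq0.
by rewrite (negbTE nt).
Qed.

Lemma coord_form_neq0 k : coord_form k (rev_ord k) != 0.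
Proof.
apply/eqP => e; have uG : coord_form \in unitmx.
  by rewrite !unitmx_mul unitmx_tr unitmx_inv eigen_unit pl_form_unit.
have : row k coord_form = 0.
  apply/rowP => l; rewrite [LHS]mxE [RHS]mxE.
  by have [->|/coord_form_rev] := eqVneq l (rev_ord k).
rewrite rowE => /(congr1 (fun M => M *m invmx coord_form)).
rewrite mulmxK // mul0mx => /rowP/(_ k) /eqP; rewrite !mxE !eqxx.
by rewrite oner_eq0.
Qed.

Lemma bilin_coord x y : bilin J x y =
  \sum_k coord_form k (rev_ord k) * (ecoord x k * ecoord y (rev_ord k)).
Proof.
have -> : bilin J x y = bilin coord_form (E *m x) (E *m y).
  by rewrite bilin_mul /coord_form !mulmxA -trmx_mul mulVmx ?eigen_unit // trmx1 mul1mx mulmxKV ?eigen_unit.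
move: coord_form coord_form_rev => G hG; rewrite /bilin -mulmxA mxE.
apply: eq_bigr => k _; rewrite /ecoord [_^T _ _]mxE [(G *m _) _ _]mxE (bigD1 (rev_ord k)) //=.
rewrite big1 ?addr0 => [|l lk]; last by rewrite hG // mul0r.
by rewrite mulrCA.
Qed.

(** The contribution of one pair of complementary coordinates to the Pluecker form; on the quadric
    the three contributions add up to 0. *)
Definition line_product k x : K := coord_form k (rev_ord k) * (ecoord x k * ecoord x (rev_ord k)).

Lemma coord_inv y k : ecoord (invmx E *m y) k = y k 0.
Proof. by rewrite /ecoord mulKVmx ?eigen_unit. Qed.

(** J is evaluated on the vectors dual to the coordinates pi k and rev_ord (pi k); after B only the
    summand of index k survives. *)
Lemma beta_product (pi : 'I_6 -> 'I_6) B beta c : injective pi ->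
  (forall k, pi (rev_ord k) = rev_ord (pi k)) ->
  B^T *m J *m B = c *: J ->
  (forall k x, ecoord (B *m x) k = beta k * ecoord x (pi k)) ->
  forall k, coord_form k (rev_ord k) * (beta k * beta (rev_ord k)) =
    c * coord_form (pi k) (rev_ord (pi k)).
Proof.
move=> pinj pirev eB hb k.
pose x := invmx E *m delta_mx (pi k) (0 : 'I_1).
pose y := invmx E *m delta_mx (rev_ord (pi k)) (0 : 'I_1).
have cx l : ecoord x l = (l == pi k)%:R by rewrite coord_inv mxE eqxx andbT.
have cy l : ecoord y l = (l == rev_ord (pi k))%:R by rewrite coord_inv mxE eqxx andbT.
have : bilin J (B *m x) (B *m y) = c * bilin J x y.
  by rewrite bilin_mul eB /bilin -scalemxAr -scalemxAl mxE.
rewrite !bilin_coord (bigD1 k) //= [in RHS](bigD1 (pi k)) //=.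
rewrite !hb !cx !cy pirev !eqxx !mulr1 big1 ?addr0 => [|l lk].
  rewrite big1 ?addr0 => [|l lk]; first by [].
  by rewrite !cx (negbTE lk) mul0r mulr0.
by rewrite !hb cx (inj_eq pinj) (negbTE lk) mulr0 mul0r mulr0.
Qed.

Lemma line_product_perm (pi : 'I_6 -> 'I_6) B beta c : injective pi ->
  (forall k, pi (rev_ord k) = rev_ord (pi k)) ->
  B^T *m J *m B = c *: J ->
  (forall k x, ecoord (B *m x) k = beta k * ecoord x (pi k)) ->
  forall k x, line_product k (B *m x) = c * line_product (pi k) x.
Proof.
move=> pinj pirev eB hb k x; rewrite /line_product !hb pirev [RHS]mulrA.
by rewrite -(beta_product pinj pirev eB hb); ring.
Qed.

End Eigenbasis.

(** * Twisting the torus by a monomial map *)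

Section MultivariatePolynomialMaps.
Context (K : numClosedFieldType) (n : nat).

Definition mpolyfun (h : 'cV[K]_n -> K) : Prop := exists p : {mpoly K[n]}, forall x, pev p x = h x.

Lemma mpolyfunC c : mpolyfun (fun=> c).
Proof. by exists c%:MP => x; rewrite /pev mevalC. Qed.

Lemma mpolyfunX (i : 'I_n) : mpolyfun (fun x => x i 0).
Proof. by exists 'X_i => x; rewrite /pev mevalXU. Qed.

Lemma mpolyfunB g h : mpolyfun g -> mpolyfun h -> mpolyfun (fun x => g x - h x).
Proof. by move=> [p hp] [q hq]; exists (p - q) => x; rewrite /pev mevalB -!/(pev _ _) hp hq. Qed.

Lemma mpolyfunM g h : mpolyfun g -> mpolyfun h -> mpolyfun (fun x => g x * h x).
Proof. by move=> [p hp] [q hq]; exists (p * q) => x; rewrite pevM hp hq. Qed.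

Lemma mpolyfun_sum (I : finType) (g : I -> 'cV[K]_n -> K) :
  (forall i, mpolyfun (g i)) -> mpolyfun (fun x => \sum_i g i x).
Proof.
move=> /choice[p hp]; exists (\sum_i p i) => x.
by rewrite /pev raddf_sum /=; apply: eq_bigr => i _; rewrite -hp.
Qed.

Lemma mpolyfun_comp m (p : {mpoly K[m]}) (g : 'cV[K]_n -> 'cV[K]_m) :
  (forall j, mpolyfun (fun x => g x j 0)) -> mpolyfun (fun x => pev p (g x)).
Proof.
move=> /choice[q hq]; exists (p \mPo [tuple q j | j < m]) => x.
rewrite /pev comp_mpoly_meval; apply: meval_eq => j.
by rewrite tnth_mktuple -hq.
Qed.

Lemma mpolyfun_dense (S : K -> Prop) h : zariski_dense S -> mpolyfun h ->
  (forall x : 'cV[K]_n, (forall i, S (x i 0)) -> h x = 0) -> forall x, h x = 0.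
Proof.
move=> dS [p hp] h0 x; rewrite -hp; have [->|] := eqVneq p 0; first by rewrite /pev meval0.
by move=> /(mpoly_dense dS)[y Sy]; rewrite hp h0 // eqxx.
Qed.

End MultivariatePolynomialMaps.

Section CharacterImage.
Context (K : numClosedFieldType).

(** Otherwise all values of a are roots of p. Among the powers z^0, ..., z^(size p - 1) of a value z
    two coincide, so the order of z divides (size p)!, and divisibility makes a trivial. *)
Lemma character_dense (a : K -> K) : character a -> (exists2 x, x != 0 & a x ^+ 2 != 1) ->
  zariski_dense (fun z => exists2 x, x != 0 & z = a x).
Proof.
move=> ha [x x0 nx] p p0; apply: contrapT => /forall2NP h.
have rp y : y != 0 -> root p (a y).
  move=> y0; case: (h (a y)) => [ny|/negP/negPn/eqP/rootP //].
  by case: ny; exists y.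
have fin y : y != 0 -> a y ^+ (size p)`! = 1.
  move=> y0; set z := a y; have z0 : z != 0 by apply: character_neq0.
  have [i [j [ij js e]]] : exists i j, [/\ (i < j)%N, (j < size p)%N & z ^+ i = z ^+ j].
    apply: contrapT => ne; suff u : uniq [seq z ^+ i | i <- iota 0 (size p)].
      have r : all (root p) [seq z ^+ i | i <- iota 0 (size p)].
        apply/allP => _ /mapP[k _ ->]; rewrite /z -characterX //.
        by apply: rp; rewrite expf_neq0.
      by have := max_poly_roots p0 r u; rewrite size_map size_iota ltnn.
    rewrite map_inj_in_uniq ?iota_uniq // => i j; rewrite !mem_iota !add0n /= => ip jp e.
    by case: (ltngtP i j) => // ij; case: ne; [exists i, j|exists j, i].
  have e1 : z ^+ (j - i) = 1.
    by apply: (mulfI (expf_neq0 i z0)); rewrite mulr1 -exprD subnKC // ltnW.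
  have /dvdnP[k ->] : (j - i %| (size p)`!)%N.
    by apply: dvdn_fact; rewrite subn_gt0 ij /= (leq_trans (leq_subr _ _)) // ltnW.
  by rewrite mulnC exprM e1 expr1n.
have := character_torsion_free ha (fact_gt0 (size p)) fin x0 => a1.
by move: nx; rewrite a1 expr1n eqxx.
Qed.

(** Used at the torus point (1, s0, s1, s2): it prescribes the ratios s_i^2 / (s0 s1 s2) = r_i.
    Square roots of the r_i solve the system. *)
Lemma solve_torus (r0 r1 r2 : K) : r0 != 0 -> r1 != 0 -> r2 != 0 ->
  exists s0 s1 s2, [/\ [/\ s0 != 0, s1 != 0 & s2 != 0], s0 = r0 * (s1 * s2),
    s1 = r1 * (s0 * s2) & s2 = r2 * (s0 * s1)].
Proof.
move=> n0 n1 n2; pose q0 := sqrtC r0; pose q1 := sqrtC r1; pose q2 := sqrtC r2.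
have e0 : r0 = q0 ^+ 2 by rewrite sqrtCK.
have e1 : r1 = q1 ^+ 2 by rewrite sqrtCK.
have e2 : r2 = q2 ^+ 2 by rewrite sqrtCK.
have [m0 m1 m2] : [/\ q0 != 0, q1 != 0 & q2 != 0] by rewrite !sqrtC_eq0.
exists (q1 * q2)^-1, (q0 * q2)^-1, (q0 * q1)^-1; rewrite !invr_eq0 !mulf_neq0 //.
by rewrite e0 e1 e2; split=> //; field; rewrite m0 m1 m2.
Qed.

End CharacterImage.

Section TorusOrbits.
Context (K : numClosedFieldType) (phi : PGL K 4 -> Bir (G13 K)).
Hypothesis phiM : forall g h, phi (g * h)%g = (phi g * phi h)%g.
Hypothesis phiAut : forall g, phi g \in Aut (G13 K).
Implicit Types (t : 'rV[K]_4) (k l : 'I_6) (x y : 'cV[K]_6).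
Variables (E : 'M[K]_6) (a : K -> K).
Hypothesis hE : eigenbasis phiAut E a.
Local Notation J := (pl_form K).
Local Notation y_ := (ecoord E).

(** For entries a(t_i) this is the weight of line k times the product of all four a(t_i): the common
    factor turns the weights into polynomials. *)
Definition line_square t k : K := (t 0 (pl_fst k) * t 0 (pl_snd k)) ^+ 2.

Lemma line_weight_square t k : in_torus t ->
  (\prod_i a (t 0 i)) * line_weight a k t = line_square (map_mx a t) k.
Proof.
move=> ht; have ha := eigen_char hE; rewrite /line_weight -big_split /= prod4.
have nz i : a (t 0 i) != 0 by apply: character_neq0.
have := (nz (@Ordinal 4 0 isT), nz (@Ordinal 4 1 isT), nz (@Ordinal 4 2 isT), nz (@Ordinal 4 3 isT)).
move=> [[[n0 n1] n2] n3]; rewrite /line_square !mxE.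
by elim/ord6P: k; rewrite /on_line /=; field; rewrite ?n0 ?n1 ?n2 ?n3.
Qed.

Lemma diag_square_lift t : in_torus t -> exists2 M,
  linear_lift (phi (diag_pgl (torus_mul t t))) M &
  forall x k, y_ (M *m x) k = line_square (map_mx a t) k * y_ x k.
Proof.
move=> ht; have ha := eigen_char hE; have [_ _ _ hEN] := hE.
exists ((\prod_i a (t 0 i)) *: diag_sq phiAut t).
  apply: linear_liftZ; first by apply/prodf_neq0 => i _; apply: character_neq0.
  by rewrite phi_diagM //; apply: square_lift_lift; apply: diag_sqP.
move=> x k; rewrite /ecoord -scalemxAl -scalemxAr mulmxA hEN // -mulmxA.
rewrite mul_diag_mx mxE [X in _ * X = _]mxE [in X in _ * (X * _)]mxE mulrA.
by rewrite line_weight_square.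
Qed.

Lemma ecoord0 k : y_ 0 k = 0.
Proof. by rewrite /ecoord mulmx0 mxE. Qed.

Lemma ecoordZ c x k : y_ (c *: x) k = c * y_ x k.
Proof. by rewrite /ecoord -scalemxAr mxE. Qed.

Lemma ecoord_inj x x' : (forall k, y_ x k = y_ x' k) -> x = x'.
Proof.
move=> h; apply: (can_inj (mulKmx (eigen_unit hE))).
by apply/matrixP => i j; rewrite ord1; apply: h.
Qed.

Lemma ecoord_minors u w : (u != 0 -> w != 0 -> same_point u w) ->
  forall k l, y_ u k * y_ w l = y_ u l * y_ w k.
Proof.
move=> h k l; have [->|u0] := eqVneq u 0; first by rewrite !ecoord0 !mul0r.
have [->|w0] := eqVneq w 0; first by rewrite !ecoord0 !mulr0.
by have [c _ ->] := h u0 w0; rewrite !ecoordZ; ring.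
Qed.

Definition escale (s : 'I_6 -> K) x : 'cV[K]_6 := invmx E *m \col_k (s k * y_ x k).

Lemma ecoord_escale s x k : y_ (escale s x) k = s k * y_ x k.
Proof. by rewrite /escale (coord_inv hE) mxE. Qed.

(* The action of [[1,0,0],[-1,1,0],[0,0,-1]] on (t_1, t_2, t_3) with t_0 = 1, up
   to a scalar that clears the denominators. *)
Definition torus_twist t : 'rV[K]_4 := \row_i nth 0
  [:: t 0 (@Ordinal 4 1 isT) * t 0 (@Ordinal 4 3 isT);
      t 0 (@Ordinal 4 1 isT) ^+ 2 * t 0 (@Ordinal 4 3 isT);
      t 0 (@Ordinal 4 2 isT) * t 0 (@Ordinal 4 3 isT); t 0 (@Ordinal 4 1 isT)] i.

Lemma torus_twist_torus t : in_torus t -> in_torus (torus_twist t).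
Proof. by move=> ht; elim/ord4P; rewrite mxE /= ?mulf_neq0 ?expf_neq0. Qed.

Lemma torus_twistM s t : torus_twist (torus_mul s t) = torus_mul (torus_twist s) (torus_twist t).
Proof. by apply/rowP; elim/ord4P; rewrite !mxE /=; ring. Qed.

Lemma torus_twist_map t : torus_twist (map_mx a t) = map_mx a (torus_twist t).
Proof.
have [_ _ aM] := eigen_char hE.
by apply/rowP; elim/ord4P; rewrite !mxE /= ?expr2 ?aM ?mxE.
Qed.

Definition torus_of (s : 'cV[K]_3) : 'rV[K]_4 := \row_i nth 0
  [:: 1; s (@Ordinal 3 0 isT) 0; s (@Ordinal 3 1 isT) 0; s (@Ordinal 3 2 isT) 0] i.

Variable f0 : Bir (G13 K).
Hypothesis twist : forall t, in_torus t -> t 0 0 = 1 ->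
  (f0 * phi (diag_pgl t) = phi (diag_pgl (torus_twist t)) * f0)%g.

(** F maps a torus scaling of x to the twisted scaling of F x. The proportionality is written with
    minors, which makes it a polynomial identity valid also where F vanishes. *)
Lemma twist_square F (hF : is_birat (G13 K) F) t x k l : f0 = to_bir hF ->
  is_line x -> in_torus t -> t 0 0 = 1 ->
  y_ (mev F (escale (line_square (map_mx a t)) x)) k *
    (line_square (torus_twist (map_mx a t)) l * y_ (mev F x) l) =
  y_ (mev F (escale (line_square (map_mx a t)) x)) l *
    (line_square (torus_twist (map_mx a t)) k * y_ (mev F x) k).
Proof.
move=> ef lx ht t1; have [M [hM eM] cM] := diag_square_lift ht.
have [M' [hM' eM'] cM'] := diag_square_lift (torus_twist_torus ht).
have eMx : M *m x = escale (line_square (map_mx a t)) x.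
  by apply: ecoord_inj => j; rewrite cM ecoord_escale.
rewrite -eMx torus_twist_map -!cM'; apply: ecoord_minors.
(* The diagonal lifts represent images of squares, so the twisting relation is applied to t^2. *)
have t2 : in_torus (torus_mul t t) by apply: torus_mul_torus.
have := twist t2 _; rewrite mxE t1 mulr1 => /(_ erefl).
rewrite torus_twistM eM eM' ef [LHS]bir_mulE [RHS]bir_mulE => /to_birP/(_ x lx).
by rewrite !mev_comp !mev_lin.
Qed.

Lemma line_square_poly k : mpolyfun (fun s => line_square (torus_of s) k).
Proof.
have h i : mpolyfun (fun s => torus_of s 0 i).
  have [p hp] : mpolyfun (fun s : 'cV[K]_3 => nth 0
      [:: 1; s (@Ordinal 3 0 isT) 0; s (@Ordinal 3 1 isT) 0; s (@Ordinal 3 2 isT) 0] i).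
    by elim/ord4P: i => /=; [exact: mpolyfunC|exact: mpolyfunX..].
  by exists p => s; rewrite hp mxE.
by apply: mpolyfunM; apply: mpolyfunM.
Qed.

Lemma line_square_twist_poly k : mpolyfun (fun s => line_square (torus_twist (torus_of s)) k).
Proof.
have h i : mpolyfun (fun s => torus_of s 0 i).
  have [p hp] : mpolyfun (fun s : 'cV[K]_3 => nth 0
      [:: 1; s (@Ordinal 3 0 isT) 0; s (@Ordinal 3 1 isT) 0; s (@Ordinal 3 2 isT) 0] i).
    by elim/ord4P: i => /=; [exact: mpolyfunC|exact: mpolyfunX..].
  by exists p => s; rewrite hp mxE.
have h' i : mpolyfun (fun s => torus_twist (torus_of s) 0 i).
  have [p hp] : mpolyfun (fun s => nth 0
    [:: torus_of s 0 (@Ordinal 4 1 isT) * torus_of s 0 (@Ordinal 4 3 isT);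
      torus_of s 0 (@Ordinal 4 1 isT) ^+ 2 * torus_of s 0 (@Ordinal 4 3 isT);
      torus_of s 0 (@Ordinal 4 2 isT) * torus_of s 0 (@Ordinal 4 3 isT); torus_of s 0 (@Ordinal 4 1 isT)] i).
    by elim/ord4P: i => //=; do ?apply: mpolyfunM.
  by exists p => s; rewrite hp [RHS]mxE.
by apply: mpolyfunM; apply: mpolyfunM.
Qed.

(** Both sides are polynomials in s that agree when the entries of s are values of a; the density of
    these values extends the relation to all s. *)
Lemma twist_line_square F (hF : is_birat (G13 K) F) s x k l : f0 = to_bir hF ->
  is_line x ->
  y_ (mev F (escale (line_square (torus_of s)) x)) k *
    (line_square (torus_twist (torus_of s)) l * y_ (mev F x) l) =
  y_ (mev F (escale (line_square (torus_of s)) x)) l *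
    (line_square (torus_twist (torus_of s)) k * y_ (mev F x) k).
Proof.
move=> ef lx; apply/eqP; rewrite -subr_eq0; apply/eqP; move: s.
have [_ ha na _] := hE; have [_ a1 _] := ha.
pose h s := y_ (mev F (escale (line_square (torus_of s)) x)) k *
    (line_square (torus_twist (torus_of s)) l * y_ (mev F x) l) -
  y_ (mev F (escale (line_square (torus_of s)) x)) l *
    (line_square (torus_twist (torus_of s)) k * y_ (mev F x) k).
rewrite -/(forall s, h s = 0); apply: (mpolyfun_dense (character_dense ha na)).
  have pF j : mpolyfun (fun s => y_ (mev F (escale (line_square (torus_of s)) x)) j).
    have [p hp] : mpolyfun (fun s => \sum_i E j i * pev (F i 0) (escale (line_square (torus_of s)) x)).
      apply: mpolyfun_sum => i; apply: mpolyfunM; first exact: mpolyfunC.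
      apply: mpolyfun_comp => m.
      have [p hp] : mpolyfun (fun s => \sum_q invmx E m q * (line_square (torus_of s) q * y_ x q)).
        apply: mpolyfun_sum => q; apply: mpolyfunM; first exact: mpolyfunC.
        by apply: mpolyfunM; [exact: line_square_poly|exact: mpolyfunC].
      by exists p => s; rewrite hp [RHS]mxE; apply: eq_bigr => q _; rewrite mxE.
    by exists p => s; rewrite hp /ecoord [RHS]mxE; apply: eq_bigr => i _; rewrite pev_mev.
  by apply: mpolyfunB; apply: mpolyfunM => //; apply: mpolyfunM; do ?exact: mpolyfunC; exact: line_square_twist_poly.
move=> s hs; have /choice[t ht] : forall i, exists z : K, z != 0 /\ s i 0 = a z.
  by move=> i; have [x0 nx0 ex] := hs i; exists x0.
have t0 i : t i != 0 by case: (ht i).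
have et i : s i 0 = a (t i) by case: (ht i).
(* A preimage of s under a, normalized to have first coordinate 1. *)
pose t' := torus_of (\col_i t i).
rewrite /h; have -> : torus_of s = map_mx a t'.
  by apply/rowP; elim/ord4P; rewrite !mxE /= ?a1 ?mxE // et.
apply/eqP; rewrite subr_eq0; apply/eqP; apply: (twist_square _ _ ef) => //.
  by elim/ord4P; rewrite !mxE /= ?oner_eq0 ?mxE.
by rewrite mxE.
Qed.

End TorusOrbits.

(** * The conjugated Klein involution against the 3-cycle *)

Section Contradiction.
Context (K : numClosedFieldType) (phi : PGL K 4 -> Bir (G13 K)).
Hypothesis phiM : forall g h, phi (g * h)%g = (phi g * phi h)%g.
Hypothesis phiAut : forall g, phi g \in Aut (G13 K).
Implicit Types (t : 'rV[K]_4) (k l : 'I_6) (x y : 'cV[K]_6).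
Variables (E : 'M[K]_6) (a : K -> K).
Hypothesis hE : eigenbasis phiAut E a.
Local Notation J := (pl_form K).
Local Notation y_ := (ecoord E).
Local Notation o4 k := (@Ordinal 4 k isT).
Local Notation o6 k := (@Ordinal 6 k isT).
Local Notation X := (G13 K).

(** On lines, [klein_perm] maps each pair {k, rev_ord k} to itself, whereas [cycle_perm] permutes
    the three pairs cyclically. *)
Definition klein_perm : 'S_4 := (tperm (o4 0) (o4 1) * tperm (o4 2) (o4 3))%g.
Definition cycle_perm : 'S_4 := (tperm (o4 1) (o4 2) * tperm (o4 1) (o4 3))%g.
Definition klein_lines k : 'I_6 := nth (o6 0) [:: o6 0; o6 4; o6 3; o6 2; o6 1; o6 5] k.
Definition cycle_lines k : 'I_6 := nth (o6 0) [:: o6 1; o6 2; o6 0; o6 5; o6 3; o6 4] k.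

Lemma klein_lines_rev k : klein_lines (rev_ord k) = rev_ord (klein_lines k).
Proof. by apply: val_inj; elim/ord6P: k. Qed.

Lemma cycle_lines_rev k : cycle_lines (rev_ord k) = rev_ord (cycle_lines k).
Proof. by apply: val_inj; elim/ord6P: k. Qed.

Lemma klein_lines_inj : injective klein_lines.
Proof. by apply: (@can_inj _ _ _ klein_lines); elim/ord6P. Qed.

Lemma klein_lines_or k : klein_lines k = k \/ klein_lines k = rev_ord k.
Proof.
by elim/ord6P: k; [left|right|right|right|right|left]; apply: val_inj.
Qed.

Lemma cycle_lines_inj : injective cycle_lines.
Proof. by apply: (@can_inj _ _ _ (cycle_lines \o cycle_lines)); elim/ord6P. Qed.

Lemma klein_on_line k i : on_line (klein_lines k) (klein_perm i) = on_line k i.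
Proof. by rewrite /klein_perm permM !permE; elim/ord4P: i; elim/ord6P: k. Qed.

Lemma cycle_on_line k i : on_line (cycle_lines k) (cycle_perm i) = on_line k i.
Proof. by rewrite /cycle_perm permM !permE; elim/ord4P: i; elim/ord6P: k. Qed.

Lemma line_product_rev k x : line_product E (rev_ord k) x = line_product E k x.
Proof.
rewrite /line_product rev_ordK -[in LHS](coord_form_tr E) mxE.
by congr (_ * _); rewrite mulrC.
Qed.

Lemma line_coord x : is_line x <-> x != 0 /\
  line_product E (o6 0) x + line_product E (o6 1) x + line_product E (o6 2) x = 0.
Proof.
have e : bilin J x x = 2%:R * (line_product E (o6 0) x + line_product E (o6 1) x + line_product E (o6 2) x).
  rewrite (bilin_coord hE) sum6.
  have e3 : line_product E (o6 3) x = line_product E (o6 2) x.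
    by rewrite -[RHS]line_product_rev; congr (line_product E _ x); apply: val_inj.
  have e4 : line_product E (o6 4) x = line_product E (o6 1) x.
    by rewrite -[RHS]line_product_rev; congr (line_product E _ x); apply: val_inj.
  have e5 : line_product E (o6 5) x = line_product E (o6 0) x.
    by rewrite -[RHS]line_product_rev; congr (line_product E _ x); apply: val_inj.
  transitivity (line_product E (o6 0) x + line_product E (o6 1) x + line_product E (o6 2) x
    + line_product E (o6 3) x + line_product E (o6 4) x + line_product E (o6 5) x) => //.
  by rewrite e3 e4 e5; ring.
split=> [/line_form[x0]|[x0 h]]; last by apply/line_form; rewrite e h mulr0.
by rewrite e => /eqP; rewrite mulf_eq0 pnatr_eq0 /= => /eqP.
Qed.

Lemma generic_poly d (p : {mpoly K[6]}) : p \is d.-homog -> (exists2 x, is_line x & pev p x != 0) ->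
  generic X (fun x => pev p x != 0).
Proof. by move=> hp [x lx nx]; exists d, p; split=> //; exists x. Qed.

Lemma ecoord_poly k : exists2 p : {mpoly K[6]}, p \is 1.-homog & forall x, pev p x = y_ x k.
Proof.
exists (lin_map E k 0); last by move=> x; rewrite pev_mev mev_lin.
rewrite mxE; apply: rpred_sum => j _; apply: rpredZ.
by rewrite dhomogX /= mdeg1.
Qed.

Lemma generic_ecoord k : generic X (fun x => y_ x k != 0).
Proof.
have [p hp ep] := ecoord_poly k.
apply: (genericS _ (generic_poly hp _)) => [x _|]; first by rewrite ep.
exists (invmx E *m delta_mx k 0); last by rewrite ep (coord_inv hE) mxE !eqxx oner_eq0.
have c l : y_ (invmx E *m delta_mx k 0) l = (l == k)%:R.
  by rewrite (coord_inv hE) mxE eqxx andbT.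
apply/line_coord; split.
  by apply/eqP => e; have /eqP := c k; rewrite e ecoord0 eqxx eq_sym oner_eq0.
rewrite /line_product !c; elim/ord6P: k {p hp ep c} => /=;
  by rewrite ?(mulr0, mul0r, addr0).
Qed.

Lemma generic_all_ecoord : generic X (fun x => forall k, y_ x k != 0).
Proof.
have g k := generic_ecoord k.
apply: genericS (genericI (genericI (genericI (g (o6 0)) (g (o6 1))) (genericI (g (o6 2)) (g (o6 3))))
  (genericI (g (o6 4)) (g (o6 5)))) => x _ [[[? ?] [? ?]] [? ?]].
by elim/ord6P.
Qed.

(** After normalization, the ratios r k between the coordinates of B z and z are inverse to each
    other at complementary indices; such ratio vectors come from torus elements by [solve_torus].
    The entries of s need not be values of a. *)
Lemma klein_orbit B z : linear_lift (phi (pgl_of (perm_mx klein_perm))) B ->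
  (forall k, y_ z k != 0) -> exists (s : 'cV[K]_3) (c : K), [/\ forall i, s i 0 != 0, c != 0 &
    B *m z = c *: escale E (line_square (torus_of s)) z].
Proof.
move=> lB nz; have [beta hb] := perm_coord phiM hE klein_on_line lB.
have [c c0 eB] := linear_lift_form lB.
have hbc k : beta k * beta (rev_ord k) = c.
  have := beta_product hE klein_lines_inj klein_lines_rev eB hb k.
  have -> : coord_form E (klein_lines k) (rev_ord (klein_lines k)) = coord_form E k (rev_ord k).
    have [->//|->] := klein_lines_or k.
    by rewrite rev_ordK -[in LHS]coord_form_tr mxE.
  by rewrite mulrC => /(mulIf (coord_form_neq0 hE k)).
have b0 k : beta k != 0 by apply: contra_neq c0 => e; rewrite -(hbc k) e mul0r.
(* Complementary coefficients of B multiply to c, so dividing by a square root of c makes the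
   products r k * r (rev_ord k) equal to 1. *)
pose L := sqrtC c; have L0 : L != 0 by rewrite sqrtC_eq0.
have LL : L * L = c by rewrite -expr2 sqrtCK.
pose r k := beta k * y_ z (klein_lines k) / (L * y_ z k).
have r0 k : r k != 0 by rewrite /r !mulf_neq0 ?invr_eq0 ?mulf_neq0.
have rr k : r k * r (rev_ord k) = 1.
  have e : y_ z (klein_lines k) * y_ z (klein_lines (rev_ord k)) = y_ z k * y_ z (rev_ord k).
    by rewrite klein_lines_rev; have [->|->] := klein_lines_or k; rewrite ?rev_ordK // mulrC.
  have nz' := nz (rev_ord k).
  transitivity ((beta k * beta (rev_ord k)) * (y_ z (klein_lines k) * y_ z (klein_lines (rev_ord k))) /
     ((L * L) * (y_ z k * y_ z (rev_ord k)))); first by rewrite /r; field; rewrite L0 !nz.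
  by rewrite hbc e LL mulfV // !mulf_neq0.
have [s0 [s1 [s2 [[n0 n1 n2] e0 e1 e2]]]] := solve_torus (r0 (o6 0)) (r0 (o6 1)) (r0 (o6 2)).
pose s : 'cV[K]_3 := \col_i nth 0 [:: s0; s1; s2] i.
exists s, (L / (s0 * s1 * s2)); split.
- by move=> [[|[|[|//]]] hi]; rewrite mxE.
- by rewrite !mulf_neq0 // invr_eq0 !mulf_neq0.
apply: (ecoord_inj hE) => k; rewrite ecoordZ (ecoord_escale hE) hb.
have -> : beta k * y_ z (klein_lines k) = L * r k * y_ z k.
  by rewrite /r; field; rewrite L0 nz.
rewrite mulrA; congr (_ * _); rewrite -mulrA; congr (_ * _).
have r5 : r (o6 5) = (r (o6 0))^-1.
  apply: (mulfI (r0 (o6 0))); rewrite mulfV // -[RHS](rr (o6 0)); congr (_ * r _); exact: val_inj.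
have r4 : r (o6 4) = (r (o6 1))^-1.
  apply: (mulfI (r0 (o6 1))); rewrite mulfV // -[RHS](rr (o6 1)); congr (_ * r _); exact: val_inj.
have r3 : r (o6 3) = (r (o6 2))^-1.
  apply: (mulfI (r0 (o6 2))); rewrite mulfV // -[RHS](rr (o6 2)); congr (_ * r _); exact: val_inj.
have f0 : r (o6 0) = s0 / (s1 * s2) by rewrite e0 mulfK // mulf_neq0.
have f1 : r (o6 1) = s1 / (s0 * s2) by rewrite e1 mulfK // mulf_neq0.
have f2 : r (o6 2) = s2 / (s0 * s1) by rewrite e2 mulfK // mulf_neq0.
rewrite /line_square !mxE; elim/ord6P: k => /=; rewrite ?r3 ?r4 ?r5 ?f0 ?f1 ?f2; field;
  by rewrite n0 n1 n2.
Qed.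

Variable f0 : Bir X.
Hypothesis twist : forall t, in_torus t -> t 0 0 = 1 ->
  (f0 * phi (diag_pgl t) = phi (diag_pgl (torus_twist t)) * f0)%g.

Definition keeps_products (g : Bir X) : Prop := exists G (hG : is_birat X G), g = to_bir hG /\
  generic X (fun x => mev G x != 0 /\ exists2 c, c != 0 &
    forall k, line_product E k (mev G x) = c * line_product E k x).

Lemma line_productZ c k x : line_product E k (c *: x) = c ^+ 2 * line_product E k x.
Proof. by rewrite /line_product !ecoordZ; ring. Qed.

(** The right-hand side is independent of k, so a torus scaling multiplies all line products by the
    same factor. *)
Lemma line_square_rev t k : line_square t k * line_square t (rev_ord k) = (\prod_i t 0 i) ^+ 2.
Proof. by rewrite prod4 /line_square; elim/ord6P: k; rewrite /=; ring. Qed.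

(** With z = f0^-1 x, the permutation moves z inside its torus orbit, and f0 turns this scaling of z
    into a twisted torus scaling of x. By [line_square_rev] all line products get one common
    factor. *)
Lemma klein_conj_keeps : keeps_products (f0 * phi (pgl_of (perm_mx klein_perm)) * f0^-1)%g.
Proof.
have [F [hF ef]] := birP f0; have [F' [hF' ef']] := birP f0^-1%g.
have [B lB] := linear_lift_ex phiAut (pgl_of (perm_mx klein_perm)).
have [hB eB] := lB; have hBb := lin_is_birat hB.
pose R := rat_comp (rat_comp F (lin_map B)) F'.
have hFF' := is_birat_comp hF hF'.
have hR : is_birat X R := is_birat_comp (is_birat_comp hF hBb) hF'.
have eR : (f0 * phi (pgl_of (perm_mx klein_perm)) * f0^-1)%g = to_bir hR.
  by rewrite ef' {1}ef eB [X in (X * _)%g]bir_mulE [LHS]bir_mulE; apply/to_birP => x _ _ _; apply: same_point_refl.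
exists R, hR; split => //.
have inv x : is_line x -> mev F (mev F' x) != 0 -> same_point (mev F (mev F' x)) x.
  move=> lx nx; have : Defs.rat_eq X (rat_comp F F') (@rat_id K 5).
    apply/(to_birP (is_birat_comp hF hF') (is_birat_id X)); rewrite -bir_mulE -ef -ef'; exact: mulgV.
  have x0 : x != 0 by case: lx.
  by case/(_ x lx); rewrite ?mev_comp ?mev_id // => c c0 ec; exists c.
apply: genericS (genericI (genericI (rat_generic hR.1) (rat_generic hFF'.1))
  (genericI (rat_generic hF'.1) (birat_pull hF' generic_all_ecoord))).
move=> x lx [[nR]]; rewrite mev_comp => nF [nF' nz]; split=> //.
have lz : is_line (mev F' x) by have [[_ _ h] _] := hF'; apply: h.
move: nR; rewrite /R !mev_comp mev_lin; set z := mev F' x in nF nz lz *.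
have [s [c [s0 c0 ->]]] := klein_orbit lB nz => nR.
set u := mev F (_ *: _) in nR *.
set w := escale E (line_square (torus_twist (torus_of s))) (mev F z).
have [d d0 eFz] := inv x lx nF; rewrite -/z in eFz.
have ts : in_torus (torus_of s) by elim/ord4P; rewrite mxE /= ?oner_eq0.
have tt := torus_twist_torus ts.
have sq0 k : line_square (torus_twist (torus_of s)) k != 0.
  by rewrite /line_square expf_neq0 // mulf_neq0.
have w0 : w != 0.
  have [k nk] : exists k, y_ (mev F z) k != 0.
    apply: contrapT => /forallNP h; case/eqP: nF; apply: (ecoord_inj hE) => k.
    by rewrite ecoord0; apply/eqP; apply: contrapT => /negP; apply: h.
  apply: contra_neq (mulf_neq0 (sq0 k) nk) => e.
  by rewrite -(ecoord_escale hE) -/w e ecoord0.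
have [b b0 eb] := mev_scale (escale E (line_square (torus_of s)) z) hF.1 c0.
have min k l : y_ u k * y_ w l = y_ u l * y_ w k.
  rewrite /u eb !ecoordZ !(ecoord_escale hE) -[LHS]mulrA -[RHS]mulrA; congr (_ * _).
  exact: (twist_line_square phiM hE twist s k l ef lz).
have [m nm] : exists m, y_ w m != 0.
  apply: contrapT => /forallNP h; case/eqP: w0; apply: (ecoord_inj hE) => k.
  by rewrite ecoord0; apply/eqP; apply: contrapT => /negP; apply: h.
pose q := y_ u m / y_ w m.
have eu : u = q *: w.
  apply: (ecoord_inj hE) => k; rewrite ecoordZ; apply: (mulIf nm).
  by rewrite min /q; field.
have q0 : q != 0 by apply: contra_neq nR => e; rewrite eu e scale0r.
exists (q ^+ 2 * (\prod_i torus_twist (torus_of s) 0 i) ^+ 2 * d^-1 ^+ 2).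
  have p0 : \prod_i torus_twist (torus_of s) 0 i != 0 by apply/prodf_neq0 => i _.
  exact: mulf_neq0 (mulf_neq0 (expf_neq0 2 q0) (expf_neq0 2 p0)) (expf_neq0 2 (invr_neq0 d0)).
move=> k; rewrite eu line_productZ -(line_square_rev _ k) {1}eFz line_productZ.
rewrite /line_product !(ecoord_escale hE); field; exact: d0.
Qed.

(** Up to common factors m keeps the three line products and c shifts them, so the relation makes a
    double shift proportional to the identity. For the products p0, p1, p2 this means p2 p1 = p0^2
    generically, while the quadric only imposes p0 + p1 + p2 = 0. *)
Theorem twist_contradiction :
  let m := (f0 * phi (pgl_of (perm_mx klein_perm)) * f0^-1)%g in
  let c := phi (pgl_of (perm_mx cycle_perm)) in
  (m * c = c^-1 * m)%g -> False.
Proof.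
move=> m c emc; have [R [hR [em gR]]] := klein_conj_keeps; rewrite -/m in em.
have [C lC] := linear_lift_ex phiAut (pgl_of (perm_mx cycle_perm)).
have [beta hb] := perm_coord phiM hE cycle_on_line lC.
have [n n0 eC] := linear_lift_form lC.
have lpC k x : line_product E k (C *m x) = n * line_product E (cycle_lines k) x.
  exact: (line_product_perm hE cycle_lines_inj cycle_lines_rev eC hb).
have uC := linear_lift_unit lC.
have [hC ec] := lC; have [hC' ec'] := linear_lift_inv lC.
have hCb := lin_is_birat hC; have hCb' := lin_is_birat hC'.
have e : Defs.rat_eq X (rat_comp R (lin_map C)) (rat_comp (lin_map (invmx C)) R).
  apply/(to_birP (is_birat_comp hR hCb) (is_birat_comp hCb' hR)).
  rewrite -!bir_mulE; have : to_bir hCb = c by rewrite /c ec; apply/to_birP => x _ _ _; apply: same_point_refl.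
  have : to_bir hCb' = c^-1%g by rewrite /c ec'; apply/to_birP => x _ _ _; apply: same_point_refl.
  by move=> -> ->; rewrite -em.
have key : generic X (fun x => line_product E (o6 2) x * line_product E (o6 1) x = line_product E (o6 0) x ^+ 2).
  apply: genericS (genericI gR (birat_pull hCb gR)) => x lx.
  rewrite !mev_lin => -[[nx [d d0 hd]] [nCx [d' d'0 hd']]].
  have n2 : invmx C *m mev R x != 0 by apply: unitmx_neq0; rewrite ?unitmx_inv.
  have := e x lx; rewrite !mev_comp !mev_lin => /(_ nCx n2)[p p0 ep].
  have E1 k : line_product E (cycle_lines k) (invmx C *m mev R x) = n^-1 * line_product E k (mev R x).
    apply: (mulfI n0); rewrite -lpC mulKVmx // mulrA mulfV ?mul1r //.
  pose q := n^-1 * d / (p ^+ 2 * d' * n).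
  have main k : line_product E (cycle_lines (cycle_lines k)) x = q * line_product E k x.
    have := E1 k; rewrite ep line_productZ hd' lpC hd => h.
    have nz : p ^+ 2 * d' * n != 0 by exact: mulf_neq0 (mulf_neq0 (expf_neq0 2 p0) d'0) n0.
    apply: (mulfI nz); transitivity (n^-1 * (d * line_product E k x)).
      by rewrite -h; ring.
    by rewrite /q; field; rewrite p0 d'0 n0.
  have c0 : cycle_lines (cycle_lines (o6 0)) = o6 2 by apply: val_inj.
  have c1 : cycle_lines (cycle_lines (o6 1)) = o6 0 by apply: val_inj.
  by have := main (o6 0); have := main (o6 1); rewrite c0 c1 => h1 h0; rewrite h0 h1; ring.
have neq : generic X (fun x => line_product E (o6 2) x * line_product E (o6 1) x - line_product E (o6 0) x ^+ 2 != 0).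
  have [p0 hp0 ep0] := ecoord_poly (o6 0); have [p1 hp1 ep1] := ecoord_poly (o6 1).
  have [p2 hp2 ep2] := ecoord_poly (o6 2); have [p3 hp3 ep3] := ecoord_poly (rev_ord (o6 2)).
  have [p4 hp4 ep4] := ecoord_poly (rev_ord (o6 1)); have [p5 hp5 ep5] := ecoord_poly (rev_ord (o6 0)).
  pose G k := coord_form E k (rev_ord k).
  pose P := (G (o6 2) *: (p2 * p3)) * (G (o6 1) *: (p1 * p4)) -
            (G (o6 0) *: (p0 * p5)) * (G (o6 0) *: (p0 * p5)).
  have pevZl z (u : {mpoly K[6]}) x : pev (z *: u) x = z * pev u x by rewrite /pev mevalZ.
  have eP x : pev P x = line_product E (o6 2) x * line_product E (o6 1) x - line_product E (o6 0) x ^+ 2.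
    rewrite /P {1}/pev mevalB -!/(pev _ _) !pevM !pevZl !pevM ep0 ep1 ep2 ep3 ep4 ep5.
    by rewrite /line_product expr2.
  have hP : P \is (4).-homog.
    have hm q (u v : {mpoly K[6]}) : u \is 1.-homog -> v \is 1.-homog ->
        (q *: (u * v)) \is 2.-homog.
      by move=> hu hv; apply: rpredZ; apply: (@dhomogM _ _ _ 1 _ 1).
    by apply: rpredB; apply: (@dhomogM _ _ _ 2 _ 2); apply: hm.
  apply: (genericS _ (generic_poly hP _)) => [x _|]; first by rewrite eP.
  pose g k := (coord_form E k (rev_ord k))^-1.
  (* Chosen to have line products 1, -1 and 0. *)
  pose y : 'cV[K]_6 := \col_k nth 0 [:: 1; 1; 0; 0; - g (o6 1); g (o6 0)] k.
  pose x := invmx E *m y.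
  have cx k : y_ x k = y k 0 by rewrite (coord_inv hE).
  have nz k := coord_form_neq0 hE k.
  have l0 : line_product E (o6 0) x = 1.
    by rewrite /line_product !cx [y (o6 0) 0]mxE [y (rev_ord _) 0]mxE /= mul1r /g mulfV.
  have l1 : line_product E (o6 1) x = -1.
    by rewrite /line_product !cx [y (o6 1) 0]mxE [y (rev_ord _) 0]mxE /= mul1r /g mulrN mulfV.
  have l2 : line_product E (o6 2) x = 0.
    by rewrite /line_product !cx [y (o6 2) 0]mxE /= mul0r mulr0.
  exists x; last by rewrite eP l0 l1 l2 mul0r sub0r oppr_eq0 expr1n oner_eq0.
  apply/line_coord; split; last by rewrite l0 l1 l2 subrr addr0.
  apply/eqP => ex; have /eqP := cx (o6 0).
  by rewrite ex ecoord0 mxE /= eq_sym oner_eq0.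
have [x _ [h nx]] := generic_ex (genericI key neq).
by move: nx; rewrite h subrr eqxx.
Qed.

End Contradiction.

(** * Monomial maps *)

Section Monomials.
Context (K : numClosedFieldType) (n : nat).
Local Notation P := (Pn K n).

Lemma bir_eq_torus F G (hF : is_birat P F) (hG : is_birat P G) :
  (forall t : 'cV[K]_n, torus t -> same_point (mev F (chart0 t)) (mev G (chart0 t))) ->
  to_bir hF = to_bir hG.
Proof.
move=> h; apply/to_birP; apply: rat_eq_generic hF.1 hG.1 _.
apply: genericS (generic_torus K n) => x _ [t ht e].
apply: same_point_trans (mev_same hF.1 e) _.
apply: same_point_trans (h t ht) _.
exact: mev_same hG.1 (same_point_sym e).
Qed.

(* The monomial map with exponents a, or 1 when a is not invertible. *)
Definition mon_of (a : 'M[int]_n) : Bir P :=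
  if @idP (a \in unitmx) is ReflectT ua then to_bir (mon_is_birat K ua) else 1%g.

Lemma mon_ofE a (ua : a \in unitmx) : mon_of a = to_bir (mon_is_birat K ua).
Proof.
rewrite /mon_of; case: {-}_ / idP => [h|//].
by apply/to_birP => x _ _ _; apply: same_point_refl.
Qed.

Lemma mon_ofM a b : a \in unitmx -> b \in unitmx -> mon_of (a *m b) = (mon_of a * mon_of b)%g.
Proof.
move=> ua ub; have uab : a *m b \in unitmx by rewrite unitmx_mul ua.
rewrite (mon_ofE ua) (mon_ofE ub) (mon_ofE uab) [RHS]bir_mulE.
apply: bir_eq_torus => t ht; rewrite mev_comp.
apply: same_point_trans (mon_map_same _ ht) _; rewrite -monomialM //.
apply: same_point_sym.
apply: same_point_trans (mev_same (mon_is_rat K a) (mon_map_same _ ht)) _.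
exact: mon_map_same (monomial_torus _ ht).
Qed.

Lemma pgl_bir_of (A : 'M[K]_n.+1) (uA : A \in unitmx) :
  pgl_bir (pgl_of A) = to_bir (lin_is_birat (Pn_stable uA)).
Proof. by rewrite (pgl_ofE uA) pgl_birE. Qed.

Lemma pgl_bir_mon (A : 'M[K]_n.+1) a : A \in unitmx -> a \in unitmx ->
  (forall t, torus t -> same_point (A *m chart0 t) (chart0 (monomial a t))) ->
  pgl_bir (pgl_of A) = mon_of a.
Proof.
move=> uA ua h; rewrite (pgl_bir_of uA) (mon_ofE ua); apply: bir_eq_torus => t ht.
rewrite mev_lin; apply: same_point_trans (h t ht) _.
exact: same_point_sym (mon_map_same a ht).
Qed.

Lemma mon_pgl_comm (A B : 'M[K]_n.+1) a : A \in unitmx -> B \in unitmx -> a \in unitmx ->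
  (forall t, torus t -> exists2 s, torus s & same_point (A *m chart0 t) (chart0 s) /\
     same_point (chart0 (monomial a s)) (B *m chart0 (monomial a t))) ->
  (mon_of a * pgl_bir (pgl_of A) = pgl_bir (pgl_of B) * mon_of a)%g.
Proof.
move=> uA uB ua h; rewrite (pgl_bir_of uA) (pgl_bir_of uB) (mon_ofE ua).
rewrite [LHS]bir_mulE [RHS]bir_mulE; apply: bir_eq_torus => t ht.
rewrite !mev_comp !mev_lin; have [s hs [e1 e2]] := h t ht.
apply: same_point_trans (mev_same (mon_is_rat K a) e1) _.
apply: same_point_trans (mon_map_same _ hs) _.
apply: same_point_trans e2 _; have [c c0 ->] := mon_map_same a ht.
by exists c^-1; rewrite ?invr_eq0 // -scalemxAr scalerA mulVf // scale1r.
Qed.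

End Monomials.

(** * Generation by elementary matrices *)

Section ElementaryMatrices.
Context (R : comUnitRingType).

Definition elem_mx n (i j : 'I_n) (c : R) : 'M[R]_n := 1%:M + c *: delta_mx i j.

Inductive elem_product n : 'M[R]_n -> Prop :=
| elem_product1 : elem_product 1%:M
| elem_productS i j c A : i != j -> elem_product A -> elem_product (elem_mx i j c *m A).

Lemma elem_productM n (A B : 'M[R]_n) :
  elem_product A -> elem_product B -> elem_product (A *m B).
Proof.
move=> hA hB; elim: hA => [|i j c A' ij _ IH]; first by rewrite mul1mx.
by rewrite -mulmxA; apply: elem_productS.
Qed.

Lemma elem_product_elem n (i j : 'I_n) c : i != j -> elem_product (elem_mx i j c).
Proof. by move=> ij; rewrite -[elem_mx _ _ _]mulmx1; apply: elem_productS ij (elem_product1 n). Qed.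

Lemma elem_mxD n (i j : 'I_n) c d : i != j -> elem_mx i j c *m elem_mx i j d = elem_mx i j (c + d).
Proof.
move=> ij; rewrite /elem_mx mulmxDl mul1mx mulmxDr mulmx1 -scalemxAl -scalemxAr.
by rewrite mul_delta_mx_0 1?eq_sym // !scaler0 addr0 scalerDl -addrA [d *: _ + _]addrC.
Qed.

Lemma det_elem_mx n (i j : 'I_n) c : i != j -> \det (elem_mx i j c) = 1.
Proof.
have trig (k l : 'I_n) : (l < k)%N -> \det (elem_mx k l c) = 1.
  move=> lk; rewrite det_trig; last first.
    apply/is_trig_mxP => p q pq; rewrite !mxE.
    have -> : (p == q) = false by apply: ltn_eqF.
    have -> : (p == k) && (q == l) = false.
      by apply/negP => /andP[/eqP e1 /eqP e2]; move: pq; rewrite e1 e2 ltnNge ltnW.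
    by rewrite mulr0 addr0.
  rewrite big1 // => p _; rewrite !mxE eqxx.
  have [->|] := eqVneq p k; last by rewrite mulr0 addr0.
  have [e|] := eqVneq k l; last by rewrite mulr0 addr0.
  by move: lk; rewrite e ltnn.
move=> ij; have [lt|gt|/val_inj e] := ltngtP j i; first exact: trig.
  rewrite -det_tr; have -> : (elem_mx i j c)^T = elem_mx j i c.
    by rewrite /elem_mx linearD /= linearZ /= trmx1 trmx_delta.
  exact: trig.
by rewrite e eqxx in ij.
Qed.

Lemma elem_product_det n (A : 'M[R]_n) : elem_product A -> \det A = 1.
Proof.
elim=> [|i j c B ij _ IH]; first exact: det1.
by rewrite det_mulmx det_elem_mx // IH mulr1.
Qed.

Lemma elem_product_cancel n (A B : 'M[R]_n) :
  elem_product B -> elem_product (B *m A) -> elem_product A.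
Proof.
move=> hB; elim: hB A => [|i j c B' ij _ IH] A; first by rewrite mul1mx.
rewrite -mulmxA => h; apply: IH.
have -> : B' *m A = elem_mx i j (- c) *m (elem_mx i j c *m (B' *m A)).
  by rewrite mulmxA elem_mxD // addNr /elem_mx scale0r addr0 mul1mx.
exact: elem_productS.
Qed.

Lemma elem_mx_col n (i j : 'I_n) c (v : 'cV[R]_n) k :
  (elem_mx i j c *m v) k 0 = v k 0 + (if k == i then c * v j 0 else 0).
Proof.
rewrite /elem_mx mulmxDl mul1mx -scalemxAl mxE; congr (_ + _); rewrite !mxE.
rewrite (bigD1 j) //= big1 ?addr0 => [|l lj].
  by rewrite mxE eqxx andbT; case: eqP => _; rewrite ?mul1r // mul0r mulr0.
by rewrite mxE (negbTE lj) andbF mul0r.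
Qed.

Variable norm : R -> nat.
Hypothesis euclid : forall a b, b != 0 -> exists q, (norm (a - q * b)%R < norm b)%N.

(** Euclid's algorithm, with the sum of the norms as measure, leaves one nonzero entry, and u v = 1
    makes it a unit. The presence of a second coordinate allows it to be turned into 1 in place
    0. *)
Lemma elem_column n (v : 'cV[R]_n.+2) (u : 'rV[R]_n.+2) : u *m v = 1%:M ->
  exists2 B, elem_product B & B *m v = delta_mx 0 0.
Proof.
have [m] := ubnP (\sum_i norm (v i 0%R))%N; elim: m v u => // m IHm v u sv uv.
have step i j c : i != j -> (norm (v i 0 + c * v j 0)%R < norm (v i 0%R))%N ->
    exists2 B, elem_product B & B *m v = delta_mx 0 0.
  move=> ij lt; pose v' := elem_mx i j c *m v.
  have [||B hB eB] := IHm v' (u *m elem_mx i j (- c)).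
  - rewrite -ltnS; apply: leq_trans sv; rewrite ltnS.
    rewrite (bigD1 i) //= [X in (_ < X)%N](bigD1 i) //= /v' elem_mx_col eqxx.
    rewrite (eq_bigr (fun k => norm (v k 0%R))) ?ltn_add2r // => k /negbTE ki.
    by rewrite elem_mx_col ki addr0.
  - by rewrite -mulmxA (mulmxA (elem_mx _ _ _)) elem_mxD // addNr /elem_mx scale0r addr0 mul1mx.
  exists (B *m elem_mx i j c); last by rewrite -mulmxA.
  by apply: elem_productM => //; apply: elem_product_elem.
have [[i [j [ij [ni nj]]]]|none] :=
    pselect (exists i j, i != j /\ (v i 0 != 0 /\ v j 0 != 0)).
  have [le|le] := leqP (norm (v j 0%R)) (norm (v i 0%R)).
    have [q hq] := euclid (v i 0) nj; apply: (step i j (- q) ij).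
    by rewrite mulNr; apply: leq_trans hq le.
  have [q hq] := euclid (v j 0) ni; apply: (step j i (- q)); first by rewrite eq_sym.
  by rewrite mulNr; apply: leq_trans hq (ltnW le).
have [i ni] : exists i, v i 0 != 0.
  apply: contrapT => /forallNP h; have v0 : v = 0.
    by apply/colP => i; rewrite mxE; apply/eqP; apply: contrapT => /negP; apply: h.
  move: uv; rewrite v0 mulmx0 => /matrixP/(_ 0 0)/eqP; rewrite !mxE eqxx.
  by rewrite eq_sym oner_eq0.
have v0 j : j != i -> v j 0 = 0.
  move=> ji; apply/eqP; apply: contrapT => /negP nj; apply: none.
  by exists j, i.
have ud : u 0 i * v i 0 = 1.
  have /matrixP/(_ 0 0) := uv; rewrite !mxE eqxx (bigD1 i) //= big1 ?addr0 //.
  by move=> j ji; rewrite v0 // mulr0.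
set d := v i 0 in ud ni; set e := u 0 i in ud.
have [i0|i0] := eqVneq i 0.
  have n10 : (1 : 'I_n.+2) != 0 by [].
  have n01 : (0 : 'I_n.+2) != 1 by [].
  (* With e d = 1 the first two entries go from (d, 0) to (d, 1), (1, 1) and (1, 0). *)
  exists (elem_mx 1 0 (- 1) *m (elem_mx 0 1 (1 - d) *m elem_mx 1 0 e)).
    by do !apply: elem_productM; apply: elem_product_elem.
  apply/colP => k; rewrite -!mulmxA !elem_mx_col [RHS]mxE ?eqxx ?(negbTE n10) ?(negbTE n01) ?andbT.
  have d0 : v 0 0 = d by rewrite /d i0.
  have d1 : v 1 0 = 0 by rewrite v0 // i0.
  have [->|k0] := eqVneq k 0; first by rewrite (negbTE n01) d0 d1 ud /= mulr1n; ring.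
  have [->|k1] := eqVneq k 1; first by rewrite d0 d1 ud /= mulr0n; ring.
  by rewrite v0 ?i0 //= !addr0.
(* Entry 0 becomes e d = 1, which then clears entry i. *)
exists (elem_mx i 0 (- d) *m elem_mx 0 i e).
  by apply: elem_productM; apply: elem_product_elem => //; rewrite eq_sym.
apply/colP => k; rewrite -!mulmxA !elem_mx_col [RHS]mxE ?eqxx ?(negbTE i0) ?andbT.
have d0 : v 0 0 = 0 by rewrite v0 // eq_sym.
have [->|k0] := eqVneq k 0.
  by rewrite eq_sym (negbTE i0) d0 -/d ud /= mulr1n; ring.
have [->|ki] := eqVneq k i; first by rewrite d0 -/d ud /= ?(negbTE i0) mulr0n; ring.
by rewrite v0 //= !addr0.
Qed.

Lemma elem_block n (A : 'M[R]_n) : elem_product A ->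
  elem_product (block_mx 1%:M 0 0 A : 'M_(1 + n)).
Proof.
elim=> [|i j c B ij _ IH]; first by rewrite -scalar_mx_block; apply: elem_product1.
have -> : block_mx 1%:M 0 0 (elem_mx i j c *m B) =
    elem_mx (rshift 1 i) (rshift 1 j) c *m block_mx 1%:M 0 0 B :> 'M_(1 + n).
  rewrite {2}/elem_mx.
  have -> : delta_mx (rshift 1 i) (rshift 1 j) = block_mx 0 0 0 (delta_mx i j) :> 'M[R]_(1 + n).
    apply/matrixP => k l; rewrite -[k]splitK -[l]splitK.
    by case: (split k) (split l) => k' [] l'; rewrite /= ?block_mxEul ?block_mxEur ?block_mxEdl ?block_mxEdr
      !mxE ?eq_lshift ?eq_rshift ?eq_lrshift ?eq_rlshift ?andbF.
  rewrite scale_block_mx (scalar_mx_block 1) add_block_mx !scaler0 !addr0.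
  by rewrite mulmx_block !mul1mx !mul0mx !mulmx0 !addr0 !add0r.
by apply: elem_productS => //; rewrite eq_rshift.
Qed.

Lemma elem_upper n (r : 'rV[R]_n) : elem_product (block_mx 1%:M r 0 1%:M : 'M_(1 + n)).
Proof.
pose U (r : 'rV[R]_n) : 'M[R]_(1 + n) := block_mx 1%:M r 0 1%:M.
have UD r1 r2 : U (r1 + r2) = U r2 *m U r1.
  by rewrite /U mulmx_block !mulmx1 !mul1mx !mul0mx !mulmx0 !addr0 !add0r addrC.
have U0 : U 0 = 1%:M by rewrite /U -scalar_mx_block.
rewrite -/(U r) [r]matrix_sum_delta big_ord1.
elim/big_ind: _ => [|r1 r2 h1 h2|j _]; first by rewrite U0; apply: elem_product1.
  by rewrite UD; apply: elem_productM.
have -> : U (r 0 j *: delta_mx 0 j) = elem_mx (lshift n 0) (rshift 1 j) (r 0 j).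
  rewrite /elem_mx (scalar_mx_block 1).
  have -> : delta_mx (lshift n 0) (rshift 1 j) = block_mx 0 (delta_mx 0 j) 0 0 :> 'M[R]_(1 + n).
    apply/matrixP => k l; rewrite -[k]splitK -[l]splitK.
    by case: (split k) (split l) => k' [] l'; rewrite /= ?block_mxEul ?block_mxEur ?block_mxEdl ?block_mxEdr
      !mxE ?eq_lshift ?eq_rshift ?eq_lrshift ?eq_rlshift ?andbF.
  by rewrite scale_block_mx add_block_mx !scaler0 !addr0 add0r.
by apply: elem_product_elem; rewrite eq_lrshift.
Qed.

(** The first column is reduced to e_0 by [elem_column]; a shear then splits off the first row, and
    the remaining block has determinant 1. *)
Theorem elem_product_det1 n (A : 'M[R]_n) : \det A = 1 -> elem_product A.
Proof.
elim: n A => [|[|n] IHn] A dA.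
- have -> : A = 1%:M by apply/matrixP => -[].
  exact: elem_product1.
- have -> : A = 1%:M by rewrite [A]mx11_scalar -det_mx11 dA.
  exact: elem_product1.
have uA : A \in unitmx by rewrite unitmxE dA unitr1.
have [|B hB eB] := @elem_column n (col 0 A) (row 0 (invmx A)).
  by rewrite colE mulmxA -row_mul mulVmx // -colE; apply/matrixP => i j; rewrite !mxE !ord1.
apply: (elem_product_cancel hB).
have eB' : col 0 (B *m A) = delta_mx 0 0 by rewrite colE -mulmxA -colE.
have detA' : \det (B *m A) = 1 by rewrite det_mulmx (elem_product_det hB) dA mulr1.
move: (B *m A) eB' detA' => A' eB' detA'.
have eA' : A' = block_mx 1%:M (ursubmx (A' : 'M_(1 + n.+1))) 0 (drsubmx (A' : 'M_(1 + n.+1))).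
  have c0 k : A' k 0 = (k == 0)%:R.
    by have /colP/(_ k) := eB'; rewrite mxE => ->; rewrite mxE andbT.
  have l0 : lshift n.+1 (0 : 'I_1) = 0 by apply: val_inj.
  have e1 : ulsubmx (A' : 'M_(1 + n.+1)) = 1%:M.
    by apply/matrixP => i j; rewrite !ord1 !mxE l0 -[LHS]/(A' 0 0) c0.
  have e2 : dlsubmx (A' : 'M_(1 + n.+1)) = 0.
    apply/matrixP => i j; rewrite ord1 [RHS]mxE [LHS]mxE [LHS]mxE l0.
    by rewrite -[LHS]/(A' (rshift 1 i) 0) c0.
  by rewrite -[LHS](@submxK _ 1 n.+1 1 n.+1) e1 e2.
set A2 := drsubmx _ in eA'.
have -> : A' = (block_mx 1%:M 0 0 A2 : 'M_(1 + n.+1)) *m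
    (block_mx 1%:M (ursubmx (A' : 'M_(1 + n.+1))) 0 1%:M : 'M_(1 + n.+1)).
  by rewrite mulmx_block !mul1mx !mul0mx !mulmx0 !mulmx1 !addr0 !add0r.
apply: elem_productM (elem_upper _); apply: elem_block; apply: IHn.
by move: detA'; rewrite eA' (@det_ublock _ 1) det1 mul1r.
Qed.

End ElementaryMatrices.

(** The norm is 1 off 0, so one theorem covers both SL_n(K) and SL_n(Z). *)
Lemma field_euclid (K : fieldType) (a b : K) : b != 0 ->
  exists q, (nat_of_bool (a - q * b != 0)%R < nat_of_bool (b != 0)%R)%N.
Proof. by move=> b0; exists (a / b); rewrite divfK // subrr eqxx b0. Qed.

Lemma int_euclid (a b : int) : b != 0 -> exists q, (absz (a - q * b)%R < absz b)%N.
Proof.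
move=> b0; exists (a %/ b)%Z; rewrite -[X in (absz X < _)%N]/(a %% b)%Z.
by rewrite -ltz_nat gez0_abs ?modz_ge0 // abszE ltz_mod.
Qed.

(** * From one sign matrix to all of PGL_4, and from S_3 to GL_3(Z) *)

Section PGLTriviality.
Context (K : numClosedFieldType) (G : groupType) (phi : PGL K 4 -> G).
Hypothesis phiM : forall g h, phi (g * h)%g = (phi g * phi h)%g.
Local Notation E i j c := (pgl_of (elem_mx (i : 'I_4) j (c : K))).

Definition sign_row (i : 'I_4) : 'rV[K]_4 := \row_j (if j == i then -1 else 1).

Hypothesis phi_sign : phi (diag_pgl (sign_row 0)) = 1%g.

Lemma elem_mx_unit (R : comUnitRingType) n (i j : 'I_n) (c : R) :
  i != j -> elem_mx i j c \in unitmx.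
Proof. by move=> ij; rewrite unitmxE det_elem_mx // unitr1. Qed.

Lemma elem_mx0 (R : comUnitRingType) n (i j : 'I_n) : elem_mx i j 0 = 1%:M :> 'M[R]_n.
Proof. by rewrite /elem_mx scale0r addr0. Qed.

Lemma sign_torus i : in_torus (sign_row i).
Proof. by move=> j; rewrite mxE; case: ifP; rewrite ?oppr_eq0 oner_eq0. Qed.

Lemma pgl_sign_trivial i : phi (diag_pgl (sign_row i)) = 1%g.
Proof.
have -> : sign_row i = torus_perm (tperm 0 i) (sign_row 0).
  apply/rowP => j; rewrite !mxE; congr (if _ then _ else _).
  by rewrite -(inj_eq (@perm_inj _ (tperm 0 i))) tpermR.
rewrite diag_pgl_perm; last exact: sign_torus.
rewrite !phiM phi_sign mulg1 -phiM mulgV; exact: (morph_g1 phiM).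
Qed.

(* Conjugation by a sign matrix inverts E i j x, so E i j (2 x) is killed. *)
Lemma pgl_elem_trivial i j c : i != j -> phi (E i j c) = 1%g.
Proof.
move=> ij; have ED x y : phi (E i j (x + y)) = (phi (E i j x) * phi (E i j y))%g.
  by rewrite -phiM -pgl_ofM ?elem_mx_unit // elem_mxD.
have EN x : phi (E i j (- x)) = phi (E i j x).
  have e : (diag_pgl (sign_row i) * E i j x = E i j (- x) * diag_pgl (sign_row i))%g.
    rewrite /diag_pgl -!pgl_ofM ?elem_mx_unit ?diag_unit //; try exact: sign_torus.
    congr pgl_of; apply/matrixP => k l; rewrite mul_diag_mx mul_mx_diag !mxE.
    case: (eqVneq k i) => [->|ki] /=; last first.
      rewrite !mulr0 !addr0 mul1r; have [<-|_] := eqVneq k l; last by rewrite mul0r.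
      by rewrite (negbTE ki) mulr1.
    case: (eqVneq l j) => [->|lj] /=.
      by rewrite (negbTE ij) [j == i]eq_sym (negbTE ij) ?mulr1n ?mulr0n; ring.
    by rewrite [i == l]eq_sym; case: (eqVneq l i) => _; rewrite /= ?mulr1n ?mulr0n; ring.
  by have := congr1 phi e; rewrite !phiM pgl_sign_trivial mul1g mulg1.
by rewrite [c]splitr ED -{1}EN -ED addNr elem_mx0 pgl_of1 (morph_g1 phiM).
Qed.

Theorem pgl_morphism_trivial g : phi g = 1%g.
Proof.
(* Dividing by a fourth root of the determinant represents g in SL_4. *)
have [A uA ->] := pgl_of_surj g; pose z := 4.-root (\det A).
have dA : \det A != 0 by rewrite -unitfE -unitmxE.
have z0 : z != 0 by rewrite rootC_eq0.
rewrite -(@pgl_ofZ _ _ z^-1) ?invr_eq0 //.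
have : \det (z^-1 *: A) = 1 by rewrite detZ exprVn rootCK // mulVf.
move=> /(elem_product_det1 (@field_euclid K)).
elim=> [|i j c B ij hB IH]; first by rewrite pgl_of1 (morph_g1 phiM).
have uB : B \in unitmx by rewrite unitmxE (elem_product_det hB) unitr1.
by rewrite pgl_ofM ?elem_mx_unit // phiM pgl_elem_trivial // IH mulg1.
Qed.

End PGLTriviality.

Section GLTriviality.
Context (G : groupType) (om : 'M[int]_3 -> G).
Hypothesis omM : forall a b, a \in unitmx -> b \in unitmx -> om (a *m b) = (om a * om b)%g.
Hypothesis om_perm : forall s : 'S_3, om (perm_mx s) = 1%g.

Lemma om_one : om 1%:M = 1%g.
Proof. by apply: (mulgI (om 1%:M)); rewrite -omM ?unitmx1 // mul1mx mulg1. Qed.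

(** Elementary matrices conjugate under killed permutation matrices have the same image. *)
Lemma gl3_elem_perm (s : 'S_3) i j c : i != j ->
  om (elem_mx (s i) (s j) c) = om (elem_mx i j c).
Proof.
move=> ij; have sij : s i != s j by rewrite (inj_eq perm_inj).
have e : perm_mx s *m elem_mx (s i) (s j) c = elem_mx i j c *m perm_mx s.
  rewrite /elem_mx mulmxDr mulmxDl mulmx1 mul1mx -scalemxAr -scalemxAl; congr (_ + _ *: _).
  apply/matrixP => k l; rewrite -row_permE -[s in _ *m perm_mx s]invgK -col_permE !mxE.
  rewrite (inj_eq perm_inj); congr ((_ && _)%:R).
  by rewrite -[RHS](inj_eq (@perm_inj _ s)) permKV.
have := congr1 om e.
by rewrite !omM ?elem_mx_unit ?unitmx_perm // !om_perm mul1g mulg1.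
Qed.

(* elem_mx i j c is the commutator of elem_mx i k c and elem_mx k j 1, and the
   latter is conjugate by a permutation to elem_mx i k 1, which commutes with
   elem_mx i k c. *)
Lemma gl3_elem_trivial i j c : i != j -> om (elem_mx i j c) = 1%g.
Proof.
move=> ij; have [k [ki kj]] : exists k : 'I_3, k != i /\ k != j.
  have [k] : exists k, k \in ~: [set i; j].
    by apply/set0Pn; rewrite -card_gt0 cardsCs setCK cards2 card_ord; case: (i == j).
  by rewrite !inE negb_or => /andP[]; exists k.
have ik : i != k by rewrite eq_sym.
(* This permutation sends i to k and k to j. *)
pose s := (tperm i k * tperm i j)%g.
have e1 : om (elem_mx k j 1) = om (elem_mx i k 1).
  rewrite -[RHS](gl3_elem_perm s) //; congr (om (elem_mx _ _ _)).
    by rewrite permM tpermL tpermD // eq_sym.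
  by rewrite permM tpermR tpermL.
have e2 : elem_mx i k c *m elem_mx k j 1 = elem_mx i j c *m elem_mx k j 1 *m elem_mx i k c.
  have eA : elem_mx i k c *m elem_mx k j 1 = 1%:M + c *: delta_mx i k + delta_mx k j + c *: delta_mx i j.
    rewrite /elem_mx scale1r mulmxDr mulmx1 mulmxDl mul1mx -scalemxAl mul_delta_mx.
    by rewrite addrA.
  rewrite eA /elem_mx scale1r !(mulmxDl, mulmxDr) !mulmx1 !mul1mx -!scalemxAl -!scalemxAr.
  rewrite -!mulmxA !mul_delta_mx_0 1?eq_sym // !(mulmx0, scaler0, addr0).
  by rewrite -!addrA; congr (_ + _); rewrite addrC -addrA.
have := congr1 om e2; rewrite !omM ?elem_mx_unit ?unitmx_mul ?elem_mx_unit // e1.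
have -> : (om (elem_mx i k c) * om (elem_mx i k 1) = om (elem_mx i k 1) * om (elem_mx i k c))%g.
  by rewrite -!omM ?elem_mx_unit // !elem_mxD // addrC.
by move=> /mulIg e; apply: (mulIg (om (elem_mx i k 1))); rewrite mul1g -e.
Qed.

(** For determinant -1 a transposition matrix, which is killed too, reduces to determinant 1. *)
Theorem gl3_morphism_trivial a : a \in unitmx -> om a = 1%g.
Proof.
have det1 b : \det b = 1 -> om b = 1%g.
  move=> db; elim: (elem_product_det1 int_euclid db) => [|i j c B ij hB IH].
    exact: om_one.
  have uB : B \in unitmx by rewrite unitmxE (elem_product_det hB) unitr1.
  by rewrite omM ?elem_mx_unit // gl3_elem_trivial // IH mulg1.
move=> ua; have := ua; rewrite unitmxE => /orP[/eqP|/eqP da]; first exact: det1.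
pose s : 'S_3 := tperm 0 1.
have : om (perm_mx s *m a) = 1%g by apply: det1; rewrite det_mulmx det_perm odd_tperm da.
by rewrite omM ?unitmx_perm // om_perm mul1g.
Qed.

End GLTriviality.

(** * Relations between linear and monomial maps *)

Section MonomialMatrices.
Context (K : numClosedFieldType).
Implicit Types t : 'cV[K]_3.

Lemma chart0_0 n (t : 'cV[K]_n) : (chart0 t : 'cV_n.+1) 0 0 = 1.
Proof.
have e : (0 : 'I_n.+1) = @lshift 1 n 0 by apply: val_inj.
by rewrite e [LHS]col_mxEu mxE.
Qed.

Lemma chart0_lift n (t : 'cV[K]_n) j : (chart0 t : 'cV_n.+1) (lift 0 j) 0 = t j 0.
Proof.
have e : lift (0 : 'I_n.+1) j = @rshift 1 n j by apply: val_inj.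
by rewrite e [LHS]col_mxEd.
Qed.

Lemma perm_chart0 n (s : 'S_n) (t : 'cV[K]_n) :
  perm_mx (lift_perm 0 0 s) *m (chart0 t : 'cV_n.+1) = chart0 (monomial (perm_mx s) t).
Proof.
apply/colP => i; rewrite -row_permE [LHS]mxE.
case: (unliftP 0 i) => [j|] ->; last by rewrite lift_perm_id !chart0_0.
rewrite lift_perm_lift !chart0_lift mxE (bigD1 (s j)) //= big1 ?mulr1 => [|k kj].
  by rewrite !mxE eqxx.
by rewrite !mxE eq_sym (negbTE kj) expr0z.
Qed.

Lemma pgl_bir_perm n (s : 'S_n) :
  pgl_bir (pgl_of (perm_mx (lift_perm 0 0 s))) = mon_of K (perm_mx s).
Proof.
apply: pgl_bir_mon; rewrite ?unitmx_perm // => t _.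
by rewrite perm_chart0; apply: same_point_refl.
Qed.

Definition mx3 (R : nzRingType) (s : seq (seq R)) : 'M[R]_3 := \matrix_(i, j) nth 0 (nth [::] s i) j.

Lemma ord3P (P : 'I_3 -> Prop) :
  P (@Ordinal 3 0 isT) -> P (@Ordinal 3 1 isT) -> P (@Ordinal 3 2 isT) -> forall k, P k.
Proof.
move=> p0 p1 p2 [m lt_m].
by case: m lt_m => [|[|[|//]]] lt_m; rewrite (bool_irrelevance lt_m isT).
Qed.

Lemma chart0E t i : (chart0 t : 'cV_4) i 0 = nth 0 [:: 1; t (@Ordinal 3 0 isT) 0;
  t (@Ordinal 3 1 isT) 0; t (@Ordinal 3 2 isT) 0] i.
Proof.
have h j : (chart0 t : 'cV_4) (lift 0 j) 0 = t j 0 := chart0_lift t j.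
elim/ord4P: i => /=.
- by rewrite -[RHS](chart0_0 t); congr (chart0 t _ _); apply: val_inj.
- by rewrite -h; congr (chart0 t _ _); apply: val_inj.
- by rewrite -h; congr (chart0 t _ _); apply: val_inj.
- by rewrite -h; congr (chart0 t _ _); apply: val_inj.
Qed.

(** [klein_exp] is the coordinate permutation (01)(23) in the chart x_0 = 1. The shear conjugates it
    to [klein_shear], minus a transposition matrix, and conjugation by the latter inverts the
    3-cycle. *)
Definition shear_exp : 'M[int]_3 := mx3 [:: [:: 1; 0; 0]; [:: -1; 1; 0]; [:: 0; 0; -1]].
Definition klein_exp : 'M[int]_3 := mx3 [:: [:: -1; 0; 0]; [:: -1; 0; 1]; [:: -1; 1; 0]].
Definition cycle_exp : 'M[int]_3 := mx3 [:: [:: 0; 1; 0]; [:: 0; 0; 1]; [:: 1; 0; 0]].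
Definition klein_shear : 'M[int]_3 := mx3 [:: [:: -1; 0; 0]; [:: 0; 0; -1]; [:: 0; -1; 0]].

Lemma mx3_mul (R : nzRingType) (s s' : seq (seq R)) i j :
  (mx3 s *m mx3 s') i j = mx3 s i (@Ordinal 3 0 isT) * mx3 s' (@Ordinal 3 0 isT) j +
    mx3 s i (@Ordinal 3 1 isT) * mx3 s' (@Ordinal 3 1 isT) j +
    mx3 s i (@Ordinal 3 2 isT) * mx3 s' (@Ordinal 3 2 isT) j.
Proof.
rewrite mxE !big_ord_recr big_ord0 /= add0r.
by congr (mx3 s i _ * mx3 s' _ j + mx3 s i _ * mx3 s' _ j + mx3 s i _ * mx3 s' _ j); apply: val_inj.
Qed.

Ltac mx3_calc := apply/matrixP; elim/ord3P; elim/ord3P; rewrite ?mx3_mul !mxE //=.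

Lemma shear_unit : shear_exp \in unitmx.
Proof.
by apply: (proj1 (mulmx1_unit (_ : _ *m mx3 [:: [:: 1; 0; 0]; [:: 1; 1; 0]; [:: 0; 0; -1]] = 1%:M))); mx3_calc.
Qed.

Lemma klein_unit : klein_exp \in unitmx.
Proof. by apply: (proj1 (mulmx1_unit (_ : _ *m klein_exp = 1%:M))); mx3_calc. Qed.

Lemma klein_shear_unit : klein_shear \in unitmx.
Proof. by apply: (proj1 (mulmx1_unit (_ : _ *m klein_shear = 1%:M))); mx3_calc. Qed.

Lemma cycle_unit : cycle_exp \in unitmx.
Proof.
by apply: (proj1 (mulmx1_unit (_ : _ *m mx3 [:: [:: 0; 0; 1]; [:: 1; 0; 0]; [:: 0; 1; 0]] = 1%:M))); mx3_calc.
Qed.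

Lemma klein_shear_conj : shear_exp *m klein_exp = klein_shear *m shear_exp.
Proof. by mx3_calc. Qed.

Lemma cycle_klein_shear : klein_shear *m cycle_exp = mx3 [:: [:: 0; -1; 0]; [:: -1; 0; 0]; [:: 0; 0; -1]].
Proof. by mx3_calc. Qed.

Lemma cycle_klein_shear_cycle : cycle_exp *m (klein_shear *m cycle_exp) = klein_shear.
Proof. by rewrite cycle_klein_shear; mx3_calc. Qed.

Lemma monomialE (a : 'M[int]_3) t i : monomial a t i 0 =
  t (@Ordinal 3 0 isT) 0 ^ a i (@Ordinal 3 0 isT) * t (@Ordinal 3 1 isT) 0 ^ a i (@Ordinal 3 1 isT) *
  t (@Ordinal 3 2 isT) 0 ^ a i (@Ordinal 3 2 isT).
Proof.
rewrite mxE !big_ord_recr big_ord0 /= mul1r.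
by congr (t _ _ ^ a i _ * t _ _ ^ a i _ * t _ _ ^ a i _); apply: val_inj.
Qed.

Lemma pgl_bir_klein : pgl_bir (pgl_of (perm_mx klein_perm)) = mon_of K klein_exp.
Proof.
apply: pgl_bir_mon; rewrite ?unitmx_perm ?klein_unit // => t ht.
have n0 := ht (@Ordinal 3 0 isT).
exists (t (@Ordinal 3 0 isT) 0)^-1; first by rewrite invr_eq0.
apply/colP => i; rewrite -row_permE [RHS]mxE [X in _ * X]mxE !chart0E /klein_perm permM !permE.
by elim/ord4P: i => /=; rewrite ?monomialE ?mxE //= ?expr0z ?expr1z ?mul1r ?mulr1 ?mulVf.
Qed.

Lemma pgl_bir_cycle : pgl_bir (pgl_of (perm_mx cycle_perm)) = mon_of K cycle_exp.
Proof.
apply: pgl_bir_mon; rewrite ?unitmx_perm ?cycle_unit // => t ht.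
exists 1; first exact: oner_neq0.
apply/colP => i; rewrite scale1r -row_permE [RHS]mxE !chart0E /cycle_perm permM !permE.
by elim/ord4P: i => /=; rewrite ?monomialE ?mxE //= ?expr0z ?expr1z ?mul1r ?mulr1.
Qed.

Lemma shear_twist (t : 'rV[K]_4) : in_torus t -> t 0 0 = 1 ->
  (mon_of K shear_exp * pgl_bir (diag_pgl t) =
   pgl_bir (diag_pgl (torus_twist t)) * mon_of K shear_exp)%g.
Proof.
move=> ht t1; apply: mon_pgl_comm; rewrite ?diag_unit ?shear_unit //; first exact: torus_twist_torus.
move=> u hu; exists (\col_i (t 0 (lift 0 i) * u i 0)).
  by move=> i; rewrite mxE mulf_neq0.
split.
  exists 1; first exact: oner_neq0.
  rewrite scale1r; apply/colP => i; rewrite mul_diag_mx [RHS]mxE.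
  by case: (unliftP 0 i) => [j|] ->; rewrite ?chart0_0 ?chart0_lift ?t1 ?mulr1 // mxE.
have n1 := ht (lift 0 (@Ordinal 3 0 isT)); have n2 := ht (lift 0 (@Ordinal 3 2 isT)).
(* The scalar t_1 t_3 by which [torus_twist] clears denominators. *)
exists (t 0 (lift 0 (@Ordinal 3 0 isT)) * t 0 (lift 0 (@Ordinal 3 2 isT))); first by rewrite mulf_neq0.
apply/colP => i; rewrite mul_diag_mx [LHS]mxE [RHS]mxE !chart0E [X in X * _ = _]mxE.
have e1 : lift 0 (@Ordinal 3 0 isT) = @Ordinal 4 1 isT by apply: val_inj.
have e2 : lift 0 (@Ordinal 3 1 isT) = @Ordinal 4 2 isT by apply: val_inj.
have e3 : lift 0 (@Ordinal 3 2 isT) = @Ordinal 4 3 isT by apply: val_inj.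
have nz := (ht (@Ordinal 4 1 isT), ht (@Ordinal 4 3 isT), hu (@Ordinal 3 0 isT), hu (@Ordinal 3 2 isT)).
elim/ord4P: i => /=; rewrite ?monomialE ?mxE //= ?expr0z ?expr1z ?mul1r ?mulr1 ?e1 ?e2 ?e3.
- by [].
- by ring.
- by rewrite !exprN1; field; rewrite !nz.
- by rewrite !exprN1; field; rewrite !nz.
Qed.

End MonomialMatrices.

(** * Homomorphisms on the group generated by PGL_4 and W_3 *)

Section Extension.
Context (K : numClosedFieldType).
Local Notation gens := [predU pgl_sub K 3 & W K 3].
Variable Phi : gen_group gens -> Bir (G13 K).
Hypothesis PhiM : forall f g, Phi (f * g)%g = (Phi f * Phi g)%g.
Hypothesis PhiAut : forall f, gen_val f \in pgl_sub K 3 -> Phi f \in Aut (G13 K).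

Lemma sub_generated (G : groupType) (A : {pred G}) x : x \in A -> generated A x.
Proof. by move=> xA; apply/asboolP => S _; apply. Qed.

Lemma pgl_gen (g : PGL K 4) : generated gens (pgl_bir g).
Proof. by apply: sub_generated; rewrite inE; apply/orP; left; apply/asboolP; exists g. Qed.

Lemma mon_gen a : generated gens (mon_of K a).
Proof.
have [ua|ua] := boolP (a \in unitmx).
  by rewrite (mon_ofE K ua); apply: sub_generated; rewrite inE mon_map_W orbT.
by rewrite /mon_of; case: {-}_ / idP => [h|_]; [rewrite h in ua | exact: (generated_closed _).1].
Qed.

Definition pgl_image g : Bir (G13 K) := Phi (GenGroup (pgl_gen g)).
Definition mon_image a : Bir (G13 K) := Phi (GenGroup (mon_gen a)).

Lemma pgl_imageM g h : pgl_image (g * h)%g = (pgl_image g * pgl_image h)%g.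
Proof. by rewrite -PhiM; congr (Phi _); apply: val_inj => /=; rewrite pgl_birM. Qed.

Lemma mon_imageM a b : a \in unitmx -> b \in unitmx ->
  mon_image (a *m b) = (mon_image a * mon_image b)%g.
Proof. by move=> ua ub; rewrite -PhiM; congr (Phi _); apply: val_inj => /=; rewrite mon_ofM. Qed.

Lemma pgl_image_Aut g : pgl_image g \in Aut (G13 K).
Proof. by apply: PhiAut; apply/asboolP; exists g. Qed.

Lemma pgl_mon_image g a : pgl_bir g = mon_of K a -> pgl_image g = mon_image a.
Proof. by move=> e; congr (Phi _); apply: val_inj. Qed.

Lemma image_twist t : in_torus t -> t 0 0 = 1 ->
  (mon_image shear_exp * pgl_image (diag_pgl t) =
   pgl_image (diag_pgl (torus_twist t)) * mon_image shear_exp)%g.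
Proof.
move=> ht t1; rewrite -!PhiM; congr (Phi _); apply: val_inj => /=.
exact: shear_twist.
Qed.

(** An element of order 4 suits [eigenbasis_ex], and since N t lifts the image of t^2, a trivial N
    here kills the sign matrix. *)
Definition order4_row : 'rV[K]_4 := \row_i (if i == 0 then 'i else 1).

Lemma order4_torus : in_torus order4_row.
Proof. by move=> i; rewrite mxE; case: ifP; rewrite ?neq0Ci ?oner_eq0. Qed.

Lemma order4_sq : torus_mul order4_row order4_row = sign_row K 0.
Proof. by apply/rowP => i; rewrite !mxE; case: ifP; rewrite ?mulr1 // -expr2 sqrCi. Qed.

Lemma order4_diag_sq : diag_sq pgl_image_Aut order4_row = 1%:M.
Proof.
apply: contrapT => /eqP N1.
have [|E [a hE]] := eigenbasis_ex pgl_imageM order4_torus _ N1.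
  apply/rowP => i; rewrite order4_sq !mxE.
  by case: ifP; rewrite ?mulrNN mulr1.
apply: (twist_contradiction pgl_imageM hE image_twist).
rewrite (pgl_mon_image (pgl_bir_klein K)) (pgl_mon_image (pgl_bir_cycle K)).
have us := shear_unit; have uk := klein_unit; have uc := cycle_unit.
have um := klein_shear_unit.
rewrite -mon_imageM // klein_shear_conj mon_imageM // mulgK.
apply: (mulgI (mon_image cycle_exp)); rewrite [RHS]mulgA mulgV mul1g.
by rewrite -!mon_imageM ?unitmx_mul ?um // cycle_klein_shear_cycle.
Qed.

Lemma pgl_image_trivial g : pgl_image g = 1%g.
Proof.
apply: (pgl_morphism_trivial pgl_imageM); rewrite -order4_sq (phi_diagM pgl_imageM order4_torus order4_torus).
have := square_lift_lift (diag_sqP pgl_image_Aut order4_row); rewrite order4_diag_sq.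
case=> h1 ->; have [h2 ->] := linear_lift1 K; apply/to_birP; exact: rat_eq_refl.
Qed.

Lemma mon_image_trivial a : a \in unitmx -> mon_image a = 1%g.
Proof.
apply: (gl3_morphism_trivial mon_imageM) => s.
by rewrite -(pgl_mon_image (pgl_bir_perm K s)) pgl_image_trivial.
Qed.

Lemma W_mon_of f : f \in W K 3 -> exists2 a, a \in unitmx & f = mon_of K a.
Proof.
move/asboolP => [a ua h]; exists a => //; have [F [hF ef]] := birP f; rewrite {}ef {f} in h *.
rewrite (mon_ofE K ua); apply/to_birP; apply: rat_eq_generic hF.1 (mon_is_rat K a) _.
apply: genericS (genericI (generic_torus K 3) (rat_generic hF.1)) => x _ [[t ht e] Fx].
apply: same_point_trans (mev_same hF.1 e) _.
apply: same_point_trans (mev_same (mon_is_rat K a) (same_point_sym e)).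
have [F' [hF' [/to_birP eF nF' sF']]] := h t ht.
apply: same_point_trans (same_point_sym (mon_map_same a ht)); apply: same_point_trans sF'.
apply: eF => //; first exact: chart0_neq0.
by rewrite -(same_point_neq0 (mev_same hF.1 e)).
Qed.

Theorem extension_trivial f : Phi f = 1%g.
Proof.
(* The kernel of Phi as a subset of the full Cremona group: Phi lives on a subtype, so membership
   carries a proof of being generated. *)
pose S : {pred Bir (Pn K 3)} := fun x => `[< exists h : generated gens x, Phi (GenGroup h) = 1%g >].
case: f => x hx; have /asboolP/(_ S) := hx.
suff gS : group_closed S.
  move=> /(_ gS) hS; have sub : {subset gens <= S}.
    move=> y; rewrite inE => /orP[/asboolP[g ->]|/W_mon_of[a ua ->]]; apply/asboolP.
      by exists (pgl_gen g); apply: pgl_image_trivial.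
    by exists (mon_gen a); apply: mon_image_trivial.
  by have /asboolP[h e] := hS sub; rewrite -e; congr (Phi _); apply: val_inj.
split.
  apply/asboolP; exists (generated_closed _).1; rewrite -(morph_g1 PhiM); congr (Phi _).
  exact: val_inj.
move=> y z /asboolP[hy ey] /asboolP[hz ez]; apply/asboolP.
exists ((generated_closed _).2 y z hy hz); rewrite -[RHS](mulgV 1%g) -{1}ey -ez -(morph_gV PhiM) -PhiM.
by congr (Phi _); apply: val_inj.
Qed.

End Extension.

Section GrassmannianAction.
Context (K : numClosedFieldType).

Lemma phiG_neq1 : exists g : PGL K 4, phiG g <> 1%g.
Proof.
have uA : elem_mx 0 1 1 \in @unitmx K 4 by apply: elem_mx_unit.
exists (to_pgl uA) => e; have l1 : @linear_lift K 1%g (ext2 (elem_mx 0 1 1)).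
  by exists (ext2_stable uA); rewrite -e phiGE.
(* This off-diagonal entry of [ext2] is the minor of rows 0, 2 and columns 1, 2, equal to 1, so the
   matrix is not scalar. *)
have [c _ /matrixP/(_ (@Ordinal 6 1 isT) (@Ordinal 6 3 isT))] := linear_lift_uniq (linear_lift1 K) l1.
rewrite !mxE /= !(mulr0, addr0, add0r, mulr1, subr0) => /eqP.
by rewrite oner_eq0.
Qed.

Lemma alpha_surj n (g : PGL K n) : exists h, g = alpha h.
Proof.
rewrite (to_pgl_repr g); set uA := gl_repP _; exists (to_pgl (contragredient_unit uA)).
rewrite alphaE; apply/to_pglP; exists 1; rewrite ?oner_eq0 // scale1r.
by rewrite -trmx_inv trmxK invmxK.
Qed.

(** An extension restricted to the generated subgroup would fall under [extension_trivial], and so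
    be trivial on PGL_4. *)
Lemma no_extension (psi : PGL K 4 -> Bir (G13 K)) (Phi : Bir (Pn K 3) -> Bir (G13 K)) :
  (forall f g, Phi (f * g)%g = (Phi f * Phi g)%g) ->
  (forall g, psi g \in Aut (G13 K)) -> (exists g, psi g <> 1%g) ->
  ~ forall g, Phi (pgl_bir g) = psi g.
Proof.
move=> PhiM psiAut [g ng] e; apply: ng; rewrite -e.
have M f1 f2 : Phi (gen_val (f1 * f2)%g) = (Phi (gen_val f1) * Phi (gen_val f2))%g.
  by rewrite -PhiM.
apply: (extension_trivial (M _) _ (GenGroup (pgl_gen g))) => f /asboolP[h ->].
by rewrite e.
Qed.

End GrassmannianAction.

Theorem proposition5p2 (R : realType) :
  (~ exists Phi : {multiplicative
         gen_group [predU pgl_sub R[i]%C 3 & W R[i]%C 3] -> Bir (G13 R[i]%C)},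
       (exists f, Phi f <> 1%g) /\
       (forall f, gen_val f \in pgl_sub R[i]%C 3 -> Phi f \in Aut (G13 R[i]%C)))
  /\
  (~ exists Phi : {multiplicative Bir (Pn R[i]%C 3) -> Bir (G13 R[i]%C)},
       forall g : PGL R[i]%C 4, Phi (pgl_bir g) = phiG g)
  /\
  (~ exists Phi : {multiplicative Bir (Pn R[i]%C 3) -> Bir (G13 R[i]%C)},
       forall g : PGL R[i]%C 4, Phi (pgl_bir g) = phiG (alpha g)).
Proof.
split; last split.
- move=> [Phi [[f nf] PhiAut]]; apply: nf.
  by apply: (@extension_trivial _ Phi) => // g h; apply: gmulfM.
- move=> [Phi]; apply: no_extension => [f g||]; first exact: gmulfM.
    exact: phiG_Aut.
  exact: phiG_neq1.
- move=> [Phi]; apply: (@no_extension _ (fun g => phiG (alpha g))) => [f g|g|]; first exact: gmulfM.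
    exact: phiG_Aut.
  by have [g ng] := phiG_neq1 R[i]%C; have [h eh] := alpha_surj g; exists h; rewrite -eh.
Qed.
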